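(* Let $p<p'<2p$ be coprime positive integers whose continued fraction data (see context) satisfy $\nu_0,\nu_n\ge1$ and $\nu_j>1$ for $1\le j\le n-1$. Let $s=l_{\sigma+1}$ be a single Takahashi–Suzuki length and let $(b,r)$ be one of the pairs of Cases 1, 2a, 2b, 3, 4 of the context (so that the choice of $b$ fixes $r$), with $1\le b,s\le p'-1$, $1\le r\le p-1$. Let $\lambda=|b-s|$, and let $N\ge1$, $0\le\ell<N$ be integers with $s+b+N(b-r)+\ell$ even. Put $P=p'$, $P'=p'+N(p'-p)$, and assume $1\le b+N(b-r)\le P'-1$. Then $$\hat\chi^{(p',\,p'+N(p'-p);\,N)}_{s,\,b+N(b-r);\,\ell}(q)=q^{-\frac{\ell(N-\ell)+(N+1)\lambda^2}{4N}}\sum_{\substack{m\in\mathbb{Z}_{\ge0}^N\\ m\equiv Q \,(\mathrm{mod}\,2)}}q^{\frac14 m^TC^{(N)}m}\;\prod_{j=1}^{N-1}\begin{bmatrix}m_j+n_j\\ m_j\end{bmatrix}\;\frac{F^{(p,p')}_{r,s}(m_N,b;1/q)}{(q)_{m_N}},$$ where $n$ is determined by $m+n=\frac12\bigl(\mathcal I_{C^{(N)}}m+e_\ell\bigr)$ and $Q=(e_{\ell+1}+e_{\ell+3}+\cdots)+(b-r+1)(e_1+e_3+\cdots)$.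
   Context: Notation: $(q)_n=\prod_{i=1}^n(1-q^i)$, $(q)_\infty=\prod_{i\ge1}(1-q^i)$; all identities are between formal series in (fractional powers of) $q$. $\begin{bmatrix}a+c\\ c\end{bmatrix}=\frac{(q)_{a+c}}{(q)_a(q)_c}$ if $a,c\in\mathbb{Z}_{\ge0}$, and $0$ otherwise. $e_i$ is the $i$-th unit vector in $\mathbb{Z}^N$, $e_i=0$ if $i\notin\{1,\dots,N\}$. $\mathcal I_{C^{(N)}}$ and $C^{(N)}$ are the incidence and Cartan matrices of $A_N$: $(\mathcal I_{C^{(N)}})_{i,j}=\delta_{|i-j|,1}$, $C^{(N)}=2I-\mathcal I_{C^{(N)}}$ ($N\times N$). $m\equiv Q\pmod 2$ is meant componentwise. Continued fraction data: $\frac{p'}{p'-p}=1+\nu_0+\cfrac1{\nu_1+\cfrac1{\nu_2+\cdots+\cfrac1{\nu_n+2}}}$; $t_0=-1$, $t_i=\sum_{j=0}^{i-1}\nu_j$ for $1\le i\le n+1$. Takahashi–Suzuki lengths $l$ and truncated lengths $\bar l$: $y_{-1}=0,\ y_0=1$, $\bar y_{-1}=-1,\ \bar y_0=1$, $y_{m+1}=y_{m-1}+(\nu_m+\delta_{m,0}+2\delta_{m,n})y_m$ and likewise for $\bar y$; for $0\le j\le t_{n+1}+1$, $l_{j+1}=y_{m-1}+(j-t_m)y_m$ and $\bar l_{j+1}=\bar y_{m-1}+(j-t_m)\bar y_m$, where $t_m<j\le t_{m+1}+\delta_{m,n}$, $0\le m\le n$. Cases for $(b,r)$: - Case 1: $b=l_{\beta+1}$,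 $r=\bar l_{\beta+1}$, with $t_\xi<\beta\le t_{\xi+1}+\delta_{\xi,n}$, $0\le\xi\le n$. - Case 2a: $b=l_{\beta+1}-j$, $r=\bar l_{\beta+1}$, with $t_\xi+\delta_{\xi,1}<\beta<t_{\xi+1}+\delta_{\xi,n}$, $1\le\xi\le n$, $1\le j<\nu_0$. - Case 2b: $b=l_{\beta+1}+1+j$, $r=1+\bar l_{\beta+1}$, with $t_\xi<\beta<t_{\xi+1}+\delta_{\xi,n}$, $1\le\xi\le n$, $0\le j\le\nu_0$. - Case 3: $b=\sum_{m=0}^\xi l_{\beta_m+1}$, $r=\sum_{m=0}^\xi\bar l_{\beta_m+1}$, with $0\le\beta_0\le\nu_0-1$, $t_m<\beta_m\le t_{m+1}-3$ ($1\le m\le\xi-2$), $t_{\xi-1}<\beta_{\xi-1}\le t_\xi-2$, $t_\xi<\beta_\xi\le t_{\xi+1}-1$, $1\le\xi\le n$. - Case 4: $b=\sum_{m=\zeta}^\xi l_{\beta_m+1}$, $r=\sum_{m=\zeta}^\xi\bar l_{\beta_m+1}$, with $t_m<\beta_m\le t_{m+1}-3$ ($\zeta\le m\le\xi-2$), $t_{\xi-1}<\beta_{\xi-1}\le t_\xi-2$, $t_\xi<\beta_\xi\le t_{\xi+1}-1$, $1\le\zeta<\xi\le n$. $F^{(p,p')}_{r,s}(L,b)=F^{(p,p')}_{r,s}(L,b;q)$ is the (fermionic) $M(p,p')$ polynomial, equal to the bosonic polynomial $$B^{(p,p')}_{r,s}(L,b)=\sum_{j\in\mathbb{Z}}\left(q^{j(jpp'+rp'-sp)}\begin{bmatrix}L\\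 \frac12(L+s-b)-jp'\end{bmatrix}-q^{(jp+r)(jp'+s)}\begin{bmatrix}L\\ \frac12(L-s-b)-jp'\end{bmatrix}\right);$$ $F^{(p,p')}_{r,s}(L,b;1/q)$ is obtained by replacing $q$ by $1/q$. Let $C$ be the Cartan matrix of $A_{N-1}$ ($C_{ij}=2\delta_{ij}-\delta_{|i-j|,1}$). The level-$N$ $A_1^{(1)}$ string functions ($m+\ell$ even) are $$c^\ell_m(q)=\frac{q^{\frac{\ell(N-\ell)}{2N(N+2)}}}{(q)_\infty}\sum_{\substack{n\in\mathbb{Z}_{\ge0}^{N-1}\\ \frac{m+\ell}{2N}+(C^{-1}n)_1\in\mathbb{Z}}}\frac{q^{n^TC^{-1}(n-e_\ell)}}{(q)_{n_1}\cdots(q)_{n_{N-1}}}$$ (here $e_\ell\in\mathbb{Z}^{N-1}$, $e_0=0$; for $N=1$ there is only the empty vector and $(C^{-1}n)_1=0$); they satisfy $c^\ell_m=c^\ell_{-m}=c^\ell_{m+2N}=c^{N-\ell}_{N-m}$. The normalized branching functions of the coset $(P,P')_N$, i.e. $(A^{(1)}_1)_N\times(A_1^{(1)})_{N'}/(A^{(1)}_1)_{N+N'}$ with $N'=NP/(P'-P)-2$, are $$\hat\chi^{(P,P';N)}_{R,S;\ell}(q)=q^{-\frac{\ell(N-\ell)}{2N(N+2)}}\sum_{0\le m\le N/2}c^\ell_{2m}(q)\Biggl(\sum_{\substack{j\in\mathbb{Z}\\ \mu_{R-S}(j)\equiv\pm m\bmod N}}q^{\frac jN(jPP'+P'R-PS)}-\sum_{\substack{j\in\mathbb{Z}\\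 \mu_{R+S}(j)\equiv\pm m\bmod N}}q^{\frac1N(jP'+S)(jP+R)}\Biggr),$$ for $1\le R\le P-1$, $1\le S\le P'-1$, $R-S\equiv\ell \pmod 2$, with $\mu_a(j)=a/2+P'j$, and $m$ running over integers if $\ell$ is even and over half-odd-integers if $\ell$ is odd. *)

(* Defs.v *)
From HB Require Import structures.
From mathcomp Require Import all_boot all_order all_algebra.
From mathcomp Require Import all_classical.

Set Implicit Arguments.
Unset Strict Implicit.
Unset Printing Implicit Defensive.
Import Order.TTheory GRing.Theory Num.Theory.
Local Open Scope ring_scope.
Local Open Scope classical_set_scope.

(* [f x] is the coefficient of q^x. No support condition is built in: infinite
   sums and products are computed coefficientwise with the finitely supported
   sums [\sum_(i \in A) _] (which return 0 on an infinite support), and they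
   are only used on families that contribute finitely many nonzero terms to
   each coefficient. *)
Definition qseries := rat -> int.

Declare Scope qseries_scope.
Delimit Scope qseries_scope with QS.
Bind Scope qseries_scope with qseries.

Definition qpow (x : rat) : qseries := fun y => (y == x)%:R.
Definition qzero : qseries := fun=> 0.
Definition qone : qseries := qpow 0.
Definition qadd (f g : qseries) : qseries := fun x => f x + g x.
Definition qsub (f g : qseries) : qseries := fun x => f x - g x.

(* The Cauchy product. The product that MathComp infers on [rat -> int] is
   the pointwise one, hence the separate scope. *)
Definition qmul (f g : qseries) : qseries :=
  fun x => \sum_(y \in [set: rat]) f y * g (x - y).

Notation "f + g" := (qadd f g) : qseries_scope.
Notation "f - g" := (qsub f g) : qseries_scope.
Notation "f * g" := (qmul f g) : qseries_scope.

Definition qsum (I : choiceType) (A : set I) (F : I -> qseries) : qseries :=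
  fun x => \sum_(i \in A) F i x.

(* For f = 1 + (terms of positive integral degree), 1/f as the geometric
   series in 1 - f. *)
Definition qinv (f : qseries) : qseries :=
  qsum [set: nat] (fun k => iter k (qmul (qone - f)%QS) qone).

(* q -> 1/q, for Laurent polynomials *)
Definition qflip (f : qseries) : qseries := fun x => f (- x).

(* (q)_n *)
Definition qpoch (n : nat) : qseries :=
  \big[qmul/qone]_(1 <= i < n.+1) (qone - qpow i%:R)%QS.

(* (q)_oo : the factors 1 - q^i with i > x do not affect the coefficient
   of q^x. *)
Definition qpoch_inf : qseries := fun x => qpoch (Num.truncn x) x.

(* [qbinom A c] is the q-binomial with upper entry A = a + c and lower entry
   c; it is 0 unless a and c are both nonnegative integers. *)
Definition qbinom (A c : rat) : qseries :=
  if (A - c \is a Num.nat) && (c \is a Num.nat) then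
    (qpoch (Num.truncn A) *
     (qinv (qpoch (Num.truncn (A - c))) * qinv (qpoch (Num.truncn c))))%QS
  else qzero.

(* Vectors are indexed from 1 : [coord v i] is v_i for 1 <= i <= n, and 0
   otherwise; [unitv n i] is e_i, which is 0 for i outside {1, ..., n}. *)
Definition coord (R : nmodType) (n : nat) (v : 'cV[R]_n) (i : nat) : R :=
  \sum_(k < n | k.+1 == i) v k 0.

Definition unitv (R : pzRingType) (n i : nat) : 'cV[R]_n :=
  \col_(k < n) (k.+1 == i)%:R.

Definition incidence (n : nat) : 'M[rat]_n :=
  \matrix_(i < n, j < n) ((i.+1 == j) || (j.+1 == i))%:R.

Definition cartan (n : nat) : 'M[rat]_n := 2%:M - incidence n.

Definition toQ (n : nat) (m : 'cV[nat]_n) : 'cV[rat]_n :=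
  map_mx (fun k : nat => k%:R) m.

Definition bilin (n : nat) (u : 'cV[rat]_n) (A : 'M[rat]_n) (v : 'cV[rat]_n) :
  rat := (u^T *m A *m v) 0 0.

(* nu_i + 1/(nu_{i+1} + ... + 1/(nu_{i+d} + 2)) *)
Fixpoint contfrac (nu : nat -> nat) (i d : nat) : rat :=
  if d is d'.+1 then (nu i)%:R + (contfrac nu i.+1 d')^-1
  else (nu i)%:R + 2.

Definition tk (nu : nat -> nat) (i : nat) : int :=
  if i is 0%N then -1 else (\sum_(0 <= j < i) nu j)%:Z.

(* [ypair nu n a k] is the pair (y_{k-1}, y_k) for the recursion started at
   y_{-1} = a, y_0 = 1. *)
Fixpoint ypair (nu : nat -> nat) (n : nat) (a : int) (k : nat) : int * int :=
  if k is m.+1 then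
    let: (u, v) := ypair nu n a m in
    (v, u + (nu m + (m == 0%N) + 2 * (m == n))%N%:Z * v)
  else (a, 1).

Definition inzone (nu : nat -> nat) (n m : nat) (j : int) : bool :=
  (tk nu m < j) && (j <= tk nu m.+1 + (m == n)%:R).

(* The zones are disjoint, so at most one m contributes to the sum. *)
Definition gen_length (a : int) (nu : nat -> nat) (n : nat) (j : int) : int :=
  \sum_(m < n.+1 | inzone nu n m j)
    ((ypair nu n a m).1 + (j - tk nu m) * (ypair nu n a m).2).

(* l_{j+1} and \bar l_{j+1}, for 0 <= j <= t_{n+1} + 1 *)
Definition tslen := gen_length 0.
Definition tslen_bar := gen_length (-1).

Definition case1 (nu : nat -> nat) (n : nat) (b r : int) : Prop :=
  exists (xi : nat) (beta : int),
    [/\ (xi <= n)%N,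
        tk nu xi < beta <= tk nu xi.+1 + (xi == n)%:R,
        b = tslen nu n beta & r = tslen_bar nu n beta].

Definition case2a (nu : nat -> nat) (n : nat) (b r : int) : Prop :=
  exists (xi : nat) (beta j : int),
    [/\ (1 <= xi <= n)%N,
        tk nu xi + (xi == 1%N)%:R < beta < tk nu xi.+1 + (xi == n)%:R,
        1 <= j < (nu 0%N)%:Z,
        b = tslen nu n beta - j & r = tslen_bar nu n beta].

Definition case2b (nu : nat -> nat) (n : nat) (b r : int) : Prop :=
  exists (xi : nat) (beta j : int),
    [/\ (1 <= xi <= n)%N,
        tk nu xi < beta < tk nu xi.+1 + (xi == n)%:R,
        0 <= j <= (nu 0%N)%:Z,
        b = tslen nu n beta + 1 + j & r = 1 + tslen_bar nu n beta].

(* t_m < beta_m <= t_{m+1} - 3 for lo <= m <= xi - 2,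
   t_{xi-1} < beta_{xi-1} <= t_xi - 2 and t_xi < beta_xi <= t_{xi+1} - 1 *)
Definition zone_chain (nu : nat -> nat) (lo xi : nat) (beta : nat -> int) :
    Prop :=
  [/\ forall m : nat, (lo <= m)%N -> (m + 2 <= xi)%N ->
        tk nu m < beta m <= tk nu m.+1 - 3,
      tk nu xi.-1 < beta xi.-1 <= tk nu xi - 2 &
      tk nu xi < beta xi <= tk nu xi.+1 - 1].

Definition case3 (nu : nat -> nat) (n : nat) (b r : int) : Prop :=
  exists (xi : nat) (beta : nat -> int),
    [/\ (1 <= xi <= n)%N,
        0 <= beta 0%N <= (nu 0%N)%:Z - 1,
        zone_chain nu 1 xi beta,
        b = \sum_(0 <= m < xi.+1) tslen nu n (beta m) &
        r = \sum_(0 <= m < xi.+1) tslen_bar nu n (beta m)].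

Definition case4 (nu : nat -> nat) (n : nat) (b r : int) : Prop :=
  exists (zeta xi : nat) (beta : nat -> int),
    [/\ [&& (1 <= zeta)%N, (zeta < xi)%N & (xi <= n)%N],
        zone_chain nu zeta xi beta,
        b = \sum_(zeta <= m < xi.+1) tslen nu n (beta m) &
        r = \sum_(zeta <= m < xi.+1) tslen_bar nu n (beta m)].

Definition br_case (nu : nat -> nat) (n : nat) (b r : int) : Prop :=
  case1 nu n b r \/ case2a nu n b r \/ case2b nu n b r \/
  case3 nu n b r \/ case4 nu n b r.

(* In bosonic form, to which the fermionic polynomial F is equal. *)
Definition Mpoly (p p' r s : int) (L : nat) (b : int) : qseries :=
  qsum [set: int] (fun j =>
    qpow (j * (j * p * p' + r * p' - s * p))%:~R *
      qbinom L%:R ((L%:Z + s - b)%:~R / 2 - (j * p')%:~R)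
    - qpow ((j * p + r) * (j * p' + s))%:~R *
      qbinom L%:R ((L%:Z - s - b)%:~R / 2 - (j * p')%:~R))%QS.

Definition string_exp (N l : nat) : rat :=
  l%:R * (N%:R - l%:R) / (2 * N%:R * (N%:R + 2)).

Definition string_set (N l : nat) (m : int) : set 'cV[nat]_N.-1 :=
  [set v | (m + l%:Z)%:~R / (2 * N%:R)
             + coord (invmx (cartan N.-1) *m toQ v) 1 \is a Num.int].

Definition string_term (N l : nat) (v : 'cV[nat]_N.-1) : qseries :=
  (qpow (bilin (toQ v) (invmx (cartan N.-1)) (toQ v - unitv _ N.-1 l))
   * \big[qmul/qone]_(i < N.-1) qinv (qpoch (v i 0)))%QS.

(* c^l_m at level N. For N = 1 the only vector is the empty one, all of whose
   coordinates [coord _ i] are 0. *)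
Definition stringf (N l : nat) (m : int) : qseries :=
  (qpow (string_exp N l) *
   (qinv qpoch_inf * qsum (@string_set N l m) (@string_term N l)))%QS.

Definition congQ (N : nat) (x y : rat) : bool := (x - y) / N%:R \is a Num.int.

Definition mu (P' a j : int) : rat := a%:~R / 2 + (P' * j)%:~R.

(* The j with mu_a(j) = m or mu_a(j) = -m mod N *)
Definition mu_set (N : nat) (P' a : int) (m : rat) : set int :=
  [set j | congQ N (mu P' a j) m || congQ N (mu P' a j) (- m)].

(* The normalized branching function of the coset (P, P')_N. The summation
   index m of the formula, an integer or a half-odd-integer according to the
   parity of l, is k / 2. *)
Definition branching (P P' : int) (N : nat) (R S : int) (l : nat) : qseries :=
  (qpow (- string_exp N l) *
   \big[qadd/qzero]_(0 <= k < N.+1 | odd k == odd l)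
     (stringf N l k%:Z *
      (qsum (mu_set N P' (R - S) (k%:R / 2))
         (fun j => qpow ((j * (j * P * P' + P' * R - P * S))%:~R / N%:R))
       - qsum (mu_set N P' (R + S) (k%:R / 2))
         (fun j => qpow (((j * P' + S) * (j * P + R))%:~R / N%:R)))))%QS.

(* (e_{l+1} + e_{l+3} + ...) + (d + 1) (e_1 + e_3 + ...) in Z^N *)
Definition parityQ (N l : nat) (d : int) : 'cV[int]_N :=
  \sum_(0 <= i < N) unitv _ N (l + 1 + 2 * i)
  + (d + 1) *: \sum_(0 <= i < N) unitv _ N (1 + 2 * i).

Definition parity_set (N : nat) (Q : 'cV[int]_N) : set 'cV[nat]_N :=
  [set m : 'cV[nat]_N |
    forall k : 'I_N, ((m k ord0)%:Z = Q k ord0 %[mod 2])%Z].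

(* n, given by m + n = (I m + e_l) / 2 *)
Definition nvec (N l : nat) (m : 'cV[nat]_N) : 'cV[rat]_N :=
  2^-1 *: (incidence N *m toQ m + unitv _ N l) - toQ m.

Definition fermi_term (p p' r s b : int) (N l : nat) (m : 'cV[nat]_N) :
    qseries :=
  (qpow (bilin (toQ m) (cartan N) (toQ m) / 4) *
   (\big[qmul/qone]_(1 <= j < N)
      qbinom ((coord m j)%:R + coord (nvec l m) j) (coord m j)%:R *
    (qflip (Mpoly p p' r s (coord m N) b) *
     qinv (qpoch (coord m N)))))%QS.

(* Main.v *)
Require Import Defs.
From HB Require Import structures.
From mathcomp Require Import all_boot all_order all_algebra.
From mathcomp Require Import all_classical.
From mathcomp Require Import zify ring lra.

Set Implicit Arguments.
Unset Strict Implicit.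
Unset Printing Implicit Defensive.
Import Order.TTheory GRing.Theory Num.Theory.
Local Open Scope ring_scope.
Local Open Scope classical_set_scope.

(* Put d = b - r, e_j = d + [j <= l] and E = e_1 + ... + e_N, and substitute
   m_j = 2 (x_1 + ... + x_j) + (e_1 + ... + e_j) with integers x_j. Then
   (m^T C m - m_N^2) / 4 = sum_j (x_j + e_j / 2)^2 and n_j = x_{j+1} - x_j, and
   every term of the bosonic form of F(m_N, b; 1/q) / (q)_{m_N} is a power of q
   times 1 / ((q)_{X-B} (q)_{X+B+E}), where X = x_1 + ... + x_N and B depends on
   the term only. The theorem follows term by term from the identity
     sum_{y in Z^N, y_1 + ... + y_N = B} q^{sum y_j^2 + e_j y_j}
         prod_{j<N} 1 / (q)_{y_{j+1}-y_j}
     = (q)_oo sum_{x in Z^N} q^{sum x_j^2 + e_j x_j}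
         prod_{j<N} [m_j + n_j; m_j] / ((q)_{X-B} (q)_{X+B+E})
   (lemma [spinon_fermion]), valid for e_1 >= ... >= e_N: its left side is a
   string function in the variables n_j = y_{j+1} - y_j. The identity is proved
   by induction on N. Euler's expansion of 1 / (q)_{y-v} in powers of q^{y-v}
   reduces the sum over y_1, ..., y_{N-1} to the identity for N - 1 with e_{N-1}
   replaced by e_{N-1} - k, k >= 0, and what remains is an identity between
   sums over one variable (lemma [transformation]), a consequence of the
   q-binomial theorem and of the Durfee rectangle identity. *)

(** Replacing q by 1/q multiplies [L; c] by q^{-c(L-c)}, and for 2c = L - a one has c(L-c) = (L^2 -
    a^2)/4. The part L^2/4, with L = m_N, cancels the square m_N^2/4 of the quadratic form. The part
    a^2/4 makes the exponent of each bosonic term quadratic in its summation index, with leading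
    coefficient p'(p'-p) > 0. Convergence is the main obstacle. All sums run over whole lattices,
    their ranges being cut out by 1/(q)_n = 0 for n < 0, and the powers q^{-kv} of Euler's expansion
    work against the quadratic exponents. Every exchange of sums therefore rests on a lower bound of
    the valuations by a coercive weight. The condition e_1 >= ... >= e_N enters in these bounds, and
    again in each induction step when finite products (q^a; q)_n are recognized as q-binomials. The
    right side of the identity is symmetric under B -> -B-E. This yields the symmetry c_{-m} = c_m
    of the string functions, which is needed to unfold the restricted range of m in the branching
    function. *)

(** * Finitely supported sums of integers *)

Lemma fsum_widen (I : choiceType) (A : set I) (F : I -> int) :
  (forall i, ~ A i -> F i = 0) ->
  \sum_(i \in [set: I]) F i = \sum_(i \in A) F i.
Proof.
by move=> F0; apply/esym/fsbig_widen => // i [_ /F0].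
Qed.

Lemma fsum_pair (I J : choiceType) (F : I -> J -> int) :
  finite_set [set ij | F ij.1 ij.2 != 0] ->
  \sum_(i \in [set: I]) \sum_(j \in [set: J]) F i j
  = \sum_(ij \in [set: I * J]) F ij.1 ij.2.
Proof.
set S := (X in finite_set X) => finS.
set A := fst @` S; set B := snd @` S.
have finA : finite_set A by apply: finite_image.
have finB : finite_set B by apply: finite_image.
have F0 i j : F i j != 0 -> A i /\ B j by move=> nz; split; exists (i, j).
have {}F0 i j : ~ (A i /\ B j) -> F i j = 0.
  by move=> nAB; apply/eqP; apply: contraT => /F0.
rewrite (@fsum_widen _ A); last first.
  by move=> i nA; apply: fsbig1 => j _; apply: F0 => -[].
transitivity (\sum_(i \in A) \sum_(j \in B) F i j).
  apply: eq_fsbigr => i _; apply: fsum_widen => j nB.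
  by apply: F0 => -[].
rewrite pair_fsbig //; apply/esym/fsum_widen => -[i j] nAB.
exact: F0.
Qed.

Lemma fsum_exchange (I J : choiceType) (F : I -> J -> int) :
  finite_set [set ij | F ij.1 ij.2 != 0] ->
  \sum_(i \in [set: I]) \sum_(j \in [set: J]) F i j
  = \sum_(j \in [set: J]) \sum_(i \in [set: I]) F i j.
Proof.
move=> finF; rewrite fsum_pair // (fsum_pair (F := fun j i => F i j)); last first.
  have -> : [set ij : J * I | F ij.2 ij.1 != 0]
            = (fun ij : I * J => (ij.2, ij.1)) @` [set ij | F ij.1 ij.2 != 0].
    apply/seteqP; split=> [[j i] nz|_ [[i j] nz <-] //].
    by exists (i, j).
  exact: finite_image.
by rewrite (reindex_fsbigT (fun ij : J * I => (ij.2, ij.1))) //;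
   exists (fun ij : I * J => (ij.2, ij.1)) => -[].
Qed.

Lemma fsumD (I : choiceType) (F G : I -> int) :
  finite_set [set i | F i != 0] -> finite_set [set i | G i != 0] ->
  \sum_(i \in [set: I]) (F i + G i)
  = \sum_(i \in [set: I]) F i + \sum_(i \in [set: I]) G i.
Proof.
set A := [set i | F i != 0]; set B := [set i | G i != 0] => fA fB.
have H (H : I -> int) : (forall i, H i != 0 -> A i \/ B i) ->
    \sum_(i \in [set: I]) H i = \sum_(i \in A `|` B) H i.
  move=> nz; apply: fsum_widen => i nAB; apply/eqP; apply: contraT => /nz.
  by move/nAB.
have Hf i : F i != 0 -> A i \/ B i by left.
have Hg i : G i != 0 -> A i \/ B i by right.
have Hfg i : F i + G i != 0 -> A i \/ B i.
  by have [->|nz _] := eqVneq (F i) 0; [rewrite add0r => nz; right|left].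
by rewrite (H F Hf) (H G Hg) (H _ Hfg) -fsbig_split // finite_setU.
Qed.

(** * The ring of series with locally finite support *)

(** Such a support is bounded below, and fractional degrees need no common denominator. In the
    Cauchy product of two such series every coefficient is a finite sum. *)
Definition lfin (f : qseries) :=
  forall x, finite_set [set y | f y != 0 /\ y <= x].

Lemma lfin_lbound f : lfin f -> exists b, forall y, f y != 0 -> b <= y.
Proof.
move=> /(_ 0) /finite_seqP[s sE].
have [b bP] : exists b, forall y : rat, y \in s -> b <= y.
  elim: s {sE} => [|a s [b bP]]; first by exists 0.
  exists (Num.min a b) => y; rewrite inE => /orP[/eqP->|/bP]; first by rewrite ge_min lexx.
  by move=> le_by; rewrite ge_min le_by orbT.
exists (Num.min 0 b) => y nz; rewrite ge_min.
have [//|y_lt0] := leP 0 y; rewrite bP //.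
suff : [set` s] y by [].
by rewrite -sE /=; split=> //; exact: ltW.
Qed.

Lemma lfin_const0 : lfin (fun=> 0).
Proof. by move=> x; rewrite (_ : [set _ | _] = set0) // -subset0 => y []. Qed.

Lemma lfin_qpow x : lfin (qpow x).
Proof.
move=> z; apply: (@sub_finite_set _ _ [set x]); last exact: finite_set1.
by move=> y [+ _]; rewrite /qpow; case: (eqVneq y x) => // _; rewrite eqxx.
Qed.

Lemma lfin_add f g : lfin f -> lfin g -> lfin (qadd f g).
Proof.
move=> Hf Hg x; pose S h := [set y | (h : qseries) y != 0 /\ y <= x].
apply: (@sub_finite_set _ _ (S f `|` S g)); last first.
  by rewrite finite_setU; split; [exact: Hf|exact: Hg].
move=> y [nz le_yx]; have [f0|] := eqVneq (f y) 0; last by left.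
by right; split=> //; rewrite /qadd f0 add0r in nz.
Qed.

Lemma lfin_opp f : lfin f -> lfin (fun x => - f x).
Proof.
by move=> Hf x; apply: sub_finite_set (Hf x) => y; rewrite /= oppr_eq0.
Qed.

Lemma lfin_mul_supp f g x : lfin f -> lfin g ->
  finite_set [set yz : rat * rat |
    [/\ f yz.1 != 0, g yz.2 != 0 & yz.1 + yz.2 <= x]].
Proof.
move=> Hf Hg; have [a aP] := lfin_lbound Hf; have [b bP] := lfin_lbound Hg.
apply: (@sub_finite_set _ _ ([set y | f y != 0 /\ y <= x - b] `*`
                             [set z | g z != 0 /\ z <= x - a])).
  by move=> [y z] /= [fn gn le]; have := aP _ fn; have := bP _ gn; do !split=> //; lra.
exact: finite_setX.
Qed.

Lemma lfin_mul f g : lfin f -> lfin g -> lfin (qmul f g).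
Proof.
move=> Hf Hg x; apply: sub_finite_set (finite_image
  (fun yz => yz.1 + yz.2) (lfin_mul_supp x Hf Hg)) => w [nz le_wx].
have [y _ nzy] := fsbigN1 (f := fun w y => f y * g (w - y)) nz.
move: nzy; rewrite mulf_eq0 negb_or => /andP[fn gn].
by exists (y, w - y) => /=; rewrite ?subrKC //; split.
Qed.

Record ser := Ser { coef :> rat -> int; coef_lfin : lfin coef }.

Lemma ser_ext (f g : ser) : (forall x, f x = g x) -> f = g.
Proof.
case: f g => [f Hf] [g Hg] /= fg; have {}fg : f = g by apply/funext.
by case: _ / fg Hg => Hg; congr Ser; exact: Prop_irrelevance.
Qed.

HB.instance Definition _ := gen_eqMixin ser.
HB.instance Definition _ := gen_choiceMixin ser.

HB.lock Definition ser0 : ser := Ser lfin_const0.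
HB.lock Definition serD (f g : ser) : ser :=
  Ser (lfin_add (coef_lfin f) (coef_lfin g)).
HB.lock Definition serN (f : ser) : ser := Ser (lfin_opp (coef_lfin f)).
HB.lock Definition serM (f g : ser) : ser :=
  Ser (lfin_mul (coef_lfin f) (coef_lfin g)).
HB.lock Definition mono (x : rat) : ser := Ser (lfin_qpow x).

Lemma serDA : associative serD.
Proof. by move=> f g h; apply: ser_ext => x; rewrite serD.unlock /= /qadd addrA. Qed.
Lemma serDC : commutative serD.
Proof. by move=> f g; apply: ser_ext => x; rewrite serD.unlock /= /qadd addrC. Qed.
Lemma ser0D : left_id ser0 serD.
Proof. by move=> f; apply: ser_ext => x; rewrite serD.unlock ser0.unlock /= /qadd add0r. Qed.
Lemma serND : left_inverse ser0 serN serD.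
Proof.
move=> f; apply: ser_ext => x.
by rewrite serD.unlock serN.unlock ser0.unlock /= /qadd addNr.
Qed.

HB.instance Definition _ := GRing.isZmodule.Build ser serDA serDC ser0D serND.

Lemma ser_coef0 x : (0 : ser) x = 0.
Proof. by rewrite -[0]/ser0 ser0.unlock. Qed.
Lemma ser_coefD (f g : ser) x : (f + g) x = f x + g x.
Proof. by rewrite -[f + g]/(serD f g) serD.unlock. Qed.
Lemma ser_coefN (f : ser) x : (- f) x = - f x.
Proof. by rewrite -[- f]/(serN f) serN.unlock. Qed.
Lemma ser_coefB (f g : ser) x : (f - g) x = f x - g x.
Proof. by rewrite ser_coefD ser_coefN. Qed.
Lemma serME (f g : ser) x : serM f g x = \sum_(y \in [set: rat]) f y * g (x - y).
Proof. by rewrite serM.unlock. Qed.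
Lemma ser_coef_mono x y : mono x y = (y == x)%:R.
Proof. by rewrite mono.unlock. Qed.

Lemma mul_supp (f g : ser) x : finite_set [set y | f y * g (x - y) != 0].
Proof.
apply: sub_finite_set (finite_image fst
  (lfin_mul_supp x (coef_lfin f) (coef_lfin g))) => y /=.
rewrite mulf_eq0 negb_or => /andP[fn gn]; exists (y, x - y) => //=.
by rewrite subrKC.
Qed.

Lemma serMC : commutative serM.
Proof.
move=> f g; apply: ser_ext => x; rewrite !serME.
rewrite (reindex_fsbigT (fun y => x - y)); last first.
  by exists (fun y => x - y) => y; rewrite subKr.
by apply: eq_fsbigr => y _; rewrite subKr mulrC.
Qed.

Lemma serMA : associative serM.
Proof.
move=> f g h; apply: ser_ext => x; rewrite !serME.
have fin : finite_set [set wy : rat * rat |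
    f wy.2 * g (wy.1 - wy.2) * h (x - wy.1) != 0].
  have [b bP] := lfin_lbound (coef_lfin h).
  apply: sub_finite_set (finite_image (fun yz => (yz.1 + yz.2, yz.1))
    (lfin_mul_supp (x - b) (coef_lfin f) (coef_lfin g))) => -[w y] /=.
  rewrite !mulf_eq0 !negb_or => /andP[/andP[fn gn] /bP hb].
  exists (y, w - y) => /=; last by rewrite subrKC.
  by split=> //; lra.
transitivity (\sum_(w \in [set: rat]) \sum_(y \in [set: rat])
    f y * g (w - y) * h (x - w)); last first.
  by apply: eq_fsbigr => w _; rewrite serME mulr_fsuml.
rewrite (fsum_exchange fin); apply: eq_fsbigr => y _.
rewrite serME mulr_fsumr (reindex_fsbigT (fun w => w - y)); last first.
  by exists (fun w => w + y) => w; rewrite ?subrK ?addrK.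
by apply: eq_fsbigr => w _; rewrite mulrA; congr (_ * h _); ring.
Qed.

Lemma ser1M : left_id (mono 0) serM.
Proof.
move=> f; apply: ser_ext => x; rewrite serME.
rewrite (@fsum_widen _ [set 0]); first by rewrite fsbig_set1 ser_coef_mono eqxx mul1r subr0.
by move=> y /eqP/negbTE y0; rewrite ser_coef_mono y0 mul0r.
Qed.

Lemma serMDl : left_distributive serM +%R.
Proof.
move=> f g h; apply: ser_ext => x; rewrite ser_coefD !serME -fsumD; first last.
- exact: mul_supp.
- exact: mul_supp.
by apply: eq_fsbigr => y _; rewrite ser_coefD mulrDl.
Qed.

Lemma ser1_neq0 : mono 0 != 0.
Proof.
by apply/eqP => /(congr1 (fun f : ser => f 0)); rewrite ser_coef_mono ser_coef0 eqxx.
Qed.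

HB.instance Definition _ := GRing.Zmodule_isComNzRing.Build ser
  serMA serMC ser1M serMDl ser1_neq0.

Lemma ser_coefM (f g : ser) x : (f * g) x = \sum_(y \in [set: rat]) f y * g (x - y).
Proof. exact: serME. Qed.

Lemma mono0 : mono 0 = 1. Proof. by []. Qed.

Lemma ser_coef_monoM x (f : ser) y : (mono x * f) y = f (y - x).
Proof.
rewrite ser_coefM (@fsum_widen _ [set x]); first by rewrite fsbig_set1 ser_coef_mono eqxx mul1r.
by move=> z /eqP/negbTE zx; rewrite ser_coef_mono zx mul0r.
Qed.

Lemma monoD x y : mono (x + y) = mono x * mono y.
Proof.
apply: ser_ext => z; rewrite ser_coef_monoM !ser_coef_mono; congr (_%:R).
by congr nat_of_bool; apply/eqP/eqP => [->|<-]; ring.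
Qed.

Lemma monoK x : mono x * mono (- x) = 1.
Proof. by rewrite -monoD subrr. Qed.

(** * Lower bounds on the valuation *)

Variant vge (f : ser) (x : rat) : Prop := Vge of forall y, y < x -> f y = 0.

Lemma vgeE x y (f : ser) : vge f x -> y < x -> f y = 0.
Proof. by case=> fx; exact: fx. Qed.

Lemma vgeW x y (f : ser) : y <= x -> vge f x -> vge f y.
Proof. by move=> le_yx [fx]; split=> z lt_zy; apply: fx; exact: lt_le_trans le_yx. Qed.

Lemma vge0 x : vge 0 x.
Proof. by split=> y _; rewrite ser_coef0. Qed.

Lemma vge_mono x : vge (mono x) x.
Proof. by split=> y lt; rewrite ser_coef_mono lt_eqF. Qed.

Lemma vge1 : vge 1 0.
Proof. exact: vge_mono. Qed.

Lemma vgeD (f g : ser) x : vge f x -> vge g x -> vge (f + g) x.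
Proof. by move=> [fx] [gx]; split=> y lt; rewrite ser_coefD fx ?gx ?addr0. Qed.

Lemma vgeN (f : ser) x : vge f x -> vge (- f) x.
Proof. by move=> [fx]; split=> y lt; rewrite ser_coefN fx ?oppr0. Qed.

Lemma vgeB (f g : ser) x : vge f x -> vge g x -> vge (f - g) x.
Proof. by move=> fx gx; apply/vgeD/vgeN. Qed.

Lemma vgeM (f g : ser) x y : vge f x -> vge g y -> vge (f * g) (x + y).
Proof.
move=> [fx] [gy]; split=> z lt; rewrite ser_coefM; apply: fsbig1 => w _.
have [lt_wx|le_xw] := ltP w x; first by rewrite fx ?mul0r.
by rewrite [g _]gy ?mulr0 //; lra.
Qed.

Lemma vgeM0 (f g : ser) : vge f 0 -> vge g 0 -> vge (f * g) 0.
Proof. by move=> f0 g0; rewrite -[0]addr0; exact: vgeM. Qed.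

Lemma vge_prod (I : Type) (s : seq I) (P : pred I) (F : I -> ser) :
  (forall i, P i -> vge (F i) 0) -> vge (\prod_(i <- s | P i) F i) 0.
Proof. by move=> F0; apply: (big_ind (fun f : ser => vge f 0)) => //;
  [exact: vge1|exact: vgeM0]. Qed.

Lemma ser_limit0 (f : ser) : (forall n : nat, vge f n%:R) -> f = 0.
Proof.
move=> H; apply: ser_ext => x; rewrite ser_coef0; have := archi_boundP (normr_ge0 x).
by move=> /(le_lt_trans (ler_norm x)); exact: vgeE (H _).
Qed.

(** * Summable families and their sums *)

(** Finiteness is asked for all degrees up to x at once. Finiteness of each coefficient separately
    would neither make the sum locally finite nor survive multiplication by a series: the q^{-i}
    have finite coefficient sums, their products with 1 + q + q^2 + ... do not. *)
Definition summable (I : choiceType) (F : I -> ser) :=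
  forall x, finite_set [set i | exists2 y, F i y != 0 & y <= x].

Lemma lsum_lfin (I : choiceType) (F : I -> ser) :
  summable F -> lfin (fun x => \sum_(i \in [set: I]) F i x).
Proof.
move=> sF x; apply: sub_finite_set (bigcup_finite (sF x) (F := fun i =>
  [set y | F i y != 0 /\ y <= x]) _) => [y [nz le_yx]|i _]; last first.
  exact: (coef_lfin (F i)).
have [i _ nzi] := fsbigN1 (f := fun y i => F i y) nz.
by exists i => //; exists y.
Qed.

(** The default 0 on families that are not summable keeps [vge_lsum] true of every family. *)
HB.lock Definition lsum (I : choiceType) (F : I -> ser) : ser :=
  if pselect (summable F) is left sF then Ser (lsum_lfin sF) else 0.

Section Lsum.
Variable I : choiceType.
Implicit Types F G : I -> ser.

Lemma ser_coef_lsum F x : summable F -> lsum F x = \sum_(i \in [set: I]) F i x.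
Proof. by move=> sF; rewrite lsum.unlock; case: pselect. Qed.

Lemma eq_lsum F G : (forall i, F i = G i) -> lsum F = lsum G.
Proof. by move=> FG; congr lsum; apply/funext. Qed.

Lemma eq_summable F G : (forall i, F i = G i) -> summable F -> summable G.
Proof. by move=> FG; have -> : F = G by apply/funext. Qed.

Lemma summable_coef F x : summable F -> finite_set [set i | F i x != 0].
Proof. by move=> /(_ x); apply: sub_finite_set => i nz; exists x. Qed.

Lemma summable_vge F (w : I -> rat) :
  (forall x, finite_set [set i | w i <= x]) ->
  (forall i, vge (F i) (w i)) -> summable F.
Proof.
move=> fw Fw x; apply: sub_finite_set (fw x) => i [y nz le_yx] /=.
rewrite leNgt; apply: contra_neqN nz => lt.
by apply: vgeE (Fw i) _; exact: le_lt_trans lt.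
Qed.

Lemma summable_supp F (A : set I) :
  finite_set A -> (forall i, ~ A i -> F i = 0) -> summable F.
Proof.
move=> fA F0 x; apply: sub_finite_set fA => i [y nz _].
by apply: contrapT => /F0 Fi0; rewrite Fi0 ser_coef0 eqxx in nz.
Qed.

Lemma summable_sub F (P : pred I) :
  summable F -> summable (fun i => if P i then F i else 0).
Proof.
move=> sF x; apply: sub_finite_set (sF x) => i [y]; case: (P i); last first.
  by rewrite ser_coef0 eqxx.
by move=> nz le; exists y.
Qed.

Lemma summableD F G : summable F -> summable G -> summable (fun i => F i + G i).
Proof.
move=> sF sG x; pose S H := [set i | exists2 y, (H : I -> ser) i y != 0 & y <= x].
apply: (@sub_finite_set _ _ (S F `|` S G)); last first.
  by rewrite finite_setU; split; [exact: sF|exact: sG].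
move=> i [y nz le]; have [f0|] := eqVneq (F i y) 0; last by left; exists y.
by right; exists y => //; rewrite ser_coefD f0 add0r in nz.
Qed.

Lemma lsumD F G : summable F -> summable G ->
  lsum (fun i => F i + G i) = lsum F + lsum G.
Proof.
move=> sF sG; apply: ser_ext => x; rewrite ser_coefD !ser_coef_lsum //; last exact: summableD.
rewrite -fsumD; try exact: summable_coef.
by apply: eq_fsbigr => i _; rewrite ser_coefD.
Qed.

Lemma summableM a F : summable F -> summable (fun i => a * F i).
Proof.
move=> sF x; have [b bP] := lfin_lbound (coef_lfin a).
apply: sub_finite_set (sF (x - b)) => i [y nz le].
move: nz; rewrite ser_coefM => nz.
have [z _ nzz] := fsbigN1 (f := fun y z => a z * F i (y - z)) nz.
move: nzz; rewrite mulf_eq0 negb_or => /andP[/bP bz Fn].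
by exists (y - z) => //; lra.
Qed.

Lemma lsumM a F : summable F -> a * lsum F = lsum (fun i => a * F i).
Proof.
move=> sF; apply: ser_ext => x; rewrite (ser_coef_lsum _ (summableM a sF)) ser_coefM.
transitivity (\sum_(y \in [set: rat]) \sum_(i \in [set: I]) a y * F i (x - y)).
  by apply: eq_fsbigr => y _; rewrite ser_coef_lsum // mulr_fsumr.
rewrite (@fsum_exchange _ _ (fun y i => a y * F i (x - y))).
  by apply: eq_fsbigr => i _; rewrite ser_coefM.
have [b bP] := lfin_lbound (coef_lfin a).
pose A := [set i | exists2 y, F i y != 0 & y <= x - b].
apply: sub_finite_set (bigcup_finite (sF (x - b)) (F := fun i =>
  (fun y => (y, i)) @` [set y | a y * F i (x - y) != 0]) _); last first.
  by move=> i _; apply: finite_image; exact: mul_supp.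
move=> [y i] /= nz; exists i; last by exists y.
move: nz; rewrite mulf_eq0 negb_or => /andP[/bP by_ Fn].
by exists (x - y) => //; lra.
Qed.

Lemma summableN F : summable F -> summable (fun i => - F i).
Proof.
by move=> /(summableM (-1)); apply: eq_summable => i; rewrite mulN1r.
Qed.

Lemma lsumN F : summable F -> lsum (fun i => - F i) = - lsum F.
Proof. by move=> sF; rewrite -mulN1r lsumM //; apply: eq_lsum => i; rewrite mulN1r. Qed.

Lemma vge_lsum F x : (forall i, vge (F i) x) -> vge (lsum F) x.
Proof.
move=> Fx; split=> y lt; rewrite lsum.unlock.
case: pselect => [sF|_]; last by rewrite ser_coef0.
by apply: fsbig1 => i _; exact: vgeE (Fx i) lt.
Qed.

Lemma lsum_fin F (s : seq I) : uniq s -> (forall i, i \notin s -> F i = 0) ->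
  lsum F = \sum_(i <- s) F i.
Proof.
move=> us F0; have sF : summable F.
  apply: (@summable_supp _ [set` s]); first exact: finite_seq.
  by move=> i /negP; exact: F0.
apply: ser_ext => x; rewrite ser_coef_lsum // (@fsum_widen _ [set` s]); last first.
  by move=> i /negP /F0 ->; rewrite ser_coef0.
rewrite -fsbig_seq //; elim: s {us F0} => [|i s IHs]; first by rewrite !big_nil ser_coef0.
by rewrite !big_cons ser_coefD IHs.
Qed.

Lemma lsum1 F i0 : (forall i, i != i0 -> F i = 0) -> lsum F = F i0.
Proof.
move=> F0; rewrite (@lsum_fin _ [:: i0]) ?big_seq1 // => i.
by rewrite inE; exact: F0.
Qed.

Lemma lsum0 F : (forall i, F i = 0) -> lsum F = 0.
Proof. by move=> F0; rewrite (@lsum_fin _ [::]) ?big_nil. Qed.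

Lemma lsum_set (F : I -> ser) (A : set I) x :
  summable (fun i => if i \in A then F i else 0) ->
  lsum (fun i => if i \in A then F i else 0) x = \sum_(i \in A) F i x.
Proof.
move=> sF; rewrite ser_coef_lsum // [RHS]fsbig_mkcond.
have -> : patch (fun=> 0) A (F ^~ x) = fun i => (if i \in A then F i else 0) x.
  by apply/funext => i; rewrite /patch; case: (i \in A); rewrite ?ser_coef0.
by [].
Qed.

End Lsum.

Lemma summable_reindex (I J : choiceType) (A : set J) (h : J -> I) (F : I -> ser) : set_inj A h ->
  summable F -> summable (fun j => if j \in A then F (h j) else 0).
Proof.
move=> hinj sF x.
set S := [set j | _]; have SA j : S j -> A j /\ exists2 y, F (h j) y != 0 & y <= x.
  case=> y; case: ifPn => [/[!inE] Aj nz le|_]; last by rewrite ser_coef0 eqxx.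
  by split=> //; exists y.
rewrite -(eq_finite_set (@inj_card_eq _ _ S h _)); last first.
  by move=> j j' /[!inE] /SA[Aj _] /SA[Aj' _]; apply: hinj; rewrite inE.
by apply: sub_finite_set (sF x) => _ [j /SA[_ Sj] <-].
Qed.

Lemma lsum_reindex (I J : choiceType) (A : set J) (h : J -> I) (F : I -> ser) : set_inj A h ->
  (forall i, ~ (h @` A) i -> F i = 0) -> summable F ->
  lsum F = lsum (fun j => if j \in A then F (h j) else 0).
Proof.
move=> hinj F0 sF; apply: ser_ext => x.
rewrite lsum_set; last exact: summable_reindex.
rewrite ser_coef_lsum // (@fsum_widen _ (h @` A)) ?fsbig_image // => i /F0 ->.
by rewrite ser_coef0.
Qed.

Lemma lsum_bij (I J : choiceType) (h : J -> I) (F : I -> ser) :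
  bijective h -> summable F -> lsum F = lsum (fun j => F (h j)).
Proof.
move=> [g gK hK] sF; rewrite (@lsum_reindex _ _ setT h) //.
- by apply: eq_lsum => j; rewrite in_setT.
- by move=> j j' _ _; exact: (can_inj gK).
- by move=> i []; exists (g i).
Qed.

Section Fubini.
Variables (I J : choiceType) (F : I -> J -> ser).
Hypothesis sF : summable (fun ij : I * J => F ij.1 ij.2).

Lemma summable_row i : summable (F i).
Proof.
move=> x; apply: sub_finite_set (finite_image snd (sF x)) => j [y nz le].
by exists (i, j) => //; exists y.
Qed.

Lemma summable_lsum : summable (fun i => lsum (F i)).
Proof.
move=> x; apply: sub_finite_set (finite_image fst (sF x)) => i [y nz le].
move: nz; rewrite ser_coef_lsum; last exact: summable_row.
move=> nz; have [j _ nzj] := fsbigN1 (f := fun y j => F i j y) nz.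
by exists (i, j) => //; exists y.
Qed.

Lemma summable_swap : summable (fun ji : J * I => F ji.2 ji.1).
Proof.
move=> x; apply: sub_finite_set (finite_image (fun ij => (ij.2, ij.1)) (sF x)).
by move=> [j i] [y nz le]; exists (i, j) => //; exists y.
Qed.

Lemma lsum_pair : lsum (fun i => lsum (F i)) = lsum (fun ij => F ij.1 ij.2).
Proof.
apply: ser_ext => x; rewrite (ser_coef_lsum x summable_lsum) (ser_coef_lsum x sF).
rewrite -(@fsum_pair _ _ (fun i j => F i j x)); last exact: summable_coef sF.
by apply: eq_fsbigr => i _; rewrite (ser_coef_lsum x (summable_row i)).
Qed.
End Fubini.

Lemma lsum_exchange (I J : choiceType) (F : I -> J -> ser) :
  summable (fun ij : I * J => F ij.1 ij.2) ->
  lsum (fun i => lsum (F i)) = lsum (fun j => lsum (fun i => F i j)).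
Proof.
move=> sF; apply: ser_ext => x.
have sF' : summable (fun ji : J * I => (fun j i => F i j) ji.1 ji.2).
  exact: (summable_swap sF).
rewrite (ser_coef_lsum x (summable_lsum sF)) (ser_coef_lsum x (summable_lsum (F := fun j i => F i j) sF')).
transitivity (\sum_(i \in [set: I]) \sum_(j \in [set: J]) F i j x).
  by apply: eq_fsbigr => i _; rewrite (ser_coef_lsum x (summable_row sF i)).
rewrite fsum_exchange; last exact: summable_coef sF.
apply: eq_fsbigr => j _; have sFj : summable (F^~ j) := summable_row (F := fun j i => F i j) sF' j.
by rewrite (ser_coef_lsum x sFj).
Qed.

Arguments summable_row {I J} F.
Arguments summable_lsum {I J} F.
Arguments lsum_pair {I J} F.
Arguments lsum_exchange {I J} F.

(** * Coercive weights and sums over the integers *)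

(** A family whose valuations are bounded below by a coercive weight, up to a constant, is summable;
    most summability proofs below have this form. *)
Definition coercive (I : Type) (w : I -> int) :=
  forall x : int, finite_set [set i | w i <= x].

Lemma coercive_int : coercive (fun k : int => `|k|).
Proof.
move=> x; apply: (@sub_finite_set _ _ ((fun n : nat => n%:Z - x) @` `I_((absz x).*2.+1))).
  by move=> k /= le; exists (absz (k + x)); lia.
exact: finite_image.
Qed.

Lemma coercive_pair (I J : Type) (v : I -> int) (w : J -> int) :
  coercive v -> coercive w -> (forall i, 0 <= v i) -> (forall j, 0 <= w j) ->
  coercive (fun ij : I * J => v ij.1 + w ij.2).
Proof.
move=> pv pw v0 w0 x; apply: sub_finite_set (finite_setX (pv x) (pw x)).
move=> [i j] /= le; have := v0 i; have := w0 j.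
by split=> /=; lia.
Qed.

Definition vgz (f : ser) (a : int) := vge f a%:~R.
Definition qz (k : int) : ser := mono k%:~R.

Lemma qz0 : qz 0 = 1. Proof. by []. Qed.
Lemma qzD a b : qz (a + b) = qz a * qz b.
Proof. by rewrite /qz rmorphD monoD. Qed.
Lemma qzK a : qz a * qz (- a) = 1.
Proof. by rewrite -qzD subrr. Qed.

Lemma vgzW a b f : b <= a -> vgz f a -> vgz f b.
Proof. by move=> le; apply: vgeW; rewrite ler_int. Qed.
Lemma vgz_qz a : vgz (qz a) a. Proof. exact: vge_mono. Qed.
Lemma vgz0 a : vgz 0 a. Proof. exact: vge0. Qed.
Lemma vgz1 : vgz 1 0. Proof. exact: vge1. Qed.
Lemma vgzM a b f g : vgz f a -> vgz g b -> vgz (f * g) (a + b).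
Proof. by rewrite /vgz rmorphD; apply: vgeM. Qed.
Lemma vgzM0 f g : vgz f 0 -> vgz g 0 -> vgz (f * g) 0.
Proof. exact: vgeM0. Qed.
Lemma vgzMr a f g : vgz f a -> vgz g 0 -> vgz (f * g) a.
Proof. by move=> fa g0; rewrite -[a]addr0; apply: vgzM. Qed.
Lemma vgzMl a f g : vgz f 0 -> vgz g a -> vgz (f * g) a.
Proof. by move=> fa g0; rewrite -[a]add0r; apply: vgzM. Qed.
Lemma vgzD a f g : vgz f a -> vgz g a -> vgz (f + g) a.
Proof. exact: vgeD. Qed.
Lemma vgzB a f g : vgz f a -> vgz g a -> vgz (f - g) a.
Proof. exact: vgeB. Qed.
Lemma vgzN a f : vgz f a -> vgz (- f) a.
Proof. exact: vgeN. Qed.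
Lemma vgz_lsum (I : choiceType) (F : I -> ser) a :
  (forall i, vgz (F i) a) -> vgz (lsum F) a.
Proof. exact: vge_lsum. Qed.

Lemma vgz_eq0 f a : (forall n : nat, vgz f (a + n%:Z)) -> f = 0.
Proof.
move=> H; apply: ser_limit0 => n.
have := H (n + absz a)%N; apply: vgeW; rewrite -[n%:R]/(n%:~R) ler_int; lia.
Qed.

Lemma summable_coercive (I : choiceType) (F : I -> ser) (w : I -> int) C :
  coercive w -> (forall i, vgz (F i) (w i - C)) -> summable F.
Proof.
move=> pw Fw; apply: (summable_vge _ Fw) => x.
apply: sub_finite_set (pw (Num.ceil x + C)) => i /= le.
by rewrite -lerBlDr -(ler_int rat); exact: le_trans (ceil_ge x).
Qed.

Lemma summable_int (F : int -> ser) C :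
  (forall k, vgz (F k) (`|k| - C)) -> summable F.
Proof. exact: summable_coercive coercive_int. Qed.

Lemma summable_int2 (F : int * int -> ser) C :
  (forall k, vgz (F k) (`|k.1| + `|k.2| - C)) -> summable F.
Proof.
exact: summable_coercive (coercive_pair coercive_int coercive_int _ _).
Qed.

Lemma lsum_shift (F : int -> ser) a :
  summable F -> lsum F = lsum (fun k => F (k + a)).
Proof.
move=> sF; apply: lsum_bij sF.
by exists (fun k => k - a) => k; rewrite ?addrK ?subrK.
Qed.

Lemma summable_shift (F : int -> ser) a :
  summable F -> summable (fun k => F (k + a)).
Proof.
move=> sF; apply: eq_summable (summable_reindex (A := setT) (h := +%R^~ a) _ sF).
  by move=> k; rewrite in_setT.
by move=> k l _ _; exact: addIr.
Qed.

(** * Inverses, (q)_n and (q)_oo *)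

Definition ginv (f : ser) : ser := lsum (fun k : nat => (1 - f) ^+ k).

Lemma vge_exp (u : ser) (k : nat) : vge u 1 -> vge (u ^+ k) k%:R.
Proof.
move=> u1; elim: k => [|k IHk]; first exact: vge1.
by rewrite exprS -add1n natrD; exact: vgeM.
Qed.

Lemma summable_exp (u : ser) : vge u 1 -> summable (fun k : nat => u ^+ k).
Proof.
move=> u1; apply: (@summable_coercive _ _ (fun k : nat => k%:Z) 0) => [x|k].
  by apply: (@sub_finite_set _ _ `I_((absz x).+1)) => // k /= le; lia.
by rewrite subr0; exact: vge_exp.
Qed.

Lemma ginvP f : vge (1 - f) 1 -> f * ginv f = 1.
Proof.
move=> u1; have sE := summable_exp u1.
rewrite /ginv -{1}[f](subKr 1); set u := 1 - f in u1 sE *.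
rewrite mulrBl mul1r lsumM //.
(* Multiplied by u, the geometric series loses its term k = 0; the difference of the two is 1. *)
rewrite [X in _ - X](_ : _ = lsum (fun k : nat => if (0 < k)%N then u ^+ k else 0)).
  apply/eqP; rewrite subr_eq; apply/eqP.
  rewrite -[1](@lsum1 _ (fun k : nat => if k == 0%N then 1 else 0) 0%N); last first.
    by move=> k /negbTE ->.
  rewrite -lsumD; first by apply: eq_lsum => -[|k]; rewrite ?addr0 ?add0r.
    apply: (@summable_supp _ _ [set 0%N]); first exact: finite_set1.
    by move=> k /eqP/negbTE ->.
  exact: summable_sub.
rewrite (@lsum_reindex _ _ setT S (fun k => if (0 < k)%N then u ^+ k else 0)).
- by apply: eq_lsum => k; rewrite in_setT exprS.
- by move=> k l _ _ [].
- by move=> [|k] // []; exists k.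
- exact: summable_sub.
Qed.

Lemma vge_ginv f : vge (1 - f) 1 -> vge (ginv f) 0.
Proof.
move=> u1; apply: vge_lsum => k; apply: vgeW _ (vge_exp k u1).
exact: ler0n.
Qed.

Definition qp (n : nat) : ser := \prod_(i < n) (1 - qz i.+1).

Lemma qp0 : qp 0 = 1. Proof. exact: big_ord0. Qed.
Lemma qpS n : qp n.+1 = qp n * (1 - qz n.+1).
Proof. exact: big_ord_recr. Qed.

Lemma vgz_1Bqz a : 0 <= a -> vgz (1 - qz a) 0.
Proof.
by move=> a0; apply: vgzB; [exact: vgz1|exact: vgzW _ (vgz_qz a)].
Qed.

Lemma vgz_qp n : vgz (qp n) 0.
Proof. by apply: vge_prod => i _; exact: vgz_1Bqz. Qed.

(** Each factor 1 - q^i with i > m is 1 + O(q^{m+1}); hence the coefficients of (q)_n stabilize and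
    define (q)_oo. *)
Lemma vgz_qpB m n : (m <= n)%N -> vgz (qp n - qp m) m.+1.
Proof.
move=> /subnK <-; elim: (n - m)%N => [|k IHk]; first by rewrite subrr; exact: vgz0.
rewrite addSn qpS mulrBr mulr1 addrAC; apply: vgzB => //.
by apply: vgzMl; [exact: vgz_qp|apply: vgzW _ (vgz_qz _); lia].
Qed.

Lemma vge_1Bqp n : vge (1 - qp n) 1.
Proof. by rewrite -opprB; apply: vgeN; have := @vgz_qpB 0 n isT; rewrite qp0. Qed.

(** 1/(q)_n, extended by 0 to n < 0. With this convention the recurrence [iqpP] holds at every
    integer, in particular across n = 0. *)
HB.lock Definition iqp (n : int) : ser := if n is Posz m then ginv (qp m) else 0.

Lemma iqp_neg n : n < 0 -> iqp n = 0.
Proof. by rewrite iqp.unlock; case: n. Qed.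

Lemma qpK (n : nat) : qp n * iqp n = 1.
Proof. by rewrite iqp.unlock; exact/ginvP/vge_1Bqp. Qed.

Lemma qp_inj (n : nat) (f g : ser) : qp n * f = qp n * g -> f = g.
Proof.
by move=> /(congr1 ( *%R (iqp n))); rewrite !mulrA [iqp n * _]mulrC qpK !mul1r.
Qed.

Lemma iqp0 : iqp 0 = 1.
Proof. by have := qpK 0; rewrite qp0 mul1r. Qed.

Lemma vgz_iqp n : vgz (iqp n) 0.
Proof.
rewrite iqp.unlock; case: n => [n|n]; last exact: vgz0.
exact/vge_ginv/vge_1Bqp.
Qed.

Lemma iqpP n : iqp (n - 1) = (1 - qz n) * iqp n.
Proof.
case: n => [[|n]|n]; last 1 first.
- by rewrite !iqp_neg ?mulr0 //; lia.
- by rewrite qz0 subrr mul0r iqp_neg.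
apply: (@qp_inj n); have -> : n.+1%:Z - 1 = n by lia.
by rewrite mulrA -qpS !qpK.
Qed.

Lemma qoo_lfin : lfin (fun x => qp (Num.truncn x) x).
Proof.
move=> x; apply: sub_finite_set (coef_lfin (qp (Num.truncn x)) x) => y [nz le].
split=> //; have := vgeE (vgz_qpB (le_truncn le)) (truncnS_gt y).
by rewrite ser_coefB => /eqP; rewrite subr_eq0 => /eqP ->.
Qed.

HB.lock Definition qoo : ser := Ser qoo_lfin.

Lemma vgz_qooB n : vgz (qoo - qp n) n.+1.
Proof.
split=> y lt; rewrite ser_coefB qoo.unlock /=.
have le : (Num.truncn y <= n)%N by rewrite truncn_le_nat.
have := vgeE (vgz_qpB le) (truncnS_gt y).
by rewrite ser_coefB => /eqP; rewrite subr_eq0 => /eqP ->; rewrite subrr.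
Qed.

Lemma vgz_qoo : vgz qoo 0.
Proof.
rewrite -(subrK (qp 0) qoo); apply: vgzD (vgz_qp 0).
by apply: vgzW _ (vgz_qooB 0).
Qed.

(** * Lower bounds for quadratic exponents *)

(** With t = |x| and c = |a| + K, the claim follows from t^2 - c t + c^2 >= 0. *)
Lemma sqr_lb_gen (K x a : int) : 0 <= K ->
  K * `|x| - (`|a| + K) ^+ 2 <= x * x + a * x.
Proof.
have H : - (`|a| * `|x|) <= a * x by rewrite -normrM lerNl -normrN ler_norm.
have E : x * x = `|x| * `|x| by rewrite -normrM ger0_norm // -expr2 sqr_ge0.
rewrite E expr2; have := normr_ge0 x; have := normr_ge0 a.
move: H; move: (a * x) => ax; move: `|x| `|a| => {E} {}x {}a; nia.
Qed.

Lemma sqr_lb (x a : int) : `|x| - (`|a| + 1) ^+ 2 <= x * x + a * x.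
Proof. by rewrite -[X in X - _]mul1r; exact: sqr_lb_gen. Qed.

(* The sums over k >= 0 below run over all integers k, so that they can be
   shifted freely; the factor [iqp k] is 0 for k < 0. *)
Definition tri (k : int) : int := ((k * (k + 1)) %/ 2)%Z.

Lemma triE k : tri k * 2 = k * (k + 1).
Proof.
rewrite /tri divzK //; have [m] : exists m : int, k = m * 2 \/ k = m * 2 + 1.
  by exists (k %/ 2)%Z; lia.
case=> ->; apply/dvdzP; first by exists (m * (m * 2 + 1)); ring.
by exists ((m * 2 + 1) * (m + 1)); ring.
Qed.

Lemma triS k : tri (k + 1) = tri k + k + 1.
Proof. by have := triE k; have := triE (k + 1); lia. Qed.

(** Twice the right side is k^2 + (2a + 1) k, whence the 2a + 1 in the constant. *)
Lemma tri_lb (k a : int) : `|k| - (`|a * 2 + 1| + 3) ^+ 2 <= tri k + a * k.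
Proof.
have T := triE k; have := sqr_lb k (a * 2 + 1 - 1).
set b := a * 2 + 1.
have H : - (`|b| * `|k|) <= b * k by rewrite -normrM lerNl -normrN ler_norm.
have E : k * k = `|k| * `|k| by rewrite -normrM ger0_norm // -expr2 sqr_ge0.
have {}T : (tri k + a * k) * 2 = `|k| * `|k| + b * k by rewrite /b -E; lia.
have := normr_ge0 k; have := normr_ge0 b; rewrite expr2.
move: (tri k + a * k) H T; move: (b * k) `|k| `|b| => bk x y {E} z; nia.
Qed.

Definition sg (k : int) : ser := (-1) ^+ absz k.

Lemma sgS k : sg (k + 1) = - sg k.
Proof.
have [k0|k0] := leP 0 k.
  by rewrite /sg (_ : absz (k + 1) = (absz k).+1) ?exprS ?mulN1r //; lia.
by rewrite /sg (_ : absz k = (absz (k + 1)).+1) ?exprS ?mulN1r ?opprK //; lia.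
Qed.

Lemma vgz_sg k : vgz (sg k) 0.
Proof.
rewrite /sg; elim: (absz k) => [|n IHn]; first exact: vgz1.
by rewrite exprS mulN1r; exact: vgzN.
Qed.

Lemma vgz_supp a b f (P : bool) : vgz f a -> (P -> b <= a) -> (~~ P -> f = 0) ->
  vgz f b.
Proof.
case: P => fa ba f0; first exact: vgzW (ba isT) fa.
by rewrite f0 //; exact: vgz0.
Qed.

(** * Durfee rectangles *)

(** Generating series of partitions by their Durfee rectangle of sides h and h + c. Its value is
    1/(q)_oo for every integer c, negative ones included. *)
Definition durfee (c : int) : ser :=
  lsum (fun h => qz (h * h + h * c) * (iqp h * iqp (h + c))).

Lemma vgz_iqp2 a b : vgz (iqp a * iqp b) 0.
Proof. by apply: vgzM0; exact: vgz_iqp. Qed.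

Lemma durfee_summable c c' :
  summable (fun h => qz (h * h + h * c) * (iqp h * iqp (h + c'))).
Proof.
apply: (@summable_int _ ((`|c| + 1) ^+ 2)) => h.
apply: vgzMr (vgz_iqp2 _ _); apply: vgzW (vgz_qz _).
by have := sqr_lb h c; lia.
Qed.

(** Split 1 - q^{h+c} = (1 - q^h) + q^h (1 - q^c) in the terms of [durfee (c - 1)]; after h -> h + 1
    the part with 1 - q^h becomes q^c times [durfee (c + 1)]. *)
Lemma durfee_rec c :
  durfee c - durfee (c - 1) = qz c * (durfee c - durfee (c + 1)).
Proof.
have sF := durfee_summable c c.
set F := (fun h => _) in sF.
have -> : durfee (c - 1) = lsum (fun h => F h - qz c * F h
    + qz (h * h + h * c - h) * (iqp (h - 1) * iqp (h + c))).
  apply: eq_lsum => h; rewrite /F (_ : h + (c - 1) = h + c - 1); last ring.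
  rewrite !iqpP.
  have -> : h * h + h * c = h * h + h * (c - 1) + h by ring.
  rewrite addrK (qzD _ h) (qzD h c); ring.
have sG : summable (fun h => qz (h * h + h * c - h) *
    (iqp (h - 1) * iqp (h + c))).
  apply: eq_summable (summable_shift (-1)
    (summableM (qz c) (durfee_summable (c + 1) (c + 1)))) => h.
  rewrite mulrA -qzD; congr (qz _ * (iqp _ * iqp _)); ring.
have sF' := summableM (qz c) sF.
have sFN := summableN sF'.
rewrite !lsumD //; last exact: summableD.
rewrite lsumN // -lsumM // (lsum_shift 1 sG).
have -> : lsum (fun h => qz ((h + 1) * (h + 1) + (h + 1) * c - (h + 1)) *
    (iqp (h + 1 - 1) * iqp (h + 1 + c))) = qz c * durfee (c + 1).
  rewrite /durfee lsumM; last exact: durfee_summable.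
  apply: eq_lsum => h; rewrite [RHS]mulrA -qzD; congr (qz _ * (iqp _ * iqp _)); ring.
rewrite -/(durfee c); ring.
Qed.

Lemma vgz_durfee c : 0 <= c -> vgz (durfee c) 0.
Proof.
move=> c0; apply: vgz_lsum => h; apply: (@vgz_supp (h * h + h * c) _ _ (0 <= h)).
- exact: vgzMr (vgz_qz _) (vgz_iqp2 _ _).
- by move=> h0; nia.
- by rewrite -ltNge => h0; rewrite iqp_neg // mul0r mulr0.
Qed.

(** By [durfee_rec] the difference D satisfies D c = - q^c D (c + 1). For c >= 1, iteration shows
    that D c is divisible by every power of q, hence 0; the same relation then carries 0 down to all
    c. *)
Lemma durfeeB c : durfee c = durfee (c - 1).
Proof.
pose D c := durfee c - durfee (c - 1).
have DE c' : D c' = - (qz c' * D (c' + 1)).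
  by rewrite /D durfee_rec addrK; ring.
suff D0 : D c = 0 by apply/eqP; rewrite -subr_eq0; apply/eqP.
have Dpos c' : 1 <= c' -> D c' = 0.
  move=> c1; apply: (@vgz_eq0 _ 0) => n; rewrite add0r.
  elim: n c' c1 => [|n IHn] c' c1.
    by apply: vgzB; apply: vgz_durfee; lia.
  rewrite DE; apply: vgzN; apply: vgzW (vgzM (vgz_qz c') (IHn (c' + 1) _)); lia.
have [/Dpos //|c1] := leP 1 c.
have [n] : exists n : nat, c = 1 - n%:Z by exists (absz (1 - c)); lia.
elim: n c {c1} => [|n IHn] c ->; first by rewrite subr0 Dpos.
by rewrite DE IHn ?mulr0 ?oppr0 //; lia.
Qed.

Lemma durfeeE c : durfee c = durfee 0.
Proof.
have H (n : nat) : durfee n = durfee 0 /\ durfee (- n%:Z) = durfee 0.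
  elim: n => [|n [IHn IHn']] //; split.
    by rewrite durfeeB -IHn; congr durfee; lia.
  by rewrite -IHn' [RHS]durfeeB; congr durfee; lia.
have [c0|c0] := leP 0 c; first by have [<- _] := H (absz c); congr durfee; lia.
by have [_ <-] := H (absz c); congr durfee; lia.
Qed.

(** Since the series does not depend on c, let c = n grow: modulo q^n only the term h = 0 survives,
    and it is 1/(q)_n. *)
Lemma durfee_qoo c : qoo * durfee c = 1.
Proof.
rewrite durfeeE; apply/eqP; rewrite -subr_eq0; apply/eqP.
apply: (@vgz_eq0 _ 0) => n; rewrite add0r -(durfeeE n%:Z).
have -> : qoo * durfee n - 1
  = qoo * (durfee n - iqp n) + (qoo - qp n) * iqp n.
  by rewrite -(qpK n); ring.
have H : vgz (durfee n - iqp n) n; last first.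
  apply: vgzD; first by apply: vgzMl H; exact: vgz_qoo.
  by apply: vgzMr (vgz_iqp _); apply: vgzW (vgz_qooB _); lia.
have sF := durfee_summable n n.
pose G (h : int) : ser := if h == 0 then iqp n else 0.
have GE : lsum G = iqp n.
  by rewrite (@lsum1 _ _ 0) /G ?eqxx // => h /negbTE ->.
have sG : summable G.
  apply: (@summable_supp _ _ [set 0]); first exact: finite_set1.
  by move=> h /eqP/negbTE h0; rewrite /G h0.
have sGN := summableN sG.
rewrite -GE -lsumN // -lsumD //; apply: vgz_lsum => h; rewrite /G.
have [->|h0] := eqVneq h 0.
  by rewrite !mul0r addr0 qz0 mul1r iqp0 mul1r add0r subrr; exact: vgz0.
rewrite subr0; apply: (@vgz_supp (h * h + h * n) _ _ (0 <= h)).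
- exact: vgzMr (vgz_qz _) (vgz_iqp2 _ _).
- by move=> h1; nia.
- by rewrite -ltNge => h1; rewrite iqp_neg // mul0r mulr0.
Qed.

Lemma qoo_inj f g : qoo * f = qoo * g -> f = g.
Proof.
move=> /(congr1 ( *%R (durfee 0))).
by rewrite !mulrA [durfee 0 * _]mulrC durfee_qoo !mul1r.
Qed.

(** * Euler's expansion *)

(** Euler's series for (q^{y+1}; q)_oo, a product that contains the factor 1 - q^0 when y < 0. *)
Definition euler (y : int) : ser :=
  lsum (fun k => sg k * qz (tri k + y * k) * iqp k).

Lemma euler_summable y : summable (fun k => sg k * qz (tri k + y * k) * iqp k).
Proof.
apply: (@summable_int _ ((`|y * 2 + 1| + 3) ^+ 2)) => k.
apply: vgzMr (vgz_iqp _); apply: vgzMl (vgz_sg _) _.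
by apply: vgzW (vgz_qz _); exact: tri_lb.
Qed.

Lemma euler_rec y : euler (y - 1) = (1 - qz y) * euler y.
Proof.
have sF := euler_summable y; have sF' := euler_summable (y - 1).
set F := (fun k => _) in sF; set F' := (fun k => _) in sF'.
rewrite mulrBl mul1r lsumM // -/F.
have E k : F' k = F k - qz y * F (k - 1).
  rewrite /F /F'; have := sgS (k - 1); rewrite subrK => ->.
  have := triS (k - 1); rewrite subrK => ->; rewrite iqpP.
  have -> : qz (tri (k - 1) + (k - 1) + 1 + y * k)
    = qz y * qz (tri (k - 1) + y * (k - 1)) * qz k.
    by rewrite -!qzD; congr qz; ring.
  have -> : qz (tri (k - 1) + (k - 1) + 1 + (y - 1) * k)
    = qz y * qz (tri (k - 1) + y * (k - 1)).
    by rewrite -!qzD; congr qz; ring.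
  ring.
rewrite /euler (eq_lsum E).
have sG : summable (fun k => qz y * F (k - 1)) by apply: summableM; exact: summable_shift.
have sGN := summableN sG.
rewrite lsumD // lsumN // (lsum_shift 1 sG); congr (_ - _).
by apply: eq_lsum => k; rewrite addrK.
Qed.

(** The recurrence gives 0 at y = -1 and hence at all y < 0. Upwards it gives [euler 0] = (q)_n
    [euler n], and [euler n] = 1 + O(q^n) identifies [euler 0] with (q)_oo. *)
Lemma eulerE y : euler y = qoo * iqp y.
Proof.
have Eneg (n : nat) : euler (- n%:Z - 1) = 0.
  elim: n => [|n IHn]; first by rewrite euler_rec oppr0 qz0 subrr mul0r.
  by rewrite euler_rec (_ : - n.+1%:Z = - n%:Z - 1) ?IHn ?mulr0 //; lia.
have [y0|y0] := leP 0 y; last first.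
  rewrite iqp_neg // mulr0 -(Eneg (absz (y + 1))); congr euler; lia.
have Epos (n : nat) : euler 0 = qp n * euler n.
  elim: n => [|n IHn]; first by rewrite qp0 mul1r.
  rewrite IHn qpS -mulrA -euler_rec; congr (_ * euler _); lia.
have E0 : euler 0 = qoo.
  apply/eqP; rewrite -subr_eq0; apply/eqP.
  apply: (@vgz_eq0 _ 0) => n; rewrite add0r (Epos n).
  have -> : qp n * euler n - qoo = qp n * (euler n - 1) - (qoo - qp n) by ring.
  apply: vgzB; last by apply: vgzW (vgz_qooB _); lia.
  apply: vgzMl (vgz_qp _) _.
  have sF := euler_summable n.
  pose G (k : int) : ser := if k == 0 then 1 else 0.
  have GE : lsum G = 1.
    by rewrite (@lsum1 _ _ 0) /G ?eqxx // => h /negbTE ->.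
  have sG : summable G.
    apply: (@summable_supp _ _ [set 0]); first exact: finite_set1.
    by move=> h /eqP/negbTE h0; rewrite /G h0.
  have sGN := summableN sG.
  rewrite -GE -lsumN // -lsumD //; apply: vgz_lsum => k; rewrite /G.
  have [->|k0] := eqVneq k 0.
    rewrite mulr0 addr0 iqp0 (_ : tri 0 = 0) // qz0 /sg expr0 !mul1r subrr.
    exact: vgz0.
  rewrite subr0. refine (@vgz_supp (tri k + n%:Z * k) n _ (0 <= k) _ _ _).
  - by apply: vgzMr (vgz_iqp _); apply: vgzMl (vgz_sg _) (vgz_qz _).
  - by move=> k1; have := triE k; nia.
  - by rewrite -ltNge => k1; rewrite iqp_neg // mulr0.
apply: (@qp_inj (absz y)); have ya : y = absz y by lia.
by rewrite {2}ya -Epos E0 mulrCA {2}ya qpK mulr1.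
Qed.

(** * The q-binomial theorem *)

Lemma lsum_rec (T A B : int -> ser) c : summable A -> summable B ->
  (forall k, T k = A k + c * B (k - 1)) -> lsum T = lsum A + c * lsum B.
Proof.
move=> sA sB TE; rewrite (eq_lsum TE).
have sB' := summable_shift (-1) sB; have sB'' := summableM c sB'.
rewrite lsumD // -lsumM // (lsum_shift (-1) sB).
by [].
Qed.

(** The product (q^a; q)_n. Negative a do occur, and the factors may then have negative
    exponents. *)
Definition fac (n : nat) (a : int) : ser := \prod_(t < n) (1 - qz (a + t%:Z)).

Lemma fac0 a : fac 0 a = 1. Proof. exact: big_ord0. Qed.
Lemma facS n a : fac n.+1 a = fac n a * (1 - qz (a + n%:Z)).
Proof. exact: big_ord_recr. Qed.

Lemma qp_fac (m n : nat) : qp (m + n) = qp m * fac n (m%:Z + 1).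
Proof.
elim: n => [|n IHn]; first by rewrite addn0 fac0 mulr1.
rewrite addnS qpS IHn facS -mulrA; congr (_ * (_ * (1 - qz _))); lia.
Qed.

Lemma fac_eq0 (n : nat) (a : int) : a <= 0 -> - a < n%:Z -> fac n a = 0.
Proof.
move=> a0 an; have lt : (absz a < n)%N by lia.
rewrite /fac (bigD1 (Ordinal lt)) // (_ : a + (Ordinal lt : nat)%:Z = 0); last first.
  by rewrite -[nat_of_ord _]/(absz a); lia.
rewrite qz0 subrr; exact: mul0r.
Qed.

(** The k-th term of the expansion of (q^{a+1}; q)_S, divided by (q)_S. *)
Definition qbt_term (S a k : int) : ser :=
  sg k * qz (tri k + a * k) * (iqp k * iqp (S - k)).

Lemma qbt_summable S a : summable (qbt_term S a).
Proof.
apply: (@summable_int _ ((`|a * 2 + 1| + 3) ^+ 2)) => k.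
apply: vgzMr (vgz_iqp2 _ _); apply: vgzMl (vgz_sg _) _.
by apply: vgzW (vgz_qz _); exact: tri_lb.
Qed.

(** Split 1 - q^S = (1 - q^{S-k}) + q^{S-k} (1 - q^k): both parts are multiples of terms for S - 1,
    the second one at k - 1. *)
Lemma qbt_rec S a :
  (1 - qz S) * lsum (qbt_term S a) = (1 - qz (a + S)) * lsum (qbt_term (S - 1) a).
Proof.
have sF := qbt_summable S a; have sG := qbt_summable (S - 1) a.
rewrite lsumM // [RHS]mulrBl mul1r -mulNr; apply: lsum_rec => // k.
rewrite /qbt_term; have := sgS (k - 1); rewrite subrK => ->.
have := triS (k - 1); rewrite subrK => ->; rewrite !iqpP.
have -> : S - 1 - (k - 1) = S - k by ring.
have -> : S - 1 - k = S - k - 1 by ring.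
have -> : qz (tri (k - 1) + (k - 1) + 1 + a * k)
  = qz a * qz (tri (k - 1) + a * (k - 1)) * qz k.
  by rewrite -!qzD; congr qz; ring.
have -> : qz S = qz k * qz (S - k) by rewrite -qzD; congr qz; ring.
have -> : qz (a + S) = qz a * qz k * qz (S - k) by rewrite -!qzD; congr qz; ring.
rewrite iqpP; ring.
Qed.

Lemma qz_cancel (n : nat) f g : (1 - qz n.+1) * f = (1 - qz n.+1) * g -> f = g.
Proof.
by move=> E; apply: (@qp_inj n.+1); rewrite qpS -!mulrA E.
Qed.

Lemma q_binomial S a : lsum (qbt_term S a) = iqp S * fac (absz S) (a + 1).
Proof.
case: S => [n|n]; last first.
  rewrite iqp_neg // mul0r; apply: lsum0 => k; rewrite /qbt_term.
  have [k0|k0] := leP 0 k; last by rewrite iqp_neg // mul0r mulr0.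
  by rewrite (@iqp_neg (_ - k)) ?mulr0 //; lia.
elim: n => [|n IHn].
  rewrite (@lsum1 _ _ 0) => [|k k0]; rewrite /qbt_term.
    rewrite (_ : tri 0 = 0) // mulr0 addr0 qz0 /sg expr0 fac0.
    by rewrite iqp0 !mulr1.
  have [k1|k1] := leP 0 k; last by rewrite iqp_neg // mul0r mulr0.
  by rewrite (@iqp_neg (_ - k)) ?mulr0 //; lia.
apply: (@qz_cancel n); rewrite qbt_rec.
have -> : n.+1%:Z - 1 = n by lia.
rewrite IHn [RHS]mulrA -iqpP facS; have -> : n.+1%:Z - 1 = n by lia.
have -> : a + n.+1%:Z = a + 1 + n%:Z by lia.
rewrite (_ : absz n%:Z = n) //; ring.
Qed.

(** * The transformation of one-variable sums *)

Definition vand_term (n c k : int) : ser :=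
  qz (k * k + k * (c - n)) * (iqp k * iqp (n - k)).
Definition shur_term (n c h : int) : ser :=
  qz (h * h + h * (c - n)) * (iqp h * iqp (h + c)).

Lemma vand_summable n c : summable (vand_term n c).
Proof.
apply: (@summable_int _ ((`|c - n| + 1) ^+ 2)) => h.
apply: vgzMr (vgz_iqp2 _ _); apply: vgzW (vgz_qz _).
by have := sqr_lb h (c - n); lia.
Qed.

Lemma shur_summable n c : summable (shur_term n c).
Proof. exact: durfee_summable. Qed.

(** The splitting of 1 - q^n is that of [qbt_rec]. *)
Lemma vand_rec n c : (1 - qz n) * lsum (vand_term n c)
  = lsum (vand_term (n - 1) (c - 1)) + qz c * lsum (vand_term (n - 1) c).
Proof.
rewrite [LHS]lsumM; last exact: vand_summable.
apply: lsum_rec => [||k]; [exact: vand_summable|exact: vand_summable|].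
rewrite /vand_term iqpP.
have -> : n - 1 - (k - 1) = n - k by ring.
have -> : n - 1 - k = n - k - 1 by ring.
rewrite iqpP; have -> : c - 1 - (n - 1) = c - n by ring.
have -> : k * k + k * (c - n)
  = (k - 1) * (k - 1) + (k - 1) * (c - (n - 1)) + k + (c - n) by ring.
have -> : qz n = qz k * qz (n - k) by rewrite -qzD; congr qz; ring.
have -> : qz c = qz (c - n) * qz k * qz (n - k) by rewrite -!qzD; congr qz; ring.
rewrite !(qzD _ (c - n)) !(qzD _ k); ring.
Qed.

(** Split 1 = (1 - q^{h+c}) + q^{h+c} in each term. *)
Lemma shur_rec n c : lsum (shur_term n c)
  = lsum (shur_term (n - 1) (c - 1)) + qz c * lsum (shur_term (n - 1) c).
Proof.
have sF := shur_summable; rewrite lsumM // -lsumD //; last exact: summableM.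
apply: eq_lsum => h; rewrite /shur_term addrA iqpP.
have -> : c - 1 - (n - 1) = c - n by ring.
have -> : h * h + h * (c - (n - 1)) = h * h + h * (c - n) + h by ring.
rewrite (qzD _ h) (qzD h c); ring.
Qed.

(** Both sums obey the same recurrence in n, up to a factor 1 - q^n that 1/(q)_n absorbs, and n = 0
    is the Durfee rectangle identity. *)
Lemma vand_shur n c :
  lsum (vand_term n c) = iqp n * (qoo * lsum (shur_term n c)).
Proof.
case: n => [n|n]; last first.
  rewrite iqp_neg // mul0r; apply: lsum0 => k; rewrite /vand_term.
  have [k0|k0] := leP 0 k; last by rewrite iqp_neg // mul0r mulr0.
  by rewrite (@iqp_neg (_ - k)) ?mulr0 //; lia.
elim: n c => [|n IHn] c.
  have -> : lsum (shur_term 0 c) = durfee c.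
    by apply: eq_lsum => h; rewrite /shur_term subr0.
  rewrite durfee_qoo iqp0 mulr1 (@lsum1 _ _ 0) => [|k k0]; rewrite /vand_term.
    by rewrite !mul0r addr0 qz0 iqp0 !mulr1.
  have [k1|k1] := leP 0 k; last by rewrite iqp_neg // mul0r mulr0.
  by rewrite (@iqp_neg (_ - k)) ?mulr0 //; lia.
apply: (@qz_cancel n); rewrite vand_rec [RHS]mulrA -iqpP shur_rec.
have -> : n.+1%:Z - 1 = n by lia.
rewrite !IHn; ring.
Qed.

Lemma int2_summable (F : int -> int -> ser) (a b : int) :
  (forall i k, 0 <= i -> 0 <= k ->
     vgz (F i k) (tri i + a * i + (k * k + b * k))) ->
  (forall i k, i < 0 \/ k < 0 -> F i k = 0) ->
  summable (fun ik : int * int => F ik.1 ik.2).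
Proof.
move=> Fv F0; apply: (@summable_int2 _ ((`|a * 2 + 1| + 3) ^+ 2 + (`|b| + 1) ^+ 2)).
move=> [i k] /=; have := tri_lb i a; have := sqr_lb k b.
have [i0|i0] := leP 0 i; last by rewrite F0; [move=> *; exact: vgz0|left].
have [k0|k0] := leP 0 k; last by rewrite F0; [move=> *; exact: vgz0|right].
by move=> H1 H2; apply: vgzW (Fv i k i0 k0); lia.
Qed.

(** Expand [fac] on both sides by the q-binomial theorem, with index i. For fixed i the sums over k
    and h are those of [vand_shur] at n = m - i. *)
Lemma transformation m T c :
  lsum (fun k => qz (k * k + k * (c - m)) *
    (iqp k * (iqp (m - k) * fac (absz (m - k)) (T - m + k + 1))))
  = qoo * lsum (fun h => qz (h * h + h * (c - m)) *
    (iqp h * iqp (h + c) * (iqp m * fac (absz m) (T - m + h + 1)))).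
Proof.
pose F i k := sg i * qz (tri i + (T - m) * i) * iqp i *
  (qz (k * k + k * (c - (m - i))) * (iqp k * iqp (m - i - k))).
have sF : summable (fun ik : int * int => F ik.1 ik.2).
  apply: (@int2_summable F (T - m) (c - m)) => i k.
    move=> i0 k0; apply: vgzM.
      by apply: vgzMr (vgz_iqp _); apply: vgzMl (vgz_sg _) (vgz_qz _).
    by apply: vgzMr (vgz_iqp2 _ _); apply: vgzW (vgz_qz _); nia.
  by rewrite /F; case=> lt0; rewrite (iqp_neg lt0); ring.
pose G i h := sg i * qz (tri i + (T - m) * i) * (iqp i * iqp (m - i)) *
  (qz (h * h + h * (c - (m - i))) * (iqp h * iqp (h + c))).
have sG : summable (fun ik : int * int => G ik.1 ik.2).
  apply: (@int2_summable G (T - m) (c - m)) => i k.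
    move=> i0 k0; apply: vgzM.
      by apply: vgzMr (vgz_iqp2 _ _); apply: vgzMl (vgz_sg _) (vgz_qz _).
    by apply: vgzMr (vgz_iqp2 _ _); apply: vgzW (vgz_qz _); nia.
  by rewrite /G; case=> lt0; rewrite (iqp_neg lt0); ring.
transitivity (lsum (fun k => lsum (fun i => F i k))).
  apply: eq_lsum => k; rewrite -q_binomial mulrA lsumM; last exact: qbt_summable.
  apply: eq_lsum => i; rewrite /qbt_term /F.
  have -> : m - i - k = m - k - i by ring.
  have -> : tri i + (T - m + k) * i = tri i + (T - m) * i + k * i by ring.
  have -> : k * k + k * (c - (m - i)) = k * k + k * (c - m) + k * i by ring.
  rewrite !(qzD _ (k * i)); ring.
rewrite -(lsum_exchange F sF).
transitivity (qoo * lsum (fun h => lsum (fun i => G i h))); last first.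
  congr (_ * _); apply: eq_lsum => h; rewrite -q_binomial mulrA.
  rewrite lsumM; last exact: qbt_summable.
  apply: eq_lsum => i; rewrite /qbt_term /G.
  have -> : tri i + (T - m + h) * i = tri i + (T - m) * i + h * i by ring.
  have -> : h * h + h * (c - (m - i)) = h * h + h * (c - m) + h * i by ring.
  rewrite !(qzD _ (h * i)); ring.
rewrite -(lsum_exchange G sG) lsumM; last exact: (summable_lsum G sG).
apply: eq_lsum => i; rewrite /F /G -lsumM; last exact: vand_summable.
rewrite -lsumM; last exact: shur_summable.
rewrite -/(vand_term _ _) -/(shur_term _ _).
have -> : lsum (fun k => qz (k * k + k * (c - (m - i))) * (iqp k * iqp (m - i - k)))
  = lsum (vand_term (m - i) c) by [].
have -> : lsum (fun h => qz (h * h + h * (c - (m - i))) * (iqp h * iqp (h + c)))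
  = lsum (shur_term (m - i) c) by [].
rewrite vand_shur; ring.
Qed.

(** * Recognizing q-binomials in the transformation *)

Lemma summable_range (F : int -> ser) (lo hi : int) :
  (forall k, ~~ (lo <= k <= hi) -> F k = 0) -> summable F.
Proof.
move=> F0; apply: (@summable_supp _ _ [set k : int | `|k| <= `|lo| + `|hi|]).
  exact: coercive_int.
by move=> k /negP kn; apply: F0; lia.
Qed.

(* The q-binomial [a + c; c]. *)
Definition gbin (a c : int) : ser := qp (absz (a + c)) * (iqp a * iqp c).

Lemma vgz_gbin a c : vgz (gbin a c) 0.
Proof. by apply: vgzM0 (vgz_iqp2 _ _); exact: vgz_qp. Qed.

(** If a < 0 <= a + c, then [fac] contains the factor 1 - q^0 and both sides are 0. If a + c < 0 <=
    c, the right side is nonzero while [gbin] is 0, hence the hypothesis. *)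
Lemma gbin_fac a c : 0 <= a + c -> gbin a c = iqp c * fac (absz c) (a + 1).
Proof.
rewrite /gbin; case: c => [c|c]; last by move=> _; rewrite !(@iqp_neg (Negz c)) //; ring.
case: a => [a|a] ac; last first.
  by rewrite (@iqp_neg (Negz a)) // fac_eq0 ?mul0r ?mulr0 //; lia.
have -> : absz (a%:Z + c%:Z) = (a + c)%N by lia.
by rewrite qp_fac mulrACA qpK mul1r mulrC.
Qed.

(* If x - D >= 0 and x - D + c >= 0, then the bound on e1 gives
   x - v + M >= 0, and there [fac] is the q-binomial on the right, both being 0
   for x < v. *)
Lemma inner_identity (D v M e1 c : int) : c = 2 * D + e1 + M ->
  e1 <= M - 2 * v ->
  lsum (fun z => qz (z * z + e1 * z) * (iqp (z - D) *
    (iqp (M - (z - D)) * fac (absz (M - (z - D))%R) (z - v + 1))))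
  = qoo * lsum (fun x => qz (x * x + e1 * x) *
      (gbin (x - v) M * (iqp (x - D) * iqp (x - D + c)))).
Proof.
(* With z = k + D, this T makes T - M + k equal to z - v, and [cE] makes z^2 + e1 z equal to k^2 + k
   (c - M) up to a constant. *)
move=> cE hM; pose T := D - v + M.
rewrite (lsum_shift D); last first.
  apply: (@summable_range _ D (D + M)) => z zD.
  have [z0|z0] := leP 0 (z - D)%R; last by rewrite iqp_neg //; ring.
  by rewrite (@iqp_neg (M - _)); [ring|lia].
pose A k := qz (k * k + k * (c - M)) *
  (iqp k * (iqp (M - k) * fac (absz (M - k)) (T - M + k + 1))).
have sA : summable A.
  apply: (@summable_range _ 0 M) => k kM; rewrite /A.
  have [k0|k0] := leP 0 k; last by rewrite iqp_neg //; ring.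
  by rewrite (@iqp_neg (M - _)); [ring|lia].
pose B h := qz (h * h + h * (c - M)) *
  (iqp h * iqp (h + c) * (iqp M * fac (absz M) (T - M + h + 1))).
have BE h : B h = qz (h * h + h * (c - M)) *
  (gbin (h + D - v) M * (iqp h * iqp (h + c))).
  rewrite /B; have [h0|h0] := leP 0 (h + D - v + M)%R.
    rewrite gbin_fac // (_ : T - M + h = h + D - v); last by rewrite /T; ring.
    ring.
  have [h1|h1] := leP 0 h; last by rewrite (@iqp_neg h) //; ring.
  by rewrite (@iqp_neg (h + c)); [ring|lia].
have sB : summable B.
  apply: (@summable_int _ ((`|c - M| + 1) ^+ 2)) => h; rewrite BE.
  apply: vgzMr; last by apply: vgzM0; [exact: vgz_gbin|exact: vgz_iqp2].
  by apply: vgzW (vgz_qz _); have := sqr_lb h (c - M); lia.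
have := transformation M T c; rewrite -/A -/B => AB.
rewrite (lsum_shift D (F := fun x => qz (x * x + e1 * x) *
      (gbin (x - v) M * (iqp (x - D) * iqp (x - D + c))))); last first.
  apply: (@summable_int _ ((`|e1| + 1) ^+ 2)) => h.
  apply: vgzMr; last by apply: vgzM0; [exact: vgz_gbin|exact: vgz_iqp2].
  by apply: vgzW (vgz_qz _); have := sqr_lb h e1; lia.
have -> : (fun k => qz ((k + D) * (k + D) + e1 * (k + D)) * (iqp (k + D - D) *
    (iqp (M - (k + D - D)) * fac (absz (M - (k + D - D))%R) (k + D - v + 1))))
  = (fun k => qz (D * D + e1 * D) * A k).
  apply/funext => k; rewrite /A [RHS]mulrA -qzD addrK.
  have -> : T - M + k + 1 = k + D - v + 1 by rewrite /T; ring.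
  by congr (qz _ * _); rewrite cE; ring.
rewrite -lsumM // AB mulrCA [X in _ * X = _]lsumM //; congr (_ * _); apply: eq_lsum => h.
rewrite BE [LHS]mulrA -qzD addrK; congr (qz _ * _); rewrite cE; ring.
Qed.

(** * Lower bounds for pairs of variables *)

Lemma summable_coercive2 (I : choiceType) (F : I -> ser) (w : I -> int) C :
  coercive w -> (forall i, exists2 a, vgz (F i) a & w i - C <= a * 2) ->
  summable F.
Proof.
move=> pw Fw; pose w' i := ((w i - C) %/ 2)%Z.
apply: (@summable_coercive _ _ w' 0) => [x|i].
  by apply: sub_finite_set (pw (x * 2 + C + 2)) => i /=; rewrite /w'; lia.
by have [a Fa le] := Fw i; apply: vgzW Fa; rewrite /w'; lia.
Qed.

(** Twice the right side is (k - v)^2 + (1 + 2y)(k - v) + v^2 + (2e + 1 + 2y) v. The slopes 2 and 4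
    suffice because |k| <= |k - v| + |v|. *)
Lemma euler_pair_lb (e y : int) : exists C, forall v k : int,
  `|v| + `|k| - C <= v * v + e * v + (tri k + (y - v) * k).
Proof.
exists ((`|1 + 2 * y| + 2) ^+ 2 + (`|2 * e + 1 + 2 * y| + 4) ^+ 2) => v k.
have := @sqr_lb_gen 2 (k - v) (1 + 2 * y) isT.
have := @sqr_lb_gen 4 v (2 * e + 1 + 2 * y) isT.
set c1 := (_ ^+ 2); set c2 := (_ ^+ 2).
have c1_ge0 : 0 <= c1 by exact: sqr_ge0.
have c2_ge0 : 0 <= c2 by exact: sqr_ge0.
have := triE k.
have : `|k| <= `|k - v| + `|v| by lia.
move: c1 c2 c1_ge0 c2_ge0 => c1 c2; move: (tri k) `|k - v| `|k| `|v| => t a b c; lia.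
Qed.

Lemma vgz_fac_pos n a : 0 <= a -> vgz (fac n a) 0.
Proof. by move=> a0; apply: vge_prod => t _; apply: vgz_1Bqz; lia. Qed.

(** All exponents a, ..., a + n - 1 are at most 0, so the factor 1 - q^{a+t} has valuation at least
    a + t; the bound is the sum of these. *)
Lemma vgz_fac_neg (n : nat) a : a + n%:Z <= 1 ->
  vgz (fac n a) (n%:Z * a + tri (n%:Z - 1)).
Proof.
elim: n => [|n IHn] an.
  by rewrite fac0 mul0r (_ : tri _ = 0) //; exact: vgz1.
rewrite facS; have -> : n.+1%:Z * a + tri (n.+1%:Z - 1)
  = (n%:Z * a + tri (n%:Z - 1)) + (a + n%:Z).
  have -> : n.+1%:Z - 1 = n%:Z - 1 + 1 by lia.
  by rewrite triS; lia.
apply: vgzM; first by apply: IHn; lia.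
apply: vgzB; last exact: vgz_qz.
by apply: vgzW vgz1; lia.
Qed.

Lemma mul_succ_ge0 (u : int) : 0 <= u * u + u.
Proof. by have [u0|u0] := leP 0 u; nia. Qed.

(* If all the exponents z - v + 1, ..., z - v + S are negative, the quadratic
   part of the valuation is only (v + z)^2 / 2; the growth along v - z comes
   from the linear part, and this is where e1 <= e is needed. *)
Lemma partial_pair_lb (e e1 : int) : e1 <= e -> exists C, forall v z S : int,
  0 <= S -> exists2 a, vgz (iqp S * fac (absz S) (z - v + 1)) a &
    `|v| + `|z| - C <= (z * z + e1 * z + (v * v + e * v) + a) * 2.
Proof.
move=> ee1; pose C1 := (`|e| + 1) ^+ 2 + (`|e1| + 1) ^+ 2.
pose C2 := (`|e + e1| + 1) ^+ 2.
have C1_ge0 : 0 <= C1 by rewrite addr_ge0 // sqr_ge0.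
have C2_ge0 : 0 <= C2 by exact: sqr_ge0.
exists (C1 * 2 + C2) => v z S S0.
have L1 : `|v| + `|z| - C1 <= z * z + e1 * z + (v * v + e * v).
  by rewrite /C1; have := sqr_lb v e; have := sqr_lb z e1; lia.
have L2 : `|v + z| - C2 <= (v + z) * (v + z) + (e + e1) * (v + z) by exact: sqr_lb.
case: S S0 => // n _; rewrite -[absz n]/n.
have [zv|zv] := leP 0 (z - v + 1)%R.
  exists 0; last by lia.
  by apply: vgzM0 (vgz_iqp _) (vgz_fac_pos _ _).
have [nz|nz] := ltP (- (z - v + 1)%R) n%:Z.
  exists 0; last by lia.
  by rewrite fac_eq0 ?mulr0 //; [exact: vgz0|lia].
exists (n%:Z * (z - v + 1) + tri (n%:Z - 1)).
  by apply: vgzMl (vgz_iqp _) (vgz_fac_neg _); lia.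
(* Twice the total exponent is (v + z)^2 + (e + e1)(v + z), plus (e - e1)(v - z), plus v - z, plus
   u^2 + u with u = z - v + n. The first part is bounded by [L2], the second and the last are
   nonnegative by [P] and [U], and [N] uses v - z to control |v| + |z|. *)
have T := triE (n%:Z - 1); have n0 : 0 <= n%:Z by [].
have N : `|v| + `|z| <= `|v + z| + (v - z) by lia.
have P : 0 <= (e - e1) * (v - z) by apply: mulr_ge0; lia.
have U : 0 <= (z - v + n%:Z) * (z - v + n%:Z) + (z - v + n%:Z).
  exact: mul_succ_ge0.
clear -C1_ge0 C2_ge0 L2 N P U T n0 nz zv.
move: C1 C2 `|v| `|z| `|v + z| n%:Z (tri _) C1_ge0 C2_ge0 L2 N P U T n0 nz zv.
move=> c1 c2 av az avz m t *; lia.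
Qed.

(* v is the last variable, b the sum of the variables, e the last of the
   parameters e_j and E their sum; g and W are the summands of the two sides.
   The induction step needs the identity with e replaced by e - k, for every
   k >= 0. *)
Record tower (I : choiceType) (v b h : I -> int) (g W : I -> ser) (e E : int)
    : Prop := Tower {
  (* In the towers built below, h is the sum of the absolute values of all variables but the
     last. *)
  tower_h_ge0 : forall i, 0 <= h i;
  tower_coercive : coercive (fun i => h i + `|v i|);
  (* The dependence on the last variable is kept exact, because the next step changes e and couples
     v to a new variable. *)
  tower_vgz : exists C, forall i,
    vgz (g i) (h i - C + (v i * v i + e * v i)) /\
    vgz (W i) (h i - C + (v i * v i + e * v i));
  (* From two variables on, this says that the lower entry m_{N-1} of the last q-binomial is
     nonnegative; it supplies the bound on e1 in [inner_identity]. *)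
  tower_pos : forall i, W i != 0 -> e <= 2 * b i + E - 2 * v i;
  tower_id : forall k B, 0 <= k ->
    lsum (fun i => if b i == B then qz (- (k * v i)) * g i else 0)
    = qoo * lsum (fun i => qz (- (k * v i)) * W i *
        (iqp (b i - B) * iqp (b i + B + E - k)))
}.

(** * The induction step *)

Section TowerStep.
Variables (I : choiceType) (v b h : I -> int) (g W : I -> ser) (e E : int).
Hypothesis tw : tower v b h g W e E.

Lemma vgz_if (P : bool) f a : vgz f a -> vgz (if P then f else 0) a.
Proof. by case: P => // _; exact: vgz0. Qed.

Lemma mulr_if (P : bool) (f x : ser) :
  f * (if P then x else 0) = if P then f * x else 0.
Proof. by case: P; rewrite ?mulr0. Qed.

Lemma lsum_if (J : choiceType) (P : bool) (F : J -> ser) :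
  lsum (fun j => if P then F j else 0) = if P then lsum F else 0.
Proof. by case: P => //; exact: lsum0. Qed.

Lemma tower_euler_summable (y : int) (F : I -> int -> ser) :
  (forall i k, k < 0 -> F i k = 0) ->
  (forall i k a, vgz (g i) a -> vgz (W i) a ->
    vgz (F i k) (a + (tri k + (y - v i) * k))) ->
  summable (fun ik : I * int => F ik.1 ik.2).
Proof.
move=> F0 Fv; have [C gW] := tower_vgz tw; have [C' lb] := euler_pair_lb e y.
apply: (@summable_coercive _ _ (fun ik : I * int => h ik.1 + `|v ik.1| + `|ik.2|)
  (C + C')) => [|[i k] /=].
  apply: (coercive_pair (tower_coercive tw) coercive_int) => // i.
  by rewrite addr_ge0 // (tower_h_ge0 tw).
have [gi Wi] := gW i; apply: vgzW (Fv i k _ gi Wi).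
have := lb (v i) k; lia.
Qed.

(** The k-th term of Euler's expansion calls for [tower_id] at k. On the right, 1/(q)_k and
    1/(q)_{b+B+E-k} are then resummed over k by the q-binomial theorem, which leaves the finite
    product [fac]. *)
Lemma tower_partial (y B : int) :
  lsum (fun i => if b i == B then g i * iqp (y - v i) else 0)
  = lsum (fun i => W i * (iqp (b i - B) *
      (iqp (b i + B + E) * fac (absz (b i + B + E)%R) (y - v i + 1)))).
Proof.
have [C gW] := tower_vgz tw.
pose ev i k := sg k * qz (tri k + (y - v i) * k) * iqp k.
have vev i k : vgz (ev i k) (tri k + (y - v i) * k).
  by apply: vgzMr (vgz_iqp _); apply: vgzMl (vgz_sg _) (vgz_qz _).
have ev_neg i k : k < 0 -> ev i k = 0 by move=> k0; rewrite /ev iqp_neg ?mulr0.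
have evE i k : ev i k = (sg k * qz (tri k + y * k) * iqp k) * qz (- (k * v i)).
  rewrite /ev (_ : tri k + (y - v i) * k = tri k + y * k + - (k * v i)); last ring.
  by rewrite (qzD _ (- _)); ring.
pose F i k := if b i == B then g i * ev i k else 0.
pose G i k := W i * ev i k * (iqp (b i - B) * iqp (b i + B + E - k)).
have sF : summable (fun ik : I * int => F ik.1 ik.2).
  apply: (@tower_euler_summable y) => [i k k0|i k a gi Wi].
    by rewrite /F ev_neg // mulr0; case: ifP.
  by apply: vgz_if; exact: vgzM.
have sG : summable (fun ik : I * int => G ik.1 ik.2).
  apply: (@tower_euler_summable y) => [i k k0|i k a gi Wi].
    by rewrite /G ev_neg // mulr0 mul0r.
  by apply: vgzMr (vgz_iqp2 _ _); exact: vgzM.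
apply: qoo_inj.
have -> : qoo * lsum (fun i => if b i == B then g i * iqp (y - v i) else 0)
  = lsum (fun i => lsum (F i)).
  rewrite lsumM; last first.
    (* Summability is known after multiplication by (q)_oo; its inverse [durfee 0] brings it
       back. *)
    apply: eq_summable (summableM (durfee 0) (summable_lsum F sF)) => i.
    rewrite /F lsum_if mulr_if -lsumM; last exact: euler_summable.
    have -> : lsum (ev i) = qoo * iqp (y - v i) by exact: eulerE.
    case: ifP => // _; transitivity (qoo * durfee 0 * (g i * iqp (y - v i))).
      by ring.
    by rewrite durfee_qoo mul1r.
  apply: eq_lsum => i; rewrite /F lsum_if mulr_if -lsumM; last exact: euler_summable.
  have -> : lsum (ev i) = qoo * iqp (y - v i) by exact: eulerE.
  by case: ifP => // _; ring.
rewrite (lsum_exchange F sF).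
have -> : lsum (fun k => lsum (fun i => F i k))
  = lsum (fun k => qoo * lsum (fun i => G i k)).
  apply: eq_lsum => k; have [k0|k0] := leP 0 k; last first.
    rewrite !lsum0 ?mulr0 // => i; first by rewrite /G ev_neg // mulr0 mul0r.
    by rewrite /F ev_neg // mulr0; case: ifP.
  transitivity (sg k * qz (tri k + y * k) * iqp k *
    lsum (fun i => if b i == B then qz (- (k * v i)) * g i else 0)).
    rewrite lsumM; last first.
      apply: (@summable_coercive _ _ _ (C + (`|e - k| + 1) ^+ 2) (tower_coercive tw)).
      move=> i; apply: vgz_if; have [gi _] := gW i.
      apply: vgzW (vgzM (vgz_qz _) gi); have := sqr_lb (v i) (e - k); lia.
    apply: eq_lsum => i; rewrite mulr_if /F evE.
    by case: ifP => // _; ring.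
  rewrite (tower_id tw) // mulrCA; congr (_ * _); rewrite lsumM; last first.
    apply: (@summable_coercive _ _ _ (C + (`|e - k| + 1) ^+ 2) (tower_coercive tw)).
    move=> i; have [_ Wi] := gW i; apply: vgzMr (vgz_iqp2 _ _).
    apply: vgzW (vgzM (vgz_qz _) Wi); have := sqr_lb (v i) (e - k); lia.
  by apply: eq_lsum => i; rewrite /G evE; ring.
rewrite -lsumM; last exact: (summable_lsum (fun k i => G i k) (summable_swap sG)).
rewrite -(lsum_exchange G sG); congr (_ * _); apply: eq_lsum => i.
rewrite -q_binomial mulrA lsumM; last exact: qbt_summable.
by apply: eq_lsum => k; rewrite /G /qbt_term /ev; ring.
Qed.

End TowerStep.

Section TowerNext.
Variables (I : choiceType) (v b h : I -> int) (g W : I -> ser) (e E e' : int).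
Hypotheses (tw : tower v b h g W e E) (le_e'e : e' <= e).

Definition next_g (iz : I * int) : ser :=
  g iz.1 * (qz (iz.2 * iz.2 + e' * iz.2) * iqp (iz.2 - v iz.1)).
Definition next_W (iz : I * int) : ser :=
  W iz.1 * (qz (iz.2 * iz.2 + e' * iz.2) * gbin (iz.2 - v iz.1) (2 * b iz.1 + E)).

Lemma tower_pair_summable (e1 : int) (F : I -> int -> ser) :
  (forall i z a, vgz (g i) a -> vgz (W i) a ->
    vgz (F i z) (a + (z * z + e1 * z))) ->
  summable (fun iz : I * int => F iz.1 iz.2).
Proof.
move=> Fv; have [C gW] := tower_vgz tw.
apply: (@summable_coercive _ _ (fun iz : I * int => h iz.1 + `|v iz.1| + `|iz.2|)
  (C + (`|e| + 1) ^+ 2 + (`|e1| + 1) ^+ 2)) => [|[i z] /=].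
  apply: (coercive_pair (tower_coercive tw) coercive_int) => // i.
  by rewrite addr_ge0 // (tower_h_ge0 tw).
have [gi Wi] := gW i; apply: vgzW (Fv i z _ gi Wi).
have := sqr_lb (v i) e; have := sqr_lb z e1; lia.
Qed.

(** The new variable z plays the role of y in [tower_partial], at B - z. Once the sums are
    exchanged, the sum over z for fixed i is that of [inner_identity] with D = B - b i and M = 2 b i
    + E. *)
Lemma tower_step_id (e1 B : int) : e1 <= e ->
  lsum (fun z => qz (z * z + e1 * z) *
     lsum (fun i => if b i == B - z then g i * iqp (z - v i) else 0))
  = qoo * lsum (fun i => W i * lsum (fun x => qz (x * x + e1 * x) *
     (gbin (x - v i) (2 * b i + E) *
      (iqp (x - (B - b i)) * iqp (b i + x + B + E + e1))))).
Proof.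
move=> e1e; have [C gW] := tower_vgz tw.
pose D i := B - b i; pose M i := 2 * b i + E.
pose F i z := W i * (qz (z * z + e1 * z) * (iqp (z - D i) *
    (iqp (M i - (z - D i)) * fac (absz (M i - (z - D i))%R) (z - v i + 1)))).
have sF : summable (fun iz : I * int => F iz.1 iz.2).
  have [C' lb] := partial_pair_lb e1e.
  apply: (@summable_coercive2 _ _
    (fun iz : I * int => h iz.1 + `|v iz.1| + `|iz.2|) (C * 2 + C')).
    apply: (coercive_pair (tower_coercive tw) coercive_int) => // i.
    by rewrite addr_ge0 // (tower_h_ge0 tw).
  move=> [i z] /=; have h0 := tower_h_ge0 tw i; rewrite /F.
  set S := M i - (z - D i); have [S0|S0] := leP 0 S; last first.
    (* For S < 0 the term is 0, so any sufficiently large valuation serves. *)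
    exists (h i + `|v i| + `|z| + `|C| + `|C'|); last by lia.
    by rewrite (iqp_neg S0) mul0r !mulr0; exact: vgz0.
  have [a fa le_a] := lb (v i) z S S0; have [_ Wi] := gW i.
  exists (h i - C + (v i * v i + e * v i) + (z * z + e1 * z + a)).
    apply: vgzM Wi _; apply: vgzM (vgz_qz _) _.
    by apply: vgzMl fa; exact: vgz_iqp.
  move: le_a h0; clear; lia.
transitivity (lsum (fun z => lsum (fun i => F i z))).
  apply: eq_lsum => z; rewrite (tower_partial tw) lsumM.
    apply: eq_lsum => i; rewrite /F mulrCA; congr (_ * (_ * _)).
    have -> : b i - (B - z) = z - D i by rewrite /D; ring.
    by have -> : b i + (B - z) + E = M i - (z - D i) by rewrite /D /M; ring.
  apply: eq_summable (summableM (qz (- (z * z + e1 * z)))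
    (summable_row (fun z i => F i z) (summable_swap sF) z)) => i.
  have -> : b i - (B - z) = z - D i by rewrite /D; ring.
  have -> : b i + (B - z) + E = M i - (z - D i) by rewrite /D /M; ring.
  rewrite /F; set t := W i * _; transitivity
    (qz (z * z + e1 * z) * qz (- (z * z + e1 * z)) * (W i * (iqp (z - D i) *
     (iqp (M i - (z - D i)) * fac (absz (M i - (z - D i))%R) (z - v i + 1))))).
    by rewrite /t; ring.
  by rewrite qzK mul1r.
rewrite -(lsum_exchange F sF).
pose G i x := W i * (qz (x * x + e1 * x) * (gbin (x - v i) (M i) *
  (iqp (x - D i) * iqp (b i + x + B + E + e1)))).
have sG : summable (fun iz : I * int => G iz.1 iz.2).
  apply: (@tower_pair_summable e1) => i z a _ Wi; apply: vgzM Wi _.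
  by apply: vgzMr (vgz_qz _) _; apply: vgzM0 (vgz_gbin _ _) (vgz_iqp2 _ _).
have sGi i : summable (fun x => qz (x * x + e1 * x) * (gbin (x - v i) (M i) *
  (iqp (x - D i) * iqp (b i + x + B + E + e1)))).
  apply: (@summable_int _ ((`|e1| + 1) ^+ 2)) => x; apply: vgzMr; last first.
    by apply: vgzM0 (vgz_gbin _ _) (vgz_iqp2 _ _).
  by apply: vgzW (vgz_qz _); have := sqr_lb x e1; lia.
rewrite lsumM; last first.
  apply: eq_summable (summable_lsum G sG) => i.
  by rewrite /G -lsumM.
(* [tower_pos] gives its inequality only where W i is nonzero. *)
apply: eq_lsum => i; have [W0|W0] := eqVneq (W i) 0.
  by rewrite W0 mul0r mulr0; apply: lsum0 => z; rewrite /F W0 mul0r.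
rewrite mulrCA -lsumM.
  congr (_ * _); rewrite (@inner_identity (D i) (v i) (M i) e1 (2 * D i + e1 + M i)) //.
    congr (_ * _); apply: eq_lsum => x.
    have -> // : x - D i + (2 * D i + e1 + M i) = b i + x + B + E + e1.
    by rewrite /D /M; ring.
  by have := tower_pos tw W0; rewrite /M; lia.
apply: (@summable_range _ (D i) (D i + M i)) => z zD.
have [z0|z0] := leP 0 (z - D i)%R; last by rewrite (iqp_neg z0); ring.
by rewrite (@iqp_neg (M i - _)); [ring|lia].
Qed.

(** The power q^{-kz} only lowers e' to e1 = e' - k, which is still at most e, so [tower_step_id]
    covers every k >= 0. *)
Lemma tower_next : tower (fun iz : I * int => iz.2) (fun iz => b iz.1 + iz.2)
  (fun iz => h iz.1 + `|v iz.1|) next_g next_W e' (E + e').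
Proof.
have [C gW] := tower_vgz tw; split.
- by move=> [i z] /=; rewrite addr_ge0 // (tower_h_ge0 tw).
- apply: (coercive_pair (tower_coercive tw) coercive_int) => // i.
  by rewrite addr_ge0 // (tower_h_ge0 tw).
- exists (C + (`|e| + 1) ^+ 2) => -[i z] /=; have [gi Wi] := gW i.
  have le : h i + `|v i| - (C + (`|e| + 1) ^+ 2) + (z * z + e' * z) <=
    h i - C + (v i * v i + e * v i) + (z * z + e' * z).
    by have := sqr_lb (v i) e; lia.
  split; apply: vgzW le _; rewrite /next_g /next_W /=.
    by apply: vgzM gi _; apply: vgzMr (vgz_qz _) (vgz_iqp _).
  by apply: vgzM Wi _; apply: vgzMr (vgz_qz _) (vgz_gbin _ _).
- move=> [i z] /=; apply: contraNT => lt; rewrite /next_W /=.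
  rewrite /gbin (@iqp_neg (2 * _ + E)) ?mulr0 //; lia.
move=> k B k0; pose e1 := e' - k.
have e1e : e1 <= e by rewrite /e1; lia.
pose F i z : ser := if b i + z == B then qz (- (k * z)) * next_g (i, z) else 0.
have sF : summable (fun iz : I * int => F iz.1 iz.2).
  apply: (@tower_pair_summable e1) => i z a gi _; apply: vgz_if.
  rewrite mulrC /next_g /= -[_ * qz _]mulrA; apply: vgzM gi _.
  rewrite mulrAC -qzD; apply: vgzMr (vgz_iqp _); apply: vgzW (vgz_qz _).
  by rewrite /e1; lia.
transitivity (lsum (fun z => lsum (fun i => F i z))).
  by rewrite -(lsum_exchange F sF) (lsum_pair F sF); apply: eq_lsum => -[i z].
have := tower_step_id B e1e.
have -> : lsum (fun z => qz (z * z + e1 * z) *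
     lsum (fun i => if b i == B - z then g i * iqp (z - v i) else 0))
  = lsum (fun z => lsum (fun i => F i z)).
  apply: eq_lsum => z; rewrite lsumM.
    apply: eq_lsum => i; rewrite /F mulr_if.
    have -> : (b i == B - z) = (b i + z == B) by apply/eqP/eqP; lia.
    case: ifP => // _; rewrite /next_g /=.
    have -> : z * z + e1 * z = - (k * z) + (z * z + e' * z) by rewrite /e1; ring.
    by rewrite qzD; ring.
  apply: (@summable_coercive _ _ _ (C + (`|e| + 1) ^+ 2) (tower_coercive tw)).
  move=> i; apply: vgz_if; apply: vgzMr (vgz_iqp _); have [gi _] := gW i.
  by apply: vgzW gi; have := sqr_lb (v i) e; lia.
move=> ->; congr (_ * _).
pose G i x := W i * (qz (x * x + e1 * x) * (gbin (x - v i) (2 * b i + E) *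
  (iqp (x - (B - b i)) * iqp (b i + x + B + E + e1)))).
have sG : summable (fun iz : I * int => G iz.1 iz.2).
  apply: (@tower_pair_summable e1) => i z a _ Wi; apply: vgzM Wi _.
  by apply: vgzMr (vgz_qz _) _; apply: vgzM0 (vgz_gbin _ _) (vgz_iqp2 _ _).
transitivity (lsum (fun i => lsum (G i))).
  apply: eq_lsum => i; rewrite lsumM //.
  apply: (@summable_int _ ((`|e1| + 1) ^+ 2)) => x; apply: vgzMr; last first.
    by apply: vgzM0 (vgz_gbin _ _) (vgz_iqp2 _ _).
  by apply: vgzW (vgz_qz _); have := sqr_lb x e1; lia.
rewrite (lsum_pair G sG); apply: eq_lsum => -[i x] /=; rewrite /G /next_W /=.
have -> : x * x + e1 * x = - (k * x) + (x * x + e' * x) by rewrite /e1; ring.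
have -> : x - (B - b i) = b i + x - B by ring.
have -> : b i + x + B + E + e1 = b i + x + B + (E + e') - k by rewrite /e1; ring.
by rewrite qzD; ring.
Qed.
End TowerNext.

(** The left side has the single term x = B, and x -> x + B turns the right side into the Durfee
    series with c = 2B + e - k. *)
Lemma tower_base (e : int) : tower (fun x : int => x) (fun x => x) (fun=> 0)
  (fun x => qz (x * x + e * x)) (fun x => qz (x * x + e * x)) e e.
Proof.
split=> //.
- by move=> x; apply: sub_finite_set (coercive_int x) => k /=; rewrite add0r.
- exists 0 => x; split; rewrite subr0 add0r; exact: vgz_qz.
- by move=> x _; lia.
move=> k B _; rewrite (@lsum1 _ _ B) => [|x /negbTE ->] //.
rewrite eqxx (@lsum_shift _ B).
  transitivity (qz (- (k * B)) * qz (B * B + e * B) *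
    (qoo * durfee (2 * B + e - k))); first by rewrite durfee_qoo mulr1.
  rewrite mulrCA; congr (_ * _); rewrite lsumM; last exact: durfee_summable.
  apply: eq_lsum => x; rewrite addrK mulrA -!qzD.
  have -> : x + B + B + e - k = x + (2 * B + e - k) by ring.
  by congr (qz _ * _); ring.
apply: (@summable_int _ ((`|e - k| + 1) ^+ 2)) => x; apply: vgzMr (vgz_iqp2 _ _).
by rewrite -qzD; apply: vgzW (vgz_qz _); have := sqr_lb x (e - k); lia.
Qed.

(** * The identity in n + 1 variables *)

(** Z^{n+1} as nested pairs, the index type that [tower_next] produces. Coordinates are numbered
    from 0 to n, and [crd] repeats the last one beyond n. *)
Fixpoint tow (n : nat) : choiceType :=
  if n is m.+1 then (tow m * int)%type : choiceType else int.

Fixpoint crd (n : nat) : tow n -> nat -> int :=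
  if n is m.+1 return tow n -> nat -> int then
    fun i j => if (j <= m)%N then crd i.1 j else i.2
  else fun i _ => i.

Fixpoint mk (n : nat) (f : nat -> int) : tow n :=
  if n is m.+1 return tow n then (mk m f, f m.+1) else f 0%N.

Lemma crd_mk n f j : (j <= n)%N -> crd (mk n f) j = f j.
Proof.
elim: n => [|n IHn] /=; first by rewrite leqn0 => /eqP ->.
by move=> le; case: leqP => [/IHn //|lt]; congr f; lia.
Qed.

Lemma mk_crd n (i : tow n) f : (forall j, (j <= n)%N -> crd i j = f j) -> mk n f = i.
Proof.
elim: n i => [|n IHn] i /= H; first by rewrite (H 0%N).
case: i H => i z /= H; congr pair; last by have := H n.+1 (leqnn _); rewrite ltnn.
by apply: IHn => j le; have := H j (leqW le); rewrite le.
Qed.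

Definition psum (x : nat -> int) (n : nat) : int := \sum_(j < n) x j.

Lemma psum0 x : psum x 0 = 0. Proof. exact: big_ord0. Qed.
Lemma psumS x n : psum x n.+1 = psum x n + x n. Proof. exact: big_ord_recr. Qed.
Lemma eq_psum x y n : (forall j, (j < n)%N -> x j = y j) -> psum x n = psum y n.
Proof. by move=> xy; apply: eq_bigr => j _; exact: xy. Qed.

Definition sqr_exp (e x : nat -> int) (n : nat) : int :=
  psum (fun j => x j * x j + e j * x j) n.

Definition spinon (n : nat) (e x : nat -> int) : ser :=
  qz (sqr_exp e x n.+1) * \prod_(j < n) iqp (x j.+1 - x j).

(** The lower entry of the j-th q-binomial is m_{j+1}, written in the variables x. *)
Definition fermion (n : nat) (e x : nat -> int) : ser :=
  qz (sqr_exp e x n.+1) *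
  \prod_(j < n) gbin (x j.+1 - x j) (2 * psum x j.+1 + psum e j.+1).

Lemma eq_spinon n e x y : (forall j, (j <= n)%N -> x j = y j) ->
  spinon n e x = spinon n e y.
Proof.
move=> xy; congr (qz _ * _); first by apply: eq_psum => j le; rewrite xy.
by apply: eq_bigr => j _; have lt := ltn_ord j; rewrite !xy //; lia.
Qed.

Lemma eq_fermion n e x y : (forall j, (j <= n)%N -> x j = y j) ->
  fermion n e x = fermion n e y.
Proof.
move=> xy; congr (qz _ * _); first by apply: eq_psum => j le; rewrite xy.
apply: eq_bigr => j _; have lt := ltn_ord j; rewrite !xy; try lia.
by congr (gbin _ (2 * _ + _)); apply: eq_psum => t ltt; apply: xy; lia.
Qed.

Lemma spinonS n e x : spinon n.+1 e x = spinon n e x *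
  (qz (x n.+1 * x n.+1 + e n.+1 * x n.+1) * iqp (x n.+1 - x n)).
Proof. by rewrite /spinon /sqr_exp psumS big_ord_recr qzD mulrACA. Qed.

Lemma fermionS n e x : fermion n.+1 e x = fermion n e x *
  (qz (x n.+1 * x n.+1 + e n.+1 * x n.+1) *
   gbin (x n.+1 - x n) (2 * psum x n.+1 + psum e n.+1)).
Proof. by rewrite /fermion /sqr_exp psumS big_ord_recr qzD mulrACA. Qed.

Lemma tow_tower n (e : nat -> int) : (forall j, (j < n)%N -> e j.+1 <= e j) ->
  exists h, tower (fun i : tow n => crd i n) (fun i => psum (crd i) n.+1) h
    (fun i => spinon n e (crd i)) (fun i => fermion n e (crd i)) (e n) (psum e n.+1).
Proof.
elim: n => [|n IHn] emono.
  exists (fun=> 0); have := tower_base (e 0%N).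
  congr tower; try (apply/funext => x).
  - by rewrite psumS psum0 add0r.
  - by rewrite /spinon big_ord0 mulr1 /sqr_exp psumS psum0 add0r.
  - by rewrite /fermion big_ord0 mulr1 /sqr_exp psumS psum0 add0r.
  - by rewrite psumS psum0 add0r.
have [|h tw] := IHn; first by move=> j lt; apply: emono; lia.
eexists; have := tower_next tw (emono n (leqnn _)).
have crdl (i : tow n) z j : (j <= n)%N -> crd ((i, z) : tow n.+1) j = crd i j.
  by move=> le /=; rewrite le.
have crdr (i : tow n) z : crd ((i, z) : tow n.+1) n.+1 = z by rewrite /= ltnn.
congr tower; try (apply/funext => -[i z]).
- by rewrite crdr.
- by rewrite [RHS]psumS crdr; congr (_ + _); apply: eq_psum => j lt; rewrite crdl.
- rewrite spinonS crdr crdl // (eq_spinon e (y := crd i)) // => j lt.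
  by rewrite crdl.
- rewrite fermionS crdr crdl // (eq_fermion e (y := crd i)) => [|j lt]; last first.
    by rewrite crdl.
  rewrite /next_W (@eq_psum (crd ((i, z) : tow n.+1)) (crd i)) // => j lt.
  by rewrite crdl.
- by rewrite [RHS]psumS.
Qed.

Lemma spinon_fermion n (e : nat -> int) B :
  (forall j, (j < n)%N -> e j.+1 <= e j) ->
  lsum (fun i : tow n => if psum (crd i) n.+1 == B then spinon n e (crd i) else 0)
  = qoo * lsum (fun i : tow n => fermion n e (crd i) *
      (iqp (psum (crd i) n.+1 - B) * iqp (psum (crd i) n.+1 + B + psum e n.+1))).
Proof.
move=> /tow_tower[h tw]; have := tower_id tw B (lexx 0).
rewrite (eq_lsum (G := fun i : tow n =>
  if psum (crd i) n.+1 == B then spinon n e (crd i) else 0)); last first.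
  by move=> i; rewrite mul0r oppr0 qz0 mul1r.
by move=> ->; congr (_ * _); apply: eq_lsum => i;
  rewrite mul0r oppr0 qz0 mul1r subr0.
Qed.

Lemma tow_coercive n (e : nat -> int) : (forall j, (j < n)%N -> e j.+1 <= e j) ->
  exists (w : tow n -> int) (C : int), [/\ coercive w, forall i, 0 <= w i &
    forall i, vgz (spinon n e (crd i)) (w i - C) /\
              vgz (fermion n e (crd i)) (w i - C)].
Proof.
move=> /tow_tower[h tw]; have [C gW] := tower_vgz tw.
exists (fun i => h i + `|crd i n|), (C + (`|e n| + 1) ^+ 2); split.
- exact: tower_coercive tw.
- by move=> i; rewrite addr_ge0 // (tower_h_ge0 tw).
move=> i; have [gi Wi] := gW i; have := sqr_lb (crd i n) (e n) => lb.
by split; [apply: vgzW gi|apply: vgzW Wi]; lia.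
Qed.

(** * The definitions of the statement inside the ring *)

Lemma qpowE x : qpow x = mono x.
Proof. by apply/funext => y; rewrite ser_coef_mono. Qed.

Lemma qaddE (f g : ser) : qadd f g = (f + g : ser).
Proof. by apply/funext => x; rewrite ser_coefD. Qed.

Lemma qsubE (f g : ser) : qsub f g = (f - g : ser).
Proof. by apply/funext => x; rewrite ser_coefB. Qed.

Lemma qmulE (f g : ser) : qmul f g = (f * g : ser).
Proof. by apply/funext => x; rewrite ser_coefM. Qed.

Lemma qzeroE : qzero = (0 : ser).
Proof. by apply/funext => x; rewrite ser_coef0. Qed.

Lemma qoneE : qone = (1 : ser).
Proof. by rewrite /qone qpowE. Qed.

Lemma big_qmulE (J : Type) (s : seq J) (P : pred J) (F : J -> qseries)
    (G : J -> ser) : (forall i, P i -> F i = G i) ->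
  \big[qmul/qone]_(i <- s | P i) F i = (\prod_(i <- s | P i) G i : ser).
Proof.
move=> FG; elim: s => [|i s IHs]; first by rewrite !big_nil qoneE.
by rewrite !big_cons; case: ifP => // Pi; rewrite IHs FG // qmulE.
Qed.

Lemma big_qaddE (J : Type) (s : seq J) (P : pred J) (F : J -> qseries)
    (G : J -> ser) : (forall i, P i -> F i = G i) ->
  \big[qadd/qzero]_(i <- s | P i) F i = (\sum_(i <- s | P i) G i : ser).
Proof.
move=> FG; elim: s => [|i s IHs]; first by rewrite !big_nil qzeroE.
by rewrite !big_cons; case: ifP => // Pi; rewrite IHs FG // qaddE.
Qed.

Lemma qsumE (I : choiceType) (A : set I) (F : I -> qseries) (G : I -> ser) :
  (forall i, A i -> F i = G i) ->
  summable (fun i => if i \in A then G i else 0) ->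
  qsum A F = lsum (fun i => if i \in A then G i else 0).
Proof.
move=> FG sG; apply/funext => x; rewrite lsum_set //; apply: eq_fsbigr => i.
by rewrite inE => /FG ->.
Qed.

Lemma qsumTE (I : choiceType) (F : I -> qseries) (G : I -> ser) :
  (forall i, F i = G i) -> summable G -> qsum [set: I] F = lsum G.
Proof.
move=> FG sG; have E : (fun i => if i \in [set: I] then G i else 0) = G.
  by apply/funext => i; rewrite in_setT.
by rewrite (qsumE (G := G)) ?E.
Qed.

Lemma qpochE n : qpoch n = qp n.
Proof.
rewrite /qpoch big_add1 big_mkord; apply: big_qmulE => i _.
by rewrite qoneE qpowE qsubE.
Qed.

Lemma qpoch_infE : qpoch_inf = qoo.
Proof. by rewrite qoo.unlock; apply/funext => x; rewrite /qpoch_inf qpochE. Qed.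

Lemma qinvE (f : ser) : vge (1 - f) 1 -> qinv f = ginv f.
Proof.
move=> f1; apply: qsumTE; last exact: summable_exp.
move=> k; elim: k => [|k IHk]; first by rewrite expr0 qoneE.
by rewrite iterS IHk qoneE qsubE qmulE exprS.
Qed.

Lemma qinv_qpoch n : qinv (qpoch n) = iqp n.
Proof. by rewrite qpochE iqp.unlock qinvE //; exact: vge_1Bqp. Qed.

Lemma vge_1Bqoo : vge (1 - qoo) 1.
Proof. by rewrite -opprB; apply: vgeN; have := vgz_qooB 0; rewrite qp0. Qed.

(** From here on [durfee 0] stands for 1/(q)_oo. *)
Lemma qinv_qpoch_inf : qinv qpoch_inf = durfee 0.
Proof.
rewrite qpoch_infE qinvE; last exact: vge_1Bqoo.
congr coef; apply: qoo_inj; rewrite durfee_qoo ginvP //; exact: vge_1Bqoo.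
Qed.

(** * q-binomials and the replacement of q by 1/q *)

Lemma intr_natE (a : int) : ((a%:~R : rat) \is a Num.nat) = (0 <= a).
Proof. by rewrite natrEint intr_int ler0z. Qed.

Lemma qbinomE (a c : int) : qbinom (a + c)%:~R c%:~R = gbin a c.
Proof.
rewrite /qbinom -rmorphB addrK !intr_natE /gbin.
case: a => [a|a] /=; last by rewrite qzeroE (@iqp_neg (Negz a)) // mul0r mulr0.
case: c => [c|c] /=; last by rewrite qzeroE (@iqp_neg (Negz c)) // !mulr0.
rewrite -PoszD !natrK !qinv_qpoch qpochE !qmulE; congr coef.
Qed.

Lemma gbinS (a c : nat) : gbin a.+1 c.+1
  = gbin a c.+1 + qz a.+1 * gbin a.+1 c.
Proof.
rewrite /gbin; have -> : absz (a.+1%:Z + c.+1%:Z)%R = (a + c).+2 by lia.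
have -> : absz (a%:Z + c.+1%:Z)%R = (a + c).+1 by lia.
have -> : absz (a.+1%:Z + c%:Z)%R = (a + c).+1 by lia.
have := iqpP a.+1; have := iqpP c.+1.
have -> : a.+1%:Z - 1 = a by lia.
have -> : c.+1%:Z - 1 = c by lia.
move=> -> ->; rewrite [qp (a + c).+2]qpS.
have -> : qz (a + c).+2 = qz a.+1 * qz c.+1 by rewrite -qzD; congr qz; lia.
ring.
Qed.

Lemma gbin_sym (a c : int) : gbin a c = gbin c a.
Proof. by rewrite /gbin addrC [iqp a * _]mulrC. Qed.

Lemma gbin0 (a : nat) : gbin a 0 = 1.
Proof. by rewrite /gbin addr0 iqp0 mulr1 qpK. Qed.

(** Induction on a + c: reversing the degrees exchanges the two forms of the q-Pascal rule, which
    are related by [gbin_sym]. *)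
Lemma gbin_palindrome (a c : nat) (x : rat) :
  gbin a c ((a * c)%:R - x) = gbin a c x.
Proof.
have mono1 y : (1 : ser) (- y) = (1 : ser) y.
  by rewrite -mono0 !ser_coef_mono oppr_eq0.
have [k] := ubnP (a + c); elim: k a c x => // k IHk [|a] [|c] x lt.
- by rewrite gbin0 mul0n sub0r mono1.
- by rewrite gbin_sym gbin0 mul0n sub0r mono1.
- by rewrite gbin0 muln0 sub0r mono1.
have Ea : gbin a c.+1 ((a.+1 * c.+1)%:R - x) = gbin a c.+1 (x - c.+1%:R).
  rewrite -(IHk a c.+1); last by lia.
  by congr (gbin _ _ _); rewrite mulSn natrD; ring.
have Ec : gbin a.+1 c ((a.+1 * c.+1)%:R - x - a.+1%:R) = gbin a.+1 c x.
  rewrite -[RHS](IHk a.+1 c); last by lia.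
  by congr (gbin _ _ _); rewrite mulnS natrD; ring.
rewrite [in LHS]gbinS [in RHS]gbin_sym [in RHS]gbinS !ser_coefD /qz !ser_coef_monoM.
by rewrite Ea Ec addrC (gbin_sym c) (gbin_sym c.+1).
Qed.

Lemma qmul_qpow x (f : qseries) y : qmul (qpow x) f y = f (y - x).
Proof.
rewrite /qmul (@fsum_widen _ [set x]); first by rewrite fsbig_set1 /qpow eqxx mul1r.
by move=> z /eqP/negbTE zx; rewrite /qpow zx mul0r.
Qed.

Lemma qflip_qpow x (f : qseries) : qflip (qmul (qpow x) f) = qmul (qpow (- x)) (qflip f).
Proof.
by apply/funext => y; rewrite /qflip !qmul_qpow; congr f; ring.
Qed.

Lemma qflip_gbin (a c : int) : qflip (gbin a c) = mono (- (a * c)%:~R) * gbin a c.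
Proof.
apply/funext => x; rewrite /qflip ser_coef_monoM opprK.
case: a => [a|a]; last by rewrite /gbin (@iqp_neg (Negz a)) // mul0r mulr0 !ser_coef0.
case: c => [c|c]; last by rewrite /gbin (@iqp_neg (Negz c)) // !mulr0 !ser_coef0.
by rewrite -PoszM -[X in _ = _ X](subKr (a * c)%:R) gbin_palindrome; congr (gbin _ _ _); ring.
Qed.

(** The division by (q)_{m_N} in the theorem cancels the numerator of the q-binomials of F. *)
Lemma gbin_iqp (a c : int) (L : nat) : a + c = L ->
  gbin a c * iqp L = iqp a * iqp c.
Proof. by rewrite /gbin => ->; rewrite mulrAC qpK mul1r. Qed.

(** * The Cartan matrix and its inverse *)

Lemma sum_delta (n a : nat) (g : nat -> rat) :
  \sum_(k < n) (k == a :> nat)%:R * g k = if (a < n)%N then g a else 0.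
Proof.
case: ltnP => [lt|le].
  rewrite (bigD1 (Ordinal lt)) //= eqxx mul1r big1 ?addr0 // => k.
  by rewrite -val_eqE /= => /negbTE ->; rewrite mul0r.
rewrite big1 // => k _; have := ltn_ord k.
by case: eqP => [->|]; rewrite ?mul0r // ltnNge le.
Qed.

(** The Cartan matrix is minus the second difference; zero boundary values at 0 and n + 1 make one
    formula valid in all rows. *)
Lemma cartan_col n (f : nat -> rat) : f 0%N = 0 -> f n.+1 = 0 ->
  cartan n *m (\col_(i < n) f i.+1) = \col_(i < n) (2 * f i.+1 - f i - f i.+2).
Proof.
move=> f0 fn; apply/matrixP => i j; rewrite mulmxBl mul_scalar_mx !mxE -addrA.
congr (_ + _); rewrite -opprD; congr (- _).
case: i => -[|m] lt /=.
  rewrite f0 add0r (eq_bigr (fun k : 'I_n => (k == 1%N :> nat)%:R * f k.+1)); last first.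
    by move=> k _; rewrite !mxE orbF eq_sym.
  rewrite (sum_delta n 1 (fun k => f k.+1)); case: ltnP => // le.
  by have -> : f 2%N = 0 by rewrite -fn; congr f; lia.
rewrite (eq_bigr (fun k : 'I_n => (k == m :> nat)%:R * f k.+1 +
    (k == m.+2 :> nat)%:R * f k.+1)); last first.
  move=> k _; rewrite !mxE -mulrDl -natrD; congr (_%:R * _) => /=.
  by rewrite eqSS (eq_sym m.+2); case: (eqVneq (k : nat) m) => [->|_] /=; lia.
rewrite big_split /= (sum_delta n m (fun k => f k.+1)) (sum_delta n m.+2 (fun k => f k.+1)).
rewrite (ltnW lt); congr (_ + _); case: ltnP => // le.
by have -> : f m.+3 = 0 by rewrite -fn; congr f; lia.
Qed.

Lemma cartan_unit n : cartan n \in unitmx.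
Proof.
(* The Green function min(i, j) - i j / (n + 1) of the second difference. *)
pose g (k j : nat) : rat := (minn j k.+1)%:R - j%:R * k.+1%:R / n.+1%:R.
have n1 : n.+1%:R != 0 :> rat by rewrite pnatr_eq0.
pose A : 'M[rat]_n := \matrix_(i, k) g k i.+1.
suff CA : cartan n *m A = 1%:M by have [] := mulmx1_unit CA.
apply/matrixP => i k.
have -> : (cartan n *m A) i k = (cartan n *m (\col_(i < n) g k i.+1)) i 0.
  by rewrite !mxE; apply: eq_bigr => j _; rewrite !mxE.
have lt := ltn_ord k; rewrite cartan_col; last 2 first.
- by rewrite /g min0n !mul0r subrr.
- by rewrite /g (minn_idPr _) 1?mulrAC ?divff ?mul1r ?subrr //; lia.
rewrite !mxE /g -(inj_eq val_inj) /=; set x := (n.+1%:R)^-1.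
have [E|E|E] := ltngtP (i : nat) k.
- have -> : minn i.+1 k.+1 = i.+1 by lia.
  have -> : minn i k.+1 = i by lia.
  have -> : minn i.+2 k.+1 = i.+2 by lia.
  by rewrite mulr0n -(natr1 i.+1) -(natr1 i); ring.
- have -> : minn i.+1 k.+1 = k.+1 by lia.
  have -> : minn i k.+1 = k.+1 by lia.
  have -> : minn i.+2 k.+1 = k.+1 by lia.
  by rewrite mulr0n -(natr1 i.+1) -(natr1 i); ring.
rewrite E; have -> : minn k.+1 k.+1 = k.+1 by lia.
have -> : minn k k.+1 = k by lia.
have -> : minn k.+2 k.+1 = k.+1 by lia.
by rewrite mulr1n -(natr1 k.+1) -(natr1 k); ring.
Qed.

Lemma invmx_cartan_col n (f : nat -> rat) : f 0%N = 0 -> f n.+1 = 0 ->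
  invmx (cartan n) *m (\col_(i < n) (2 * f i.+1 - f i - f i.+2))
  = \col_(i < n) f i.+1.
Proof. by move=> f0 fn; rewrite -cartan_col // mulKmx // cartan_unit. Qed.

Lemma cartan_tr n : (cartan n)^T = cartan n.
Proof.
apply/matrixP => i j; rewrite !mxE (eq_sym j) orbC.
by [].
Qed.

Lemma bilinE n (A : 'M[rat]_n) u w : A^T = A ->
  bilin u A w = \sum_i (A *m u) i 0 * w i 0.
Proof.
move=> sA; rewrite /bilin -[u^T *m A]trmxK trmx_mul trmxK sA mxE.
by apply: eq_bigr => i _; rewrite mxE.
Qed.

Lemma coordvS (R : nmodType) n (v : 'cV[R]_n) (k : 'I_n) : Defs.coord v k.+1 = v k 0.
Proof. by rewrite /Defs.coord (big_pred1 k) // => j; rewrite eqSS -val_eqE. Qed.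

Lemma coordv0 (R : nmodType) n (v : 'cV[R]_n) : Defs.coord v 0 = 0.
Proof. by rewrite /Defs.coord big_pred0. Qed.

Lemma coordv_out (R : nmodType) n (v : 'cV[R]_n) j : (n < j)%N -> Defs.coord v j = 0.
Proof.
move=> lt; rewrite /Defs.coord big_pred0 // => k.
by have ltk := ltn_ord k; apply/negbTE/eqP => E; lia.
Qed.

Lemma coordv_col (R : nmodType) n (f : nat -> R) j : (0 < j <= n)%N ->
  Defs.coord (\col_(i < n) f i.+1) j = f j.
Proof.
case: j => // j /= lt; rewrite -[j.+1]/((Ordinal lt : nat).+1) coordvS.
by rewrite mxE.
Qed.

(** * The exponent of the string functions *)

Lemma abel_sum (y : nat -> rat) (M : rat) n (Y := fun k => \sum_(j < k) y j) :
  \sum_(j < n) (j.+1%:R * M - Y j.+1) * (y j.+1 - y j)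
  = n%:R * M * y n - M * Y n - Y n * y n + \sum_(j < n) y j ^+ 2.
Proof.
elim: n => [|n IHn]; first by rewrite /Y !big_ord0; ring.
rewrite big_ord_recr /= IHn /Y !big_ord_recr /= -!natr1; ring.
Qed.

(* Sequences are indexed from 0: this is e_{j+1}. *)
Definition eseq (l : nat) (d : int) (j : nat) : int := d + (j < l)%N%:Z.

Lemma psum_eseq l d k : psum (eseq l d) k = k%:Z * d + (minn k l)%:Z.
Proof.
elim: k => [|k IHk]; first by rewrite psum0 min0n mul0r.
by rewrite psumS IHk /eseq; lia.
Qed.

Lemma eseq_mono l d j : eseq l d j.+1 <= eseq l d j.
Proof. by rewrite /eseq; lia. Qed.

Section StringExponent.
Variables (n : nat) (v : 'cV[nat]_n) (y : nat -> int).
Hypothesis vy : forall j, (j < n)%N -> y j.+1 - y j = (Defs.coord v j.+1)%:Z.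

Let yq (j : nat) : rat := (y j)%:~R.
Let Y k := \sum_(j < k) yq j.
Let M : rat := Y n.+1 / n.+1%:R.
Let f (j : nat) : rat := j%:R * M - Y j.

Let YE k : Y k = (psum y k)%:~R.
Proof. by rewrite /Y /psum rmorph_sum. Qed.

Let f0 : f 0 = 0.
Proof. by rewrite /f /Y big_ord0 mul0r subrr. Qed.

Let fn : f n.+1 = 0.
Proof. by rewrite /f /M mulrC mulfVK ?subrr // pnatr_eq0. Qed.

(** Minus the second difference of f recovers the differences of y, that is v, and the mean M is
    chosen to make f vanish at n + 1. *)
Lemma invmx_cartan_toQ : invmx (cartan n) *m toQ v = \col_(i < n) f i.+1.
Proof.
rewrite -(invmx_cartan_col f0 fn); congr (_ *m _); apply/colP => i.
have := vy (ltn_ord i); rewrite coordvS => vi.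
rewrite !mxE /f /Y !big_ord_recr /=; rewrite -[LHS]/((v i 0)%:~R) -vi.
by rewrite rmorphB /= /yq -!natr1; ring.
Qed.

Lemma coord_string : Defs.coord (invmx (cartan n) *m toQ v) 1
  = (psum y n.+1)%:~R / n.+1%:R - (y 0%N)%:~R.
Proof.
rewrite invmx_cartan_toQ -YE.
have f1 : f 1 = Y n.+1 / n.+1%:R - (y 0%N)%:~R.
  by rewrite /f /M mul1r /Y [X in _ - X]big_ord1.
(* For n = 0 the default coordinate 0 of the empty vector agrees with f 1, the boundary value at n +
   1. *)
rewrite -f1; have [n0|n0] := posnP n; last by rewrite coordv_col.
rewrite coordv_out ?n0 //; rewrite -fn; congr f; lia.
Qed.

(** For a fixed sum B of the y_j the two exponents differ by a constant: e_l contributes minus the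
    l-th coordinate of C^{-1} v, which is y_0 + ... + y_{l-1} - l B / (n + 1). *)
Lemma bilin_string (l : nat) (d : int) (B := psum y n.+1) : (l <= n)%N ->
  bilin (toQ v) (invmx (cartan n)) (toQ v - unitv _ n l)
  = (sqr_exp (eseq l d) y n.+1)%:~R - (d * B)%:~R
    - (B ^+ 2 + l%:Z * B)%:~R / n.+1%:R.
Proof.
move=> le_ln; rewrite bilinE; last by rewrite trmx_inv cartan_tr.
rewrite invmx_cartan_toQ.
rewrite (eq_bigr (fun j : 'I_n => (j.+1%:R * M - Y j.+1) * (yq j.+1 - yq j)
   - (j == l.-1 :> nat)%:R * (if (0 < l)%N then f j.+1 else 0))); last first.
  move=> i _; rewrite !mxE -/(f _) mulrBr; congr (_ * _ - _).
    have := vy (ltn_ord i); rewrite coordvS /yq -rmorphB /= => ->.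
    by [].
  rewrite mulrC; case: (posnP l) => [->|l0]; first by rewrite mul0r mulr0.
  by congr (_%:R * _); congr nat_of_bool; apply/eqP/eqP; lia.
rewrite sumrB abel_sum -/(Y n).
rewrite (sum_delta n l.-1 (fun j => if (0 < l)%N then f j.+1 else 0)).
have -> : (if (l.-1 < n)%N then if (0 < l)%N then f l.-1.+1 else 0 else 0) = f l.
  case: (posnP l) => [->|l0]; first by rewrite f0; case: ifP.
  by rewrite prednK // ifT //; lia.
have -> : sqr_exp (eseq l d) y n.+1 = psum (fun j => y j * y j) n.+1
    + d * B + psum y l.
  rewrite /sqr_exp /B; have [k kE] : exists k, n.+1 = k by exists n.+1.
  have : (l <= k)%N by lia.
  have low k' : (k' <= l)%N -> psum (fun j => y j * y j + eseq l d j * y j) k'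
      = psum (fun j => y j * y j) k' + d * psum y k' + psum y k'.
    elim: k' => [|k' IH] lt; first by rewrite !psum0; ring.
    by rewrite !psumS IH ?(ltnW lt) // /eseq (_ : (k' < l)%N%:Z = 1); [ring|lia].
  rewrite kE => {kE}; elim: k => [|k IHk].
    by rewrite leqn0 => /eqP l0; rewrite low ?l0.
  rewrite leq_eqVlt ltnS => /orP[/eqP <-|lk]; first by rewrite low.
  by rewrite !psumS IHk // /eseq (_ : (k < l)%N%:Z = 0); [ring|lia].
have -> : \sum_(j < n) yq j ^+ 2 = (psum (fun j => y j * y j) n)%:~R.
  rewrite /psum rmorph_sum; apply: eq_bigr => j _.
  by rewrite rmorphM expr2.
have n1 : n.+1%:R != 0 :> rat by rewrite pnatr_eq0.
rewrite /f /M !YE /B !psumS -[l%:R]/(l%:Z%:~R) /yq -natr1 in n1 *.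
rewrite !(rmorphD, rmorphB, rmorphM, rmorphXn) /=.
by field.
Qed.

End StringExponent.

(** * String functions as spinon sums *)

Lemma monoVK x (f : ser) : mono (- x) * (mono x * f) = f.
Proof. by rewrite mulrA [mono _ * mono _]mulrC monoK mul1r. Qed.

Definition string_ser (n l : nat) (v : 'cV[nat]_n) : ser :=
  mono (bilin (toQ v) (invmx (cartan n)) (toQ v - unitv _ n l)) *
  \prod_(i < n) iqp (v i 0)%:Z.

Definition string_fam (n l : nat) (m : int) (v : 'cV[nat]_n) : ser :=
  if v \in @string_set n.+1 l m then string_ser l v else 0.

(** The string function of level n + 1 without 1/(q)_oo and the power of q in front. *)
Definition string_sum (n l : nat) (m : int) : ser := lsum (@string_fam n l m).

Definition heights (n : nat) (v : 'cV[nat]_n) (y0 : int) (j : nat) : int :=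
  y0 + psum (fun t => (Defs.coord v t.+1)%:Z) j.

Lemma heightsS n (v : 'cV[nat]_n) y0 j :
  heights v y0 j.+1 - heights v y0 j = (Defs.coord v j.+1)%:Z.
Proof. by rewrite /heights psumS; ring. Qed.

Lemma psum_heights n (v : 'cV[nat]_n) y0 k :
  psum (heights v y0) k = k%:Z * y0 + psum (heights v 0) k.
Proof.
elim: k => [|k IHk]; first by rewrite !psum0; ring.
by rewrite !psumS IHk /heights; lia.
Qed.

(** The differences v determine the heights up to the base height; the quotient is the base height
    that makes them sum to B, provided the division is exact. By [string_setP] it is exact precisely
    on the string set of index -(2B + l). *)
Definition to_tow (n : nat) (B : int) (v : 'cV[nat]_n) : tow n :=
  mk n (heights v ((B - psum (heights v 0) n.+1) %/ n.+1)%Z).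

Lemma string_setP n l (B : int) (v : 'cV[nat]_n) :
  reflect (psum (crd (to_tow B v)) n.+1 = B)
    (v \in @string_set n.+1 l (- (2 * B + l%:Z))).
Proof.
have n1 : n.+1%:R != 0 :> rat by rewrite pnatr_eq0.
set y0 := ((B - psum (heights v 0) n.+1) %/ n.+1)%Z.
have -> : psum (crd (to_tow B v)) n.+1 = n.+1%:Z * y0 + psum (heights v 0) n.+1.
  by rewrite -psum_heights; apply: eq_psum => j lt; rewrite crd_mk.
have E : (- (2 * B + l%:Z) + l%:Z)%:~R / (2 * n.+1%:R)
    + Defs.coord (invmx (cartan n) *m toQ v) 1
  = (psum (heights v 0) n.+1 - B)%:~R / n.+1%:R :> rat.
  rewrite (@coord_string n v (heights v 0)) => [|j _]; last exact: heightsS.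
  rewrite /heights psum0 !(rmorphD, rmorphN, rmorphM) /=.
  by field; rewrite nat1r.
apply: (iffP idP); rewrite in_setE /string_set /= E.
  move=> /intrP[z zE]; rewrite /y0.
  have XE : psum (heights v 0) n.+1 - B = z * n.+1%:Z.
    apply: (@intr_inj rat); rewrite rmorphM /= -zE -[(n.+1%:Z)%:~R]/(n.+1%:R).
    by rewrite divfK.
  have -> : B - psum (heights v 0) n.+1 = - z * n.+1%:Z by lia.
  by rewrite mulzK //; lia.
move=> BE; have -> : psum (heights v 0) n.+1 - B = - y0 * n.+1%:Z by lia.
by rewrite rmorphM /= -[(n.+1%:Z)%:~R]/(n.+1%:R) mulfK // intr_int.
Qed.

Definition spinon_fam (n l : nat) (d B : int) (i : tow n) : ser :=
  if psum (crd i) n.+1 == B then spinon n (eseq l d) (crd i) else 0.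

Lemma spinon_summable n l d B : summable (@spinon_fam n l d B).
Proof.
have [w [C [cw _ gW]]] := @tow_coercive n (eseq l d) (fun j _ => eseq_mono l d j).
by apply: (@summable_coercive _ _ w C cw) => i; apply: vgz_if; case: (gW i).
Qed.

Definition string_shift (n l : nat) (d B : int) : rat :=
  (B ^+ 2 + l%:Z * B)%:~R / n.+1%:R + (d * B)%:~R.

Lemma crd_to_tow n B (v : 'cV[nat]_n) j : (j < n)%N ->
  crd (to_tow B v) j.+1 - crd (to_tow B v) j = (Defs.coord v j.+1)%:Z.
Proof. by move=> lt; rewrite !crd_mk ?(ltnW lt) // heightsS. Qed.

Lemma spinon_fam_to_tow n l d B (v : 'cV[nat]_n) : (l <= n)%N ->
  v \in @string_set n.+1 l (- (2 * B + l%:Z)) ->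
  spinon_fam l d B (to_tow B v) = mono (string_shift n l d B) * string_ser l v.
Proof.
move=> ln /string_setP BE; rewrite /spinon_fam BE eqxx /spinon /string_ser mulrA.
rewrite (@bilin_string n v (crd (to_tow B v)) _ l d ln) => [|j]; last exact: crd_to_tow.
rewrite BE -monoD; congr (_ * _).
  by congr mono; rewrite /string_shift; ring.
by apply: eq_bigr => i _; rewrite crd_to_tow // coordvS.
Qed.

Lemma to_tow_inj n l B :
  set_inj (@string_set n.+1 l (- (2 * B + l%:Z))) (@to_tow n B).
Proof.
move=> v w _ _ vw; apply/colP => k.
have := crd_to_tow B v (ltn_ord k); rewrite vw crd_to_tow // !coordvS.
by move=> [->].
Qed.

(** A decreasing step kills the spinon term through 1/(q)_n with n < 0. Without decreasing steps the
    differences form a vector v, from which i is recovered since its coordinates sum to B. *)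
Lemma spinon_fam_supp n l d B (i : tow n) :
  ~ (to_tow B @` @string_set n.+1 l (- (2 * B + l%:Z))) i ->
  spinon_fam l d B i = 0.
Proof.
move=> ni; rewrite /spinon_fam; case: eqP => // BE.
have [pos|] := pselect (forall j : 'I_n, 0 <= crd i j.+1 - crd i j); last first.
  move=> /existsNP[j /negP]; rewrite -ltNge => neg.
  rewrite /spinon (bigD1 j) //= (iqp_neg neg).
  by rewrite mul0r mulr0.
pose v : 'cV[nat]_n := \col_(j < n) absz (crd i j.+1 - crd i j)%R.
have vE (j : nat) : (j < n)%N -> (Defs.coord v j.+1)%:Z = crd i j.+1 - crd i j.
  move=> lt; have := coordvS v (Ordinal lt); rewrite mxE /= => ->.
  by have := pos (Ordinal lt); rewrite /=; lia.
have hE y0 j : (j <= n)%N -> heights v y0 j = crd i j + (y0 - crd i 0).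
  elim: j => [|j IHj] lt; first by rewrite /heights psum0; ring.
  have := heightsS v y0 j; rewrite vE // IHj; [lia|exact: ltnW].
have E : to_tow B v = i.
  rewrite /to_tow; apply: mk_crd => j le; rewrite hE //.
  have -> : psum (heights v 0) n.+1 = B - n.+1%:Z * crd i 0.
    rewrite -BE; have := psum_heights v (crd i 0) n.+1.
    rewrite (@eq_psum _ (crd i)) => [->|k lt]; [ring|rewrite hE //; ring].
  rewrite subKr mulKz //; ring.
case: ni; exists v => //.
have : v \in @string_set n.+1 l (- (2 * B + l%:Z)) by apply/string_setP; rewrite E.
by rewrite inE.
Qed.

Lemma string_fam_spinon n l d B (v : 'cV[nat]_n) : (l <= n)%N ->
  (if v \in @string_set n.+1 l (- (2 * B + l%:Z))
   then spinon_fam l d B (to_tow B v) else 0)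
  = mono (string_shift n l d B) * string_fam l (- (2 * B + l%:Z)) v.
Proof.
move=> ln; rewrite /string_fam; case: ifP => [|_]; last by rewrite mulr0.
exact: spinon_fam_to_tow.
Qed.

Lemma string_summable n l m : (l <= n)%N -> (2 %| m + l%:Z)%Z ->
  summable (@string_fam n l m).
Proof.
move=> ln /dvdzP[q qE]; have -> : m = - (2 * - q + l%:Z) by lia.
apply: eq_summable (summableM (mono (- string_shift n l 0 (- q)))
  (summable_reindex (@to_tow_inj n l (- q)) (spinon_summable n l 0 (- q)))) => v.
by rewrite string_fam_spinon // monoVK.
Qed.

Lemma string_sum_spinon n l d B : (l <= n)%N ->
  lsum (@spinon_fam n l d B)
  = mono (string_shift n l d B) * string_sum n l (- (2 * B + l%:Z)).
Proof.
move=> ln; rewrite (lsum_reindex (@to_tow_inj n l B)) //.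
- rewrite lsumM; last by apply: string_summable => //; apply/dvdzP; exists (- B); lia.
  by apply: eq_lsum => v; rewrite string_fam_spinon.
- exact: spinon_fam_supp.
- exact: spinon_summable.
Qed.

(** On the right side of [spinon_fermion] at d = 0, the substitution B -> -B - l swaps the factors
    1/(q)_{X-B} and 1/(q)_{X+B+l}, and it changes the sign of m = -(2B + l). *)
Lemma string_sumN n l m : (l <= n)%N -> (2 %| m + l%:Z)%Z ->
  string_sum n l (- m) = string_sum n l m.
Proof.
move=> ln /dvdzP[q qE].
pose B := - q; have mE : m = - (2 * B + l%:Z) by rewrite /B; lia.
have mE' : - m = - (2 * (- B - l%:Z) + l%:Z) by rewrite /B; lia.
have H := string_sum_spinon 0 B ln; have H' := string_sum_spinon 0 (- B - l%:Z) ln.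
have mono_inj x (f g : ser) : mono x * f = mono x * g -> f = g.
  by move=> /(congr1 ( *%R (mono (- x)))); rewrite !monoVK.
rewrite mE' mE; apply: (@mono_inj (string_shift n l 0 B)); rewrite -H.
have -> : string_shift n l 0 B = string_shift n l 0 (- B - l%:Z).
  by rewrite /string_shift !mul0r; congr (_%:~R / _ + _); ring.
rewrite -H' /spinon_fam !spinon_fermion; try by move=> j _; exact: eseq_mono.
congr (_ * _); apply: eq_lsum => i; congr (_ * _); rewrite mulrC.
rewrite psum_eseq; have -> : minn n.+1 l = l by lia.
by congr (iqp _ * iqp _); lia.
Qed.

Lemma string_sumD2N n l m k : string_sum n l (m + 2 * n.+1%:Z * k) = string_sum n l m.
Proof.
apply: eq_lsum => v; rewrite /string_fam.
congr (if _ then _ else _); congr (_ \in _); apply/seteqP.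
have n1 : n.+1%:R != 0 :> rat by rewrite pnatr_eq0.
suff E : (m + 2 * n.+1%:Z * k + l%:Z)%:~R / (2 * n.+1%:R)
    = k%:~R + (m + l%:Z)%:~R / (2 * n.+1%:R) :> rat.
  have intD (x : rat) : (k%:~R + x \is a Num.int) = (x \is a Num.int).
    by apply: rpredDl; exact: intr_int.
  by split=> w; rewrite /string_set /= E -[k%:~R + _ + _]addrA intD.
rewrite !(rmorphD, rmorphM) /=; field.
by rewrite nat1r.
Qed.

Lemma stringfE n l m : (l <= n)%N -> (2 %| m + l%:Z)%Z ->
  stringf n.+1 l m = mono (string_exp n.+1 l) * (durfee 0 * string_sum n l m).
Proof.
move=> ln ml; rewrite /stringf qpowE qinv_qpoch_inf.
rewrite (@qsumE _ _ _ (@string_ser n l)) ?qmulE //; last exact: string_summable.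
move=> v _; rewrite /string_term /string_ser qpowE.
rewrite (@big_qmulE _ _ _ _ (fun i => iqp (v i 0)%:Z)) ?qmulE // => i _.
exact: qinv_qpoch.
Qed.

(** * Branching functions as sums over j alone *)

Lemma lsum_sum (I : choiceType) (K : Type) (s : seq K) (P : pred K)
    (F : K -> I -> ser) : (forall k, P k -> summable (F k)) ->
  summable (fun i => \sum_(k <- s | P k) F k i) /\
  \sum_(k <- s | P k) lsum (F k) = lsum (fun i => \sum_(k <- s | P k) F k i).
Proof.
move=> sF; elim: s => [|k s [sIH IHs]].
  split; last by rewrite big_nil lsum0 // => i; rewrite big_nil.
  apply: (@summable_supp _ _ set0) => [|i _]; first exact: finite_set0.
  by rewrite big_nil.
have [Pk|nPk] := boolP (P k); last first.
  split; first by apply: eq_summable sIH => i; rewrite big_cons (negbTE nPk).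
  by rewrite big_cons (negbTE nPk) IHs; apply: eq_lsum => i; rewrite big_cons (negbTE nPk).
split; first by apply: eq_summable (summableD (sF k Pk) sIH) => i; rewrite big_cons Pk.
rewrite big_cons Pk IHs -lsumD //; last exact: sF.
by apply: eq_lsum => i; rewrite big_cons Pk.
Qed.

Definition qcoercive (kappa : int -> rat) :=
  forall x, finite_set [set j | kappa j <= x].

Lemma quad_coercive (A B : int) (c D : rat) : 0 < A -> 0 < D ->
  qcoercive (fun j => (A * j ^+ 2 + B * j)%:~R / D + c).
Proof.
move=> A0 D0 x.
apply: sub_finite_set (coercive_int (Num.ceil ((x - c) * D) + (`|B| + 1) ^+ 2)).
move=> j /=; rewrite -lerBrDr ler_pdivrMr // => le.
have le' : A * j ^+ 2 + B * j <= Num.ceil ((x - c) * D).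
  by rewrite -(ler_int rat); apply: le_trans le (ceil_ge _).
have := sqr_lb j B; have : j * j <= A * j ^+ 2.
  by rewrite -expr2 ler_peMl ?sqr_ge0 //; lia.
lia.
Qed.

Lemma qcoercive_summable (kappa : int -> rat) :
  qcoercive kappa -> summable (fun j => mono (kappa j)).
Proof. by move=> ck; apply: summable_vge ck _ => j; exact: vge_mono. Qed.

Lemma divr_int_dvdz (N : nat) (M : int) :
  (M%:~R / (2 * N.+1%:R) \is a @Num.int rat) = (2 * N.+1%:Z %| M)%Z.
Proof.
have N1 : 2 * N.+1%:R != 0 :> rat by rewrite mulf_neq0 // pnatr_eq0.
apply/intrP/dvdzP => -[z zE]; exists z.
  apply: (@intr_inj rat); rewrite !rmorphM /= -zE divfK //.
by rewrite zE !rmorphM /= mulfK.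
Qed.

Lemma mu_setE (n : nat) (P' a k j : int) :
  (j \in mu_set n.+1 P' a (k%:~R / 2))
  = (2 * n.+1%:Z %| a + 2 * P' * j - k)%Z || (2 * n.+1%:Z %| a + 2 * P' * j + k)%Z.
Proof.
have n1 : n.+1%:R != 0 :> rat by rewrite pnatr_eq0.
rewrite -!divr_int_dvdz.
have E (c : int) : (mu P' a j - c%:~R / 2) / n.+1%:R
    = (a + 2 * P' * j - c)%:~R / (2 * n.+1%:R) :> rat.
  rewrite /mu !(rmorphD, rmorphN, rmorphM) /=; field.
  by rewrite nat1r.
have E1 := E k; have E2 := E (- k).
rewrite opprK rmorphN mulNr in E2.
by apply/idP/idP; rewrite in_setE /mu_set /= /congQ E1 E2.
Qed.

Lemma mul_window (u D : int) : 0 < D -> - D < u * D -> u * D < 2 * D ->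
  u = 0 \/ u = 1.
Proof.
move=> D0 lo hi; have u0 : -1 < u by rewrite -(ltr_pM2r D0) mulN1r.
have u2 : u < 2 by rewrite -(ltr_pM2r D0).
lia.
Qed.

(** Exactly one k in 0, ..., N of the parity of l is congruent to M or -M modulo 2N: the residue of
    M folded into [0, N]. The string function is unchanged by this folding, by its period 2N and its
    evenness. At k = 0 and k = N both congruences hold, but the union in [mu_set] counts j once. *)
Lemma mu_class (n l : nat) (P' a j : int) (t : ser) : (l <= n)%N ->
  (2 %| a + l%:Z)%Z ->
  \sum_(0 <= k < n.+2 | odd k == odd l) string_sum n l k%:Z *
     (if j \in mu_set n.+1 P' a (k%:R / 2) then t else 0)
  = t * string_sum n l (a + 2 * P' * j).
Proof.
move=> ln al; set M := a + 2 * P' * j; pose N := n.+1%:Z.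
have Ml : (2 %| M + l%:Z)%Z by rewrite /M; lia.
pose q := (M %/ (2 * N))%Z; pose r := (M %% (2 * N))%Z.
have ME : M = q * (2 * N) + r by exact: divz_eq.
have r0 : 0 <= r by apply: modz_ge0.
have r2N : r < 2 * N by apply: ltz_pmod.
pose k0 := absz (if r <= N then r else 2 * N - r).
have k0n : (k0 < n.+2)%N by rewrite /k0 /N; case: ifP; lia.
have k0E : k0%:Z = if r <= N then r else 2 * N - r by rewrite /k0 /N; case: ifP; lia.
have k0l : odd k0 == odd l.
  have : (2 %| k0%:Z + l%:Z)%Z.
    rewrite k0E; move: Ml; rewrite ME; case: ifP => _ Ml.
      by lia.
    by lia.
  by lia.
rewrite big_mkord (bigD1 (Ordinal k0n)) //= big1 ?addr0 => [|k /andP[kl]]; last first.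
  rewrite -val_eqE /= => kk0.
  suff -> : (j \in mu_set n.+1 P' a ((k : nat)%:R / 2)) = false by rewrite mulr0.
  rewrite -[(k : nat)%:R]/((k : nat)%:Z%:~R) mu_setE -/M -/N.
  have kN : (k : nat)%:Z <= N by have := ltn_ord k; rewrite /N; lia.
  have {}kk0 : (k : nat)%:Z <> k0%:Z by move=> [] /eqP; exact/negP.
  have N0 : 0 < N by [].
  clear kl; apply/negP => /orP[] /dvdzP[z]; rewrite ME => zE; apply: kk0; rewrite k0E.
    have : (k : nat)%:Z = r + (q - z) * (2 * N) by rewrite mulrBl -zE; ring.
    move: (q - z) (nat_of_ord k) kN => u m kN kE.
    have [t0|t1] : u = 0 \/ u = 1 by apply: (@mul_window u (2 * N)); lia.
      have rN : r <= N by rewrite t0 in kE; lia.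
      by rewrite rN kE t0; ring.
    by rewrite t1 in kE; lia.
  have : (k : nat)%:Z = - r + (z - q) * (2 * N) by rewrite mulrBl -zE; ring.
  move: (z - q) (nat_of_ord k) kN => u m kN kE.
  have [t0|t1] : u = 0 \/ u = 1 by apply: (@mul_window u (2 * N)); lia.
    by move: kE; rewrite t0; case: ifP; lia.
  by move: kE; rewrite t1; case: ifP; lia.
have kdvd : (2 * N %| M - k0%:Z)%Z || (2 * N %| M + k0%:Z)%Z.
  rewrite k0E ME; case: ifP => _.
    by rewrite addrK dvdz_mull.
  have -> : q * (2 * N) + r + (2 * N - r) = (q + 1) * (2 * N) by ring.
  by rewrite orbC dvdz_mull.
have := mu_setE n P' a k0 j; rewrite -/M -/N kdvd => ->; rewrite mulrC; congr (_ * _).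
rewrite ME k0E -/N; case: ifP => _.
  have -> : q * (2 * N) + r = r + 2 * n.+1%:Z * q by rewrite /N; ring.
  by rewrite string_sumD2N.
have -> : q * (2 * N) + r = - (2 * N - r) + 2 * n.+1%:Z * (q + 1) by rewrite /N; ring.
rewrite string_sumD2N string_sumN //.
have /dvdzP[z zE] := Ml; apply/dvdzP; exists (q * N + N + l%:Z - z).
have -> : r = z * 2 - l%:Z - q * (2 * N) by rewrite -zE ME; ring.
ring.
Qed.

Lemma branching_part (n l : nat) (P' a : int) (kappa : int -> rat) :
  (l <= n)%N -> (2 %| a + l%:Z)%Z -> qcoercive kappa ->
  \sum_(0 <= k < n.+2 | odd k == odd l) string_sum n l k%:Z *
    lsum (fun j => if j \in mu_set n.+1 P' a (k%:R / 2) then mono (kappa j) else 0)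
  = lsum (fun j => mono (kappa j) * string_sum n l (a + 2 * P' * j)).
Proof.
move=> ln al ck; have sk := qcoercive_summable ck.
pose F (k : nat) j := string_sum n l k%:Z *
  (if j \in mu_set n.+1 P' a (k%:R / 2) then mono (kappa j) else 0).
have sF (k : nat) : summable (F k) by apply: summableM; exact: summable_sub.
have [_] := @lsum_sum _ _ (index_iota 0 n.+2) (fun k => odd k == odd l) F (fun k _ => sF k).
rewrite (eq_lsum (fun j => @mu_class n l P' a j (mono (kappa j)) ln al)) => <-.
by apply: eq_bigr => k _; rewrite lsumM //; exact: summable_sub.
Qed.

(** The congruences only select the index of the string function belonging to each j, and the power
    [string_exp] of the string functions cancels the one in front. *)
Lemma branchingE (n l : nat) (P P' R S : int) :
  (l <= n)%N -> 0 < P -> 0 < P' -> (2 %| R - S + l%:Z)%Z ->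
  branching P P' n.+1 R S l = (durfee 0 * (
    lsum (fun j => mono ((j * (j * P * P' + P' * R - P * S))%:~R / n.+1%:R) *
            string_sum n l (R - S + 2 * P' * j))
    - lsum (fun j => mono (((j * P' + S) * (j * P + R))%:~R / n.+1%:R) *
            string_sum n l (R + S + 2 * P' * j))) : ser).
Proof.
move=> ln P0 P'0 RSl.
have n0 : 0 < n.+1%:R :> rat by rewrite ltr0n.
have PP0 : 0 < P * P' by exact: mulr_gt0.
have RSl' : (2 %| R + S + l%:Z)%Z by lia.
have c1 : qcoercive (fun j => (j * (j * P * P' + P' * R - P * S))%:~R / n.+1%:R).
  have := @quad_coercive (P * P') (P' * R - P * S) 0 n.+1%:R PP0 n0.
  by congr qcoercive; apply/funext => j; rewrite addr0; congr (_%:~R / _); ring.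
have c2 : qcoercive (fun j => ((j * P' + S) * (j * P + R))%:~R / n.+1%:R).
  have := @quad_coercive (P * P') (P' * R + P * S) ((S * R)%:~R / n.+1%:R) n.+1%:R PP0 n0.
  by congr qcoercive; apply/funext => j; rewrite -mulrDl -rmorphD; congr (_%:~R / _); ring.
rewrite -(branching_part P' ln RSl c1) -(branching_part P' ln RSl' c2) -sumrB.
rewrite /branching qpowE.
rewrite (@big_qaddE _ _ _ _ (fun k : nat => mono (string_exp n.+1 l) * (durfee 0 *
  (string_sum n l k%:Z * lsum (fun j => if j \in mu_set n.+1 P' (R - S) (k%:R / 2)
     then mono ((j * (j * P * P' + P' * R - P * S))%:~R / n.+1%:R) else 0)
   - string_sum n l k%:Z * lsum (fun j => if j \in mu_set n.+1 P' (R + S) (k%:R / 2)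
     then mono (((j * P' + S) * (j * P + R))%:~R / n.+1%:R) else 0))))); last first.
  move=> k kl; rewrite stringfE //; last by lia.
  rewrite (@qsumE _ _ _ (fun j => mono ((j * (j * P * P' + P' * R - P * S))%:~R / n.+1%:R)));
    [|by move=> j _; rewrite qpowE|by apply: summable_sub; exact: qcoercive_summable c1].
  rewrite (@qsumE _ _ _ (fun j => mono (((j * P' + S) * (j * P + R))%:~R / n.+1%:R)));
    [|by move=> j _; rewrite qpowE|by apply: summable_sub; exact: qcoercive_summable c2].
  by rewrite qsubE qmulE; congr coef; ring.
by rewrite qmulE -!mulr_sumr monoVK.
Qed.

(** * The change of variables from m to x *)

Lemma sum_odd_unit (N c k : nat) : (k < N)%N ->
  \sum_(0 <= i < N) (k.+1 == (c + 1 + 2 * i)%N)%:R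
  = ((c <= k)%N && ~~ odd (k - c))%:R :> int.
Proof.
move=> kN; rewrite big_mkord; case: (boolP (_ && _)) => [/andP[ck ev]|H].
  have lt : ((k - c)./2 < N)%N by lia.
  rewrite (bigD1 (Ordinal lt)) //= big1 ?addr0 => [|i].
    by have -> : (k.+1 == c + 1 + 2 * (k - c)./2)%N by apply/eqP; lia.
  rewrite -val_eqE /= => ne; have -> // : (k.+1 == c + 1 + 2 * i)%N = false.
  by apply/eqP => E; move/eqP: ne; apply; lia.
rewrite big1 // => i _; have -> // : (k.+1 == c + 1 + 2 * i)%N = false.
by apply/eqP => E; move/negP: H; apply; lia.
Qed.

Lemma parityQE n l d (k : 'I_n.+1) : (parityQ n.+1 l d) k 0
  = ((l <= k)%N && ~~ odd (k - l))%:R + (d + 1) * (~~ odd k)%:R.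
Proof.
have lt := ltn_ord k; rewrite /parityQ !mxE !summxE.
rewrite (eq_bigr (fun i => (k.+1 == (l + 1 + 2 * i)%N)%:R)); last first.
  by move=> i _; rewrite mxE.
rewrite sum_odd_unit // (eq_bigr (fun i => (k.+1 == (0 + 1 + 2 * i)%N)%:R)); last first.
  by move=> i _; rewrite mxE.
by rewrite sum_odd_unit // subn0.
Qed.

Section Vectors.
Variables (n l : nat) (d : int) (m : 'cV[nat]_n.+1).
Hypothesis mQ : m \in parity_set (parityQ n.+1 l d).

Let mc (j : nat) : int := (Defs.coord m j)%:Z.
Local Notation e := (eseq l d).

(** Modulo 2 the vector Q consists of the partial sums j d + min(j, l) of the e_j; this is what
    makes the x_j integers. *)
Lemma parity_psum j : (j <= n.+1)%N -> (2 %| mc j - psum e j)%Z.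
Proof.
case: j => [|k] lt; first by rewrite /mc coordv0 psum0.
have := mQ; rewrite in_setE => /(_ (Ordinal lt)); rewrite parityQE /=.
rewrite psum_eseq /mc (coordvS m (Ordinal lt)).
move: (m _ _) => mk; have := odd_double_half k; move: (odd k) (k./2) => o u kE.
have -> : k.+1%:Z * d = 2 * (u%:Z * d) + o%:Z * d + d by rewrite -kE; lia.
case: o kE => kE; case: (leqP l k) => lk; rewrite ?(mulr1n, mulr0n); lia.
Qed.

Definition of_vec : tow n := mk n (fun j => ((mc j.+1 - mc j - e j) %/ 2)%Z).

Lemma crd_of_vec j : (j <= n)%N ->
  2 * crd of_vec j = mc j.+1 - mc j - e j.
Proof.
move=> le; rewrite crd_mk //; have := parity_psum (leqW le).
have := @parity_psum j.+1 le; rewrite psumS; lia.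
Qed.

Lemma psum_of_vec j : (j <= n.+1)%N ->
  2 * psum (crd of_vec) j + psum e j = mc j.
Proof.
elim: j => [|j IHj] lt; first by rewrite !psum0 /mc coordv0.
have := IHj (ltnW lt); have := crd_of_vec lt; rewrite !psumS; lia.
Qed.

Let f (j : nat) : rat := (Defs.coord m j)%:R.

Let toQE : toQ m = \col_(i < n.+1) f i.+1.
Proof. by apply/colP => i; rewrite !mxE /f coordvS. Qed.

Let f0 : f 0 = 0. Proof. by rewrite /f coordv0. Qed.
Let fn : f n.+2 = 0. Proof. by rewrite /f coordv_out. Qed.

Let fE (j : nat) : f j = (mc j)%:~R. Proof. by []. Qed.

(** Summation by parts. For g = m and k = N the last product is 0 and the square m_N^2 is
    isolated. *)
Lemma quad_sum (g : nat -> rat) k : g 0%N = 0 ->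
  \sum_(i < k) (2 * g i.+1 - g i - g i.+2) * g i.+1
  = \sum_(i < k) (g i.+1 - g i) ^+ 2 + g k ^+ 2 - g k * g k.+1.
Proof.
move=> g0; elim: k => [|k IHk]; first by rewrite !big_ord0 g0; ring.
by rewrite !big_ord_recr /= IHk; ring.
Qed.

(** The sum of the e_j^2 / 4, left over when (2 x_j + e_j)^2 / 4 is expanded. *)
Definition eseq_sqr : rat :=
  (n.+1%:R * d%:~R ^+ 2 + 2 * d%:~R * l%:R + l%:R) / 4.

Lemma bilin_cartan (ln : (l <= n)%N) : bilin (toQ m) (cartan n.+1) (toQ m) / 4
  = (sqr_exp e (crd of_vec) n.+1)%:~R + eseq_sqr + (mc n.+1)%:~R ^+ 2 / 4.
Proof.
rewrite bilinE; last exact: cartan_tr.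
rewrite {1}toQE cartan_col //.
rewrite (eq_bigr (fun i : 'I_n.+1 => (2 * f i.+1 - f i - f i.+2) * f i.+1)); last first.
  by move=> i _; rewrite !mxE /f coordvS.
rewrite quad_sum // fn mulr0 subr0 -fE.
have -> : \sum_(i < n.+1) (f i.+1 - f i) ^+ 2
    = (sqr_exp e (crd of_vec) n.+1)%:~R * 4 + (psum (fun j => e j ^+ 2) n.+1)%:~R.
  rewrite /sqr_exp /psum !rmorph_sum /= mulr_suml -big_split /=.
  apply: eq_bigr => i _; have lt : (i <= n)%N by rewrite -ltnS.
  have -> : f i.+1 - f i = (2 * crd of_vec i + e i)%:~R.
    by rewrite crd_of_vec // !fE -rmorphB; congr (_%:~R); ring.
  by rewrite -[4]/(4%:~R) -rmorphM -rmorphXn -rmorphD; congr (_%:~R); ring.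
have -> : psum (fun j => e j ^+ 2) n.+1 = n.+1%:Z * d ^+ 2 + 2 * d * l%:Z + l%:Z.
  have : (l <= n.+1)%N by apply: leqW.
  have -> : forall k, psum (fun j => e j ^+ 2) k
      = k%:Z * d ^+ 2 + 2 * d * (minn k l)%:Z + (minn k l)%:Z.
    elim=> [|k IHk]; first by rewrite psum0 min0n; ring.
    rewrite psumS IHk /eseq; have -> : k.+1%:Z = k%:Z + 1 by lia.
    have [kl|kl] := boolP (k < l)%N.
      have -> : minn k.+1 l = (k + 1)%N by lia.
      have -> : minn k l = k by lia.
      by rewrite PoszD (_ : (true : nat)%:Z = 1 :> int) // expr2; lia.
    have -> : minn k.+1 l = l by lia.
    have -> : minn k l = l by lia.
    by rewrite (_ : (false : nat)%:Z = 0 :> int) // addr0; ring.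
  by move=> le; have -> : minn n.+1 l = l by lia.
rewrite /eseq_sqr !(rmorphD, rmorphM, rmorphXn) /=.
by field.
Qed.

Lemma coord_nvec (i : nat) : (i < n)%N ->
  Defs.coord (nvec l m) i.+1 = (crd of_vec i.+1 - crd of_vec i)%:~R.
Proof.
move=> lt; have lt' : (i < n.+1)%N by exact: ltnW.
rewrite (coordvS (nvec l m) (Ordinal lt')).
have incE : incidence n.+1 *m toQ m = 2%:M *m toQ m - cartan n.+1 *m toQ m.
  by rewrite /cartan mulmxBl opprB addrC subrK.
rewrite /nvec incE mul_scalar_mx {2}toQE cartan_col // toQE !mxE.
have := crd_of_vec (ltnW lt); have := crd_of_vec lt; rewrite /eseq => E1 E2.
apply: (@mulfI _ (2 : rat)) => //.
have -> : 2 * (crd of_vec i.+1 - crd of_vec i)%:~R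
    = (2 * crd of_vec i.+1 - 2 * crd of_vec i)%:~R :> rat.
  by rewrite -mulrBr rmorphM.
rewrite E1 E2 !fE /=.
have -> : (i.+1 == l)%:R = (i < l)%N%:Z%:~R - (i.+1 < l)%N%:Z%:~R :> rat.
  by rewrite -rmorphB -[LHS]/((i.+1 == l)%N%:Z%:~R); congr (_%:~R); lia.
rewrite !(rmorphD, rmorphN, rmorphB) /=; by field.
Qed.

Lemma qbinom_prod :
  \big[qmul/qone]_(1 <= j < n.+1)
      qbinom ((Defs.coord m j)%:R + Defs.coord (nvec l m) j) (Defs.coord m j)%:R
  = (\prod_(j < n) gbin (crd of_vec j.+1 - crd of_vec j)
       (2 * psum (crd of_vec) j.+1 + psum e j.+1) : ser).
Proof.
rewrite big_add1 big_mkord; apply: big_qmulE => i _.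
rewrite coord_nvec // psum_of_vec; last exact: ltnW (ltn_ord i).
by rewrite -qbinomE (addrC _ (mc i.+1)) (rmorphD _ (mc i.+1)).
Qed.

End Vectors.

(** * Summation over the bosonic index *)

Lemma qcoercive_lbound kappa : qcoercive kappa -> exists c, forall j, c <= kappa j.
Proof.
move=> /(_ 0) /finite_seqP[s sE].
have [c cP] : exists c, forall j : int, j \in s -> c <= kappa j.
  elim: s {sE} => [|a s [c cP]]; first by exists 0.
  exists (Num.min (kappa a) c) => j; rewrite inE => /orP[/eqP->|/cP le].
    by rewrite ge_min lexx.
  by rewrite ge_min le orbT.
exists (Num.min 0 c) => j; rewrite ge_min.
have [//|lt] := leP 0 (kappa j); rewrite cP //.
suff : [set` s] j by [].
by rewrite -sE /=; exact: ltW.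
Qed.

Section FermionSums.
Variables (n l : nat) (d : int) (kappa : int -> rat) (B : int -> int).
Hypotheses (ln : (l <= n)%N) (ck : qcoercive kappa).
Local Notation e := (eseq l d).

(** [kappa j] and [B j] are the data of the j-th bosonic term; both halves of the bosonic form are
    instances. *)
Definition fermion_pair (i : tow n) (j : int) : ser :=
  mono (kappa j) * (fermion n e (crd i) *
    (iqp (psum (crd i) n.+1 - B j) * iqp (psum (crd i) n.+1 + B j + psum e n.+1))).

Lemma fermion_pair_summable :
  summable (fun ij : tow n * int => fermion_pair ij.1 ij.2).
Proof.
have [w [C [cw w0 gW]]] := @tow_coercive n e (fun j _ => eseq_mono l d j).
have [c cP] := qcoercive_lbound ck.
apply: (@summable_vge _ _ (fun ij => kappa ij.2 + (w ij.1 - C)%:~R)); last first.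
  move=> [i j]; apply: vgeM; first exact: vge_mono.
  by apply: vgzMr (vgz_iqp2 _ _); case: (gW i).
move=> x; apply: sub_finite_set
  (finite_setX (cw (Num.ceil (x - c) + C)) (ck (x + C%:~R))) => -[i j] /= le.
have := cP j => cj; split => /=.
  have : (w i - C)%:~R <= x - c by lra.
  move=> /(fun h => le_trans h (ceil_ge _)).
  by rewrite ler_int lerBlDr.
have : (0 : rat) <= (w i)%:~R by rewrite ler0z.
move: le; rewrite rmorphB /=; lra.
Qed.

Definition string_pair (j : int) : ser :=
  mono (kappa j + string_shift n l d (B j)) * string_sum n l (- (2 * B j + l%:Z)).

Lemma string_pairE j :
  string_pair j = qoo * lsum (fun i => fermion_pair i j).
Proof.
rewrite /string_pair monoD -mulrA -string_sum_spinon // /spinon_fam.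
rewrite spinon_fermion; last by move=> k _; exact: eseq_mono.
rewrite mulrCA; congr (_ * _); rewrite lsumM; first by [].
apply: eq_summable (summableM (mono (- kappa j))
  (summable_row (fun j i => fermion_pair i j) (summable_swap fermion_pair_summable) j)) => i.
by rewrite /fermion_pair monoVK.
Qed.

Lemma string_pair_summable : summable string_pair.
Proof.
apply: eq_summable (summableM qoo (summable_lsum (fun j i => fermion_pair i j)
  (summable_swap fermion_pair_summable))) => j.
by rewrite string_pairE.
Qed.

Lemma fermion_string :
  lsum (fun i => lsum (fermion_pair i)) = durfee 0 * lsum string_pair.
Proof.
rewrite (lsum_exchange fermion_pair fermion_pair_summable).
rewrite (eq_lsum string_pairE) -lsumM.
  by rewrite mulrA [durfee 0 * _]mulrC durfee_qoo mul1r.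
exact: (summable_lsum (fun j i => fermion_pair i j) (summable_swap fermion_pair_summable)).
Qed.

(** A negative m_j with j < N is the lower entry of a q-binomial. A negative m_N makes X - B or X +
    B + E negative, as these add up to m_N. Hence the sum over all integral x is a sum over
    nonnegative m. *)
Lemma fermion_pair_eq0 (i : tow n) k j : (k < n.+1)%N ->
  2 * psum (crd i) k.+1 + psum e k.+1 < 0 -> fermion_pair i j = 0.
Proof.
rewrite ltnS leq_eqVlt => /orP[/eqP ->|kn] neg; rewrite /fermion_pair.
  have [le|lt] := leP 0 (psum (crd i) n.+1 - B j)%R; last first.
    by rewrite (iqp_neg lt); ring.
  by rewrite (@iqp_neg (_ + _ + _)); [ring|lia].
rewrite /fermion (bigD1 (Ordinal kn)) //= /gbin.
rewrite (@iqp_neg (2 * psum (crd i) k.+1 + psum e k.+1)) //.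
by rewrite mulr0 mulr0 mul0r mulr0 mul0r mulr0.
Qed.

End FermionSums.

Lemma of_vec_inj n l d :
  set_inj (parity_set (parityQ n.+1 l d)) (@of_vec n l d).
Proof.
move=> m m' mQ m'Q E; apply/colP => k; have lt := ltn_ord k.
have := psum_of_vec mQ lt; rewrite E psum_of_vec // !coordvS.
by move=> [].
Qed.

Lemma of_vec_supp n l d (i : tow n) :
  ~ (@of_vec n l d @` parity_set (parityQ n.+1 l d)) i ->
  exists2 k, (k < n.+1)%N &
    2 * psum (crd i) k.+1 + psum (eseq l d) k.+1 < 0.
Proof.
move=> ni; apply: contrapT => H; apply: ni.
pose M j := 2 * psum (crd i) j + psum (eseq l d) j.
have M0 j : (j < n.+1)%N -> 0 <= M j.+1.
  by move=> lt; rewrite leNgt; apply/negP => neg; apply: H; exists j.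
pose m : 'cV[nat]_n.+1 := \col_(k < n.+1) absz (M k.+1).
have mE j : (j <= n.+1)%N -> (Defs.coord m j)%:Z = M j.
  case: j => [|j] lt; first by rewrite coordv0 /M !psum0.
  rewrite (coordvS m (Ordinal lt)) mxE /=; have := M0 j lt; lia.
exists m.
  move=> k; have lt := ltn_ord k; have := mE k.+1 lt; rewrite coordvS => ->.
  rewrite parityQE /M psum_eseq.
  have := odd_double_half k; move: (odd k) (k./2) => o u kE.
  have -> : k.+1%:Z * d = 2 * (u%:Z * d) + o%:Z * d + d by rewrite -kE; lia.
  by case: o kE => kE; case: (leqP l k) => lk; rewrite ?(mulr1n, mulr0n); lia.
apply: mk_crd => j le; rewrite !mE //; last exact: leqW.
by rewrite /M !psumS; lia.
Qed.

(** * The bosonic polynomial at 1/q *)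

Lemma qflip_term (L : nat) (A a c : int) : 2 * c = L%:Z - a ->
  qflip (qmul (qpow A%:~R) (qbinom L%:R ((L%:Z - a)%:~R / 2)))
  = mono (a%:~R ^+ 2 / 4 - A%:~R - L%:R ^+ 2 / 4) * gbin (L%:Z - c) c.
Proof.
move=> cE; rewrite -cE rmorphM /= [2 * _]mulrC mulfK //.
have -> : (L%:R : rat) = (L%:Z - c + c)%:~R by rewrite subrK.
rewrite qbinomE qflip_qpow qflip_gbin qpowE qmulE; congr coef.
rewrite mulrA -monoD; congr (mono _ * _).
have -> : a = L%:Z - 2 * c by lia.
rewrite !(rmorphD, rmorphN, rmorphB, rmorphM) /=; by field.
Qed.

Lemma qflip_Mpoly (p p' r s b : int) (L : nat) (a1 a2 c1 c2 A1 A2 : int -> int) :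
  (forall j, a1 j = b - s + 2 * (j * p')) ->
  (forall j, a2 j = b + s + 2 * (j * p')) ->
  (forall j, A1 j = j * (j * p * p' + r * p' - s * p)) ->
  (forall j, A2 j = (j * p + r) * (j * p' + s)) ->
  (forall j, 2 * c1 j = L%:Z - a1 j) -> (forall j, 2 * c2 j = L%:Z - a2 j) ->
  let h a A c j := mono ((a j : int)%:~R ^+ 2 / 4 - (A j : int)%:~R - L%:R ^+ 2 / 4) *
    gbin (L%:Z - c j) (c j) in
  summable (h a1 A1 c1) -> summable (h a2 A2 c2) ->
  qflip (Mpoly p p' r s L b) = (lsum (h a1 A1 c1) - lsum (h a2 A2 c2) : ser).
Proof.
move=> a1E a2E A1E A2E c1E c2E h s1 s2.
have s2N := summableN s2.
rewrite -lsumN // -lsumD // -(qsumTE (F := fun j => qflip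
  (qsub (qmul (qpow (A1 j)%:~R) (qbinom L%:R ((L%:Z - a1 j)%:~R / 2)))
        (qmul (qpow (A2 j)%:~R) (qbinom L%:R ((L%:Z - a2 j)%:~R / 2)))))); first last.
- exact: summableD.
- move=> j; rewrite -qsubE /h -(qflip_term (A1 j) (c1E j)) -(qflip_term (A2 j) (c2E j)).
  by [].
have e1 j : (L%:Z + s - b)%:~R / 2 - (j * p')%:~R = (L%:Z - a1 j)%:~R / 2 :> rat.
  by rewrite a1E !(rmorphD, rmorphN, rmorphB, rmorphM) /=; field.
have e2 j : (L%:Z - s - b)%:~R / 2 - (j * p')%:~R = (L%:Z - a2 j)%:~R / 2 :> rat.
  by rewrite a2E !(rmorphD, rmorphN, rmorphB, rmorphM) /=; field.
apply/funext => x; rewrite /qflip /Mpoly /qsum; apply: eq_fsbigr => j _.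
by rewrite e1 e2 A1E A2E.
Qed.

(** One half of the bosonic form at a time: q^{-L^2/4} cancels the m_N^2/4 of [bilin_cartan], and
    [gbin_iqp] produces the two denominators of [fermion_pair]. *)
Lemma fermi_half n l d (m : 'cV[nat]_n.+1) (kappa : int -> rat) (B : int -> int) :
  (l <= n)%N -> qcoercive kappa -> m \in parity_set (parityQ n.+1 l d) ->
  let L := Defs.coord m n.+1 in
  let c j := psum (crd (of_vec l d m)) n.+1 + B j + psum (eseq l d) n.+1 in
  let h j := mono (kappa j - L%:R ^+ 2 / 4) * gbin (L%:Z - c j) (c j) in
  summable h /\
  mono (bilin (toQ m) (cartan n.+1) (toQ m) / 4) *
   (\prod_(j < n) gbin (crd (of_vec l d m) j.+1 - crd (of_vec l d m) j)
       (2 * psum (crd (of_vec l d m)) j.+1 + psum (eseq l d) j.+1) *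
    (lsum h * iqp L))
  = mono (eseq_sqr n l d) * lsum (fermion_pair l d kappa B (of_vec l d m)).
Proof.
move=> ln ck mQ L c h.
have sh : summable h.
  have [C0 C0P] : exists C0, forall j, vge (h j) (kappa j - C0).
    exists (L%:R ^+ 2 / 4) => j; rewrite -[X in vge _ X]addr0.
    by apply: vgeM; [exact: vge_mono|exact: vgz_gbin].
  apply: summable_vge C0P => x; apply: sub_finite_set (ck (x + C0)) => j /=.
  by rewrite lerBlDr.
split=> //; have LE := psum_of_vec mQ (leqnn _); rewrite -/L in LE.
rewrite (bilin_cartan mQ ln) [lsum h * _]mulrC !mulrA lsumM // lsumM; last first.
  exact: (summable_row _ (fermion_pair_summable n l d B ck)).
apply: eq_lsum => j; rewrite /fermion_pair /h.
have -> : psum (crd (of_vec l d m)) n.+1 - B j = L%:Z - c j.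
  by rewrite -LE /c; ring.
rewrite -/(c j) -(gbin_iqp (subrK (c j) L%:Z)) /fermion /qz.
set Q := sqr_exp _ _ _; set PI := \prod_(_ < _) _.
have -> : mono (Q%:~R + eseq_sqr n l d + L%:Z%:~R ^+ 2 / 4)
  = mono Q%:~R * mono (eseq_sqr n l d) * mono (L%:R ^+ 2 / 4).
  by rewrite -!monoD.
have -> : mono (kappa j - L%:R ^+ 2 / 4) = mono (- (L%:R ^+ 2 / 4)) * mono (kappa j).
  by rewrite -monoD addrC.
have := monoK (L%:R ^+ 2 / 4); set u := mono _; set v := mono _ => uv.
transitivity (u * v * (mono (eseq_sqr n l d) * (mono (kappa j) *
  (mono Q%:~R * PI * (gbin (L%:Z - c j) (c j) * iqp L))))); first by ring.
by rewrite uv mul1r.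
Qed.

Theorem mainTheorem4 (p p' : nat) (n : nat) (nu : nat -> nat)
    (s b r : int) (N l : nat)
    (p_gt0 : (0 < p)%N) (lt_p_p' : (p < p')%N) (lt_p'_2p : (p' < 2 * p)%N)
    (coprime_pp' : coprime p p')
    (nu_contfrac : p'%:R / (p'%:R - p%:R) = 1 + contfrac nu 0 n :> rat)
    (nu0_ge1 : (1 <= nu 0)%N) (nun_ge1 : (1 <= nu n)%N)
    (nu_gt1 : forall j : nat, (1 <= j)%N -> (j <= n - 1)%N -> (1 < nu j)%N)
    (s_length : exists2 sigma : int,
       0 <= sigma <= tk nu n.+1 + 1 & s = tslen nu n sigma)
    (br_cases : br_case nu n b r)
    (b_range : 1 <= b <= p'%:Z - 1) (s_range : 1 <= s <= p'%:Z - 1)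
    (r_range : 1 <= r <= p%:Z - 1)
    (N_ge1 : (1 <= N)%N) (l_ltN : (l < N)%N)
    (parity : (2 %| s + b + N%:Z * (b - r) + l%:Z)%Z)
    (S_range : 1 <= b + N%:Z * (b - r)
                 <= p'%:Z + N%:Z * (p'%:Z - p%:Z) - 1) :
  let lambda := `|b - s| in
  branching p'%:Z (p'%:Z + N%:Z * (p'%:Z - p%:Z)) N s (b + N%:Z * (b - r)) l
  = (qpow (- (l%:R * (N%:R - l%:R) + (N%:R + 1) * lambda%:~R ^+ 2)
             / (4 * N%:R))
     * qsum (parity_set (parityQ N l (b - r)))
         (fermi_term p%:Z p'%:Z r s b l))%QS.
Proof.
case: N N_ge1 l_ltN parity S_range => // N _; rewrite ltnS => ln parity _ lambda.
clear coprime_pp' nu_contfrac nu0_ge1 nun_ge1 nu_gt1 s_length br_cases.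
clear b_range s_range r_range lt_p'_2p.
set d := b - r in parity *; pose P' := p'%:Z + N.+1%:Z * (p'%:Z - p%:Z).
have p'0 : 0 < p'%:Z by lia.
have pp' : 0 < p'%:Z - p%:Z by lia.
have P'0 : 0 < P' by rewrite /P' addr_gt0 // mulr_gt0.
have RS : (2 %| s - (b + N.+1%:Z * d) + l%:Z)%Z by lia.
rewrite (branchingE ln p'0 P'0 RS).
have [q0 qE] := dvdzP parity; pose E := psum (eseq l d) N.+1.
have EE : E = N.+1%:Z * d + l%:Z by rewrite /E psum_eseq (minn_idPr _) // leqW.
pose a1 j := b - s + 2 * (j * p'%:Z); pose a2 j := b + s + 2 * (j * p'%:Z).
pose A1 j := j * (j * p%:Z * p'%:Z + r * p'%:Z - s * p%:Z).
pose A2 j := (j * p%:Z + r) * (j * p'%:Z + s).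
(* The lower entry c = X + B + E with 2c = L - a and L = 2X + E forces 2B = -(a + E); the parity
   hypothesis, s + b + E = 2 q0, makes B an integer. *)
pose B1 j := - (q0 - s + j * p'%:Z); pose B2 j := - (q0 + j * p'%:Z).
have B1E j : 2 * B1 j = - (a1 j + E) by rewrite /B1 /a1 EE; lia.
have B2E j : 2 * B2 j = - (a2 j + E) by rewrite /B2 /a2 EE; lia.
pose k1 j : rat := (a1 j)%:~R ^+ 2 / 4 - (A1 j)%:~R.
pose k2 j : rat := (a2 j)%:~R ^+ 2 / 4 - (A2 j)%:~R.
have lead : 0 < p'%:Z * (p'%:Z - p%:Z) by exact: mulr_gt0.
have ck1 : qcoercive k1.
  have := @quad_coercive _ (p'%:Z * (b - s) - (r * p'%:Z - s * p%:Z))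
    ((b - s)%:~R ^+ 2 / 4) 1 lead ltr01.
  congr qcoercive; apply/funext => j; rewrite /k1 /a1 /A1.
  by rewrite !(rmorphD, rmorphN, rmorphB, rmorphM, rmorphXn) /=; field.
have ck2 : qcoercive k2.
  have := @quad_coercive _ (p'%:Z * (b + s) - p%:Z * s - r * p'%:Z)
    ((b + s)%:~R ^+ 2 / 4 - (r * s)%:~R) 1 lead ltr01.
  congr qcoercive; apply/funext => j; rewrite /k2 /a2 /A2.
  by rewrite !(rmorphD, rmorphN, rmorphB, rmorphM, rmorphXn) /=; field.
pose V := parity_set (parityQ N.+1 l d); pose es := eseq_sqr N l d.
pose Phi (i : tow N) := mono es * (lsum (fermion_pair l d k1 B1 i) - lsum (fermion_pair l d k2 B2 i)).
have fE m : V m -> fermi_term p%:Z p'%:Z r s b l m = Phi (of_vec l d m).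
  move=> Vm; have mV : m \in V by rewrite in_setE.
  rewrite /fermi_term qpowE (qbinom_prod mV) qinv_qpoch.
  have LE := psum_of_vec mV (leqnn _).
  have [s1 h1] := fermi_half B1 ln ck1 mV; have [s2 h2] := fermi_half B2 ln ck2 mV.
  rewrite (@qflip_Mpoly p%:Z p'%:Z r s b _ a1 a2
    (fun j => psum (crd (of_vec l d m)) N.+1 + B1 j + psum (eseq l d) N.+1)
    (fun j => psum (crd (of_vec l d m)) N.+1 + B2 j + psum (eseq l d) N.+1) A1 A2) //.
  - rewrite !qmulE; congr coef.
    by rewrite mulrBl !mulrBr h1 h2 -mulrBr.
  - by move=> j; rewrite -LE -/E; have := B1E j; lia.
  - by move=> j; rewrite -LE -/E; have := B2E j; lia.
have sf1 := summable_lsum (fermion_pair l d k1 B1) (fermion_pair_summable N l d B1 ck1).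
have sf2 := summable_lsum (fermion_pair l d k2 B2) (fermion_pair_summable N l d B2 ck2).
have sf2N := summableN sf2.
have sPhi : summable Phi by apply: summableM; exact: summableD.
have -> : qsum V (fermi_term p%:Z p'%:Z r s b l) = lsum Phi.
  rewrite (qsumE fE); last exact: summable_reindex (@of_vec_inj N l d) sPhi.
  congr coef; apply/esym/lsum_reindex => //; first exact: of_vec_inj.
  move=> i /of_vec_supp[k kN neg]; rewrite /Phi !lsum0 ?subrr ?mulr0 // => j;
    exact: fermion_pair_eq0 neg.
have -> : lsum Phi = mono es * (durfee 0 *
    (lsum (string_pair N l d k1 B1) - lsum (string_pair N l d k2 B2))).
  rewrite /Phi -lsumM; last exact: summableD.
  congr (_ * _); rewrite (lsumD sf1 sf2N) (lsumN sf2) [RHS]mulrBr.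
  by rewrite (fermion_string d B1 ln ck1) (fermion_string d B2 ln ck2).
rewrite qpowE qmulE; congr coef; set pref := (X in mono X).
have sp1 := string_pair_summable d B1 ln ck1.
have sp2 := string_pair_summable d B2 ln ck2.
have N1 : 1 + N%:R != 0 :> rat by rewrite nat1r pnatr_eq0.
have lam : lambda%:~R ^+ 2 = (b - s)%:~R ^+ 2 :> rat.
  have lam2 : lambda ^+ 2 = (b - s) ^+ 2 by exact: real_normK (num_real _).
  by rewrite -[LHS]rmorphXn lam2 rmorphXn.
have SE B : string_shift N l d B = (B%:~R ^+ 2 + l%:R * B%:~R) / N.+1%:R
    + d%:~R * B%:~R :> rat.
  by rewrite /string_shift !(rmorphD, rmorphM, rmorphXn).
have BQ1 j : (B1 j)%:~R = - (a1 j + E)%:~R / 2 :> rat.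
  by rewrite -rmorphN -B1E rmorphM mulrC mulKf.
have BQ2 j : (B2 j)%:~R = - (a2 j + E)%:~R / 2 :> rat.
  by rewrite -rmorphN -B2E rmorphM mulrC mulKf.
have -> : lsum (fun j => mono ((j * (j * p'%:Z * P' + P' * s - p'%:Z *
      (b + N.+1%:Z * d)))%:~R / N.+1%:R) * string_sum N l (s - (b + N.+1%:Z * d) + 2 * P' * j))
    = mono (pref + es) * lsum (string_pair N l d k1 B1).
  (* In this half the j-th term of the branching function matches the bosonic term -j, with the
     opposite string index modulo 2N; [string_sumN] absorbs the sign. *)
  rewrite lsumM // (lsum_bij (inv_bij opprK) (summableM _ sp1)).
  apply: eq_lsum => j; rewrite /string_pair mulrA -monoD; congr (mono _ * _).
    rewrite SE /k1 !BQ1 /pref lam /es /eseq_sqr.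
    rewrite EE /a1 /A1 /P' /d !(rmorphD, rmorphN, rmorphB, rmorphM, rmorphXn) /=.
    by field.
  have -> : s - (b + N.+1%:Z * d) + 2 * P' * j
      = - (a1 (- j) + N.+1%:Z * d) + 2 * N.+1%:Z * ((p'%:Z - p%:Z) * j).
    by rewrite /a1 /P'; ring.
  rewrite string_sumD2N string_sumN //; last by rewrite /a1; lia.
  congr (string_sum N l _); have := B1E (- j); rewrite EE => ->; ring.
have -> : lsum (fun j => mono (((j * P' + (b + N.+1%:Z * d)) * (j * p'%:Z + s))%:~R
      / N.+1%:R) * string_sum N l (s + (b + N.+1%:Z * d) + 2 * P' * j))
    = mono (pref + es) * lsum (string_pair N l d k2 B2).
  rewrite lsumM //; apply: eq_lsum => j; rewrite /string_pair mulrA -monoD.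
  congr (mono _ * _).
    rewrite SE /k2 !BQ2 /pref lam /es /eseq_sqr.
    rewrite EE /a2 /A2 /P' /d !(rmorphD, rmorphN, rmorphB, rmorphM, rmorphXn) /=.
    by field.
  have -> : s + (b + N.+1%:Z * d) + 2 * P' * j
      = (a2 j + N.+1%:Z * d) + 2 * N.+1%:Z * ((p'%:Z - p%:Z) * j).
    by rewrite /a2 /P'; ring.
  rewrite string_sumD2N.
  congr (string_sum N l _); have := B2E j; rewrite EE => ->; ring.
by rewrite monoD; ring.
Qed.
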